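(* Let $0<b<\infty$ and $\Omega_{0,b}=\{x\in\mathbb{R}^2:0<|x|<b\}$. Let $v=(v_1,v_2)\in C^2(\overline{\Omega_{0,b}}\setminus\{0\})$ be a flow solving the steady Euler equations $$v\cdot\nabla v+\nabla p=0\ \text{ and }\ \mathrm{div}\,v=0\ \text{ in }\Omega_{0,b}$$ (for some pressure $p$), with the boundary condition $v\cdot e_r=0$ on $C_b$, and such that $$\{x\in\overline{\Omega_{0,b}}\setminus\{0\}:|v(x)|=0\}\subsetneq C_b$$ and $$\int_{C_\varepsilon}|v\cdot e_r|\to0\ \text{ as }\varepsilon\to0^+.$$ Then $|v|>0$ in $\overline{\Omega_{0,b}}\setminus\{0\}$ and $v$ is a circular flow, namely there is a $C^2((0,b])$ function $V$ with constant strict sign (that is, $V>0$ on all of $(0,b]$ or $V<0$ on all of $(0,b]$) such that $v(x)=V(|x|)\,e_\theta(x)$ for all $x\in\overline{\Omega_{0,b}}\setminus\{0\}$.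
   Context: $|\cdot|$ is the Euclidean norm in $\mathbb{R}^2$; $C_r=\{x\in\mathbb{R}^2:|x|=r\}$, and integrals over $C_r$ are with respect to arc length. For $x=(x_1,x_2)\neq0$, $e_r(x)=x/|x|$ and $e_\theta(x)=(-x_2/|x|,x_1/|x|)$. $E\subsetneq F$ means $E\subset F$ and $E\neq F$ (in particular $E=\emptyset$ is allowed). Solutions $(v,p)$ of the Euler equations are understood in the classical sense: $v$ and $p$ are (at least) of class $C^1$ in the open domain and the equations hold at every point. A flow $v$ is called circular if $v(x)$ is parallel to $e_\theta(x)$ at every point $x$ of the domain, i.e. $v\cdot e_r=0$ there. The flow $v$ is not assumed to be bounded, nor to be defined at $0$. *)

(* Defs.v *)
From Stdlib Require Import Reals.
From Coquelicot Require Import Coquelicot.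
Local Open Scope R_scope.

Definition enorm (x : R * R) : R := sqrt (fst x ^ 2 + snd x ^ 2).
Definition dot (x y : R * R) : R := fst x * fst y + snd x * snd y.

Definition e_r (x : R * R) : R * R := (fst x / enorm x, snd x / enorm x).
Definition e_theta (x : R * R) : R * R := (- snd x / enorm x, fst x / enorm x).

Definition circle (r : R) (x : R * R) : Prop := enorm x = r.
Definition punctured_disc (b : R) (x : R * R) : Prop := 0 < enorm x < b.
(* The closure of [punctured_disc b] with the origin removed. *)
Definition closed_punctured_disc (b : R) (x : R * R) : Prop := 0 < enorm x <= b.

Definition strict_subset {T : Type} (A B : T -> Prop) : Prop :=
  (forall x, A x -> B x) /\ ~ (forall x, A x <-> B x).

Definition d1 (f : R * R -> R) (x : R * R) : R :=
  Derive (fun t => f (t, snd x)) (fst x).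
Definition d2 (f : R * R -> R) (x : R * R) : R :=
  Derive (fun t => f (fst x, t)) (snd x).

(* For open [D]. Existence of the partial derivatives is required explicitly,
   since [Derive] is total. *)
Definition C1_on (D : R * R -> Prop) (f : R * R -> R) : Prop :=
  forall x, D x ->
    ex_derive (fun t => f (t, snd x)) (fst x) /\
    ex_derive (fun t => f (fst x, t)) (snd x) /\
    continuous (d1 f) x /\ continuous (d2 f) x.

Definition C2_on (D : R * R -> Prop) (f : R * R -> R) : Prop :=
  C1_on D f /\ C1_on D (d1 f) /\ C1_on D (d2 f).

Definition extends_continuously {T : UniformSpace} (D E : T -> Prop)
  (f : T -> R) : Prop :=
  exists g : T -> R, (forall x, D x -> g x = f x) /\ continuous_on E g.

(* C^2 regularity up to the part of the boundary contained in [E], for [D] open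
   and [D] included in [E] included in the closure of [D]: [f] is C^2 in [D],
   it is continuous on [E], and its derivatives of order 1 and 2 in [D] extend
   continuously to [E]. Values of [f] outside [E] play no role. *)
Definition C2_up_to (D E : R * R -> Prop) (f : R * R -> R) : Prop :=
  C2_on D f /\ continuous_on E f /\
  extends_continuously D E (d1 f) /\
  extends_continuously D E (d2 f) /\
  extends_continuously D E (d1 (d1 f)) /\
  extends_continuously D E (d1 (d2 f)) /\
  extends_continuously D E (d2 (d1 f)) /\
  extends_continuously D E (d2 (d2 f)).

(* One-variable analogue on (0,b]; continuity of the derivatives in (0,b) is part
   of the last two clauses. *)
Definition C2_left_open (b : R) (V : R -> R) : Prop :=
  (forall r, 0 < r < b -> ex_derive V r /\ ex_derive (Derive V) r) /\
  continuous_on (fun r => 0 < r <= b) V /\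
  extends_continuously (fun r => 0 < r < b) (fun r => 0 < r <= b) (Derive V) /\
  extends_continuously (fun r => 0 < r < b) (fun r => 0 < r <= b)
    (Derive (Derive V)).

Definition comp1 (v : R * R -> R * R) (x : R * R) : R := fst (v x).
Definition comp2 (v : R * R -> R * R) (x : R * R) : R := snd (v x).

Definition steady_Euler (D : R * R -> Prop) (v : R * R -> R * R)
  (p : R * R -> R) : Prop :=
  C1_on D (comp1 v) /\ C1_on D (comp2 v) /\ C1_on D p /\
  forall x, D x ->
    comp1 v x * d1 (comp1 v) x + comp2 v x * d2 (comp1 v) x + d1 p x = 0 /\
    comp1 v x * d1 (comp2 v) x + comp2 v x * d2 (comp2 v) x + d2 p x = 0 /\
    d1 (comp1 v) x + d2 (comp2 v) x = 0.

Definition circle_integral (f : R * R -> R) (r : R) : R :=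
  RInt (fun t => f (r * cos t, r * sin t) * r) 0 (2 * PI).

Definition circular (D : R * R -> Prop) (v : R * R -> R * R) : Prop :=
  forall x, D x -> dot (v x) (e_r x) = 0.

(* Main.v *)
Require Import Defs.
From Stdlib Require Import Reals.
From Coquelicot Require Import Coquelicot.
From Stdlib Require Import Lra Psatz Classical ClassicalEpsilon.
Local Open Scope R_scope.

(* Since v is tangent to C_b, the form v_2 dx - v_1 dy has a primitive u, constant (say 0)
   on C_b. It has no critical point, and the flux condition makes its oscillation on
   C_r tend to 0 as r -> 0; by the maximum principle u is, up to sign, positive and
   asymptotically maximal at 0.

   The vorticity omega = Delta u is transported, hence a function of u: for a bump
   function chi supported near the level s, chi(u) omega du is closed, so it has a
   primitive h, and h is constant on each of {u > s + d} and {u < s - d} because u has no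
   local extremum there. The jump of h across the band can be computed at any point of
   {u = s}, where it is close to omega times the integral of chi. Moving along
   transversals, omega is locally Lipschitz in u, up to the boundary value 0 thanks
   to a non-stagnation point of C_b.

   Moving planes then apply to Delta u = F(u), in the following form: let l be the
   supremum of the abscissas of midpoints of horizontal pairs (P, Q), with P to the
   right of Q and u(P) >= u(Q). If l > 0, a limit pair contradicts the strong maximum
   principle (P <> Q), Hopf's lemma (P = Q inside the disc) or the inward slope of u
   near C_b. So u(x, y) <= u(-x, y) for x > 0, in every orthonormal frame, and u is
   radial. *)

(** * Calculus in the plane *)

(** Stagnation points are allowed on C_b, and this shapes the analysis near C_b. There grad u
    vanishes, so neither an inward slope nor a transversal is at hand. Both are recovered from one
    non-stagnation point: the level 0 is reached transversally there, and since omega depends on u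
    alone, the resulting bound |omega - w| <= C u holds along the whole of C_b. If w <= 0, u is a
    supersolution near C_b and Hopf's lemma forbids stagnation; if w > 0, the Hessian at a
    stagnation point is w times the projection on the normal, and the slope reappears at second
    order.

    At the origin u has no value and may tend to infinity, so only comparisons with nearby values of
    u are used. Level sets are never shown to be connected or to be closed streamlines: the jump of
    h is attached to a whole level at once, whichever point serves to cross it. Taking the supremum
    of the bad positions in the moving planes replaces the usual start of the planes near l = b. *)

Definition open2 (D : R -> R -> Prop) : Prop :=
  forall x y, D x y -> locally_2d D x y.

(** The partial derivatives are named functions rather than [Derive] terms, so that gradients of
    reflected, rotated or composed functions are given by formulas. Their continuity makes [f]
    differentiable in two variables ([has_grad_differentiable]). *)
Definition has_grad (D : R -> R -> Prop) (f fx fy : R -> R -> R) : Prop :=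
  forall x y, D x y ->
    is_derive (fun t => f t y) x (fx x y) /\
    is_derive (fun t => f x t) y (fy x y) /\
    continuity_2d_pt fx x y /\ continuity_2d_pt fy x y.

Lemma is_derive_eq (f : R -> R) (x l l' : R) :
  is_derive f x l -> l = l' -> is_derive f x l'.
Proof. now intros H <-. Qed.

Lemma derive_minus (f g : R -> R) (x a b : R) :
  is_derive f x a -> is_derive g x b -> is_derive (fun t => f t - g t) x (a - b).
Proof. intros Hf Hg. exact (is_derive_minus f g x a b Hf Hg). Qed.

Lemma derive_plus (f g : R -> R) (x a b : R) :
  is_derive f x a -> is_derive g x b -> is_derive (fun t => f t + g t) x (a + b).
Proof. intros Hf Hg. exact (is_derive_plus f g x a b Hf Hg). Qed.

Lemma derive_opp (f : R -> R) (x a : R) :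
  is_derive f x a -> is_derive (fun t => - f t) x (- a).
Proof. intros Hf. exact (is_derive_opp f x a Hf). Qed.

Lemma derive_scal (f : R -> R) (k x a : R) :
  is_derive f x a -> is_derive (fun t => k * f t) x (k * a).
Proof. intros Hf. exact (is_derive_scal f x k a Hf). Qed.

Lemma derive_mult (f g : R -> R) (x a b : R) :
  is_derive f x a -> is_derive g x b ->
  is_derive (fun t => f t * g t) x (a * g x + f x * b).
Proof. intros Hf Hg. apply (is_derive_mult f g x a b Hf Hg). intros; apply Rmult_comm. Qed.

Lemma derive_comp (f g : R -> R) (x a b : R) :
  is_derive f (g x) a -> is_derive g x b -> is_derive (fun t => f (g t)) x (b * a).
Proof. intros Hf Hg. exact (is_derive_comp f g x a b Hf Hg). Qed.

Lemma is_derive_continuity_pt (f : R -> R) (x l : R) :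
  is_derive f x l -> continuity_pt f x.
Proof.
  intros H. apply derivable_continuous_pt. exists l. now apply is_derive_Reals.
Qed.

Lemma mvt (f df : R -> R) (a b : R) :
  a < b ->
  (forall t, a < t < b -> is_derive f t (df t)) ->
  (forall t, a <= t <= b -> continuity_pt f t) ->
  exists c, a < c < b /\ f b - f a = df c * (b - a).
Proof.
  intros ab Hd Hc.
  assert (pr : forall c, a < c < b -> derivable_pt f c).
  { intros c Hcc. exists (df c). apply is_derive_Reals. now apply Hd. }
  destruct (MVT f id a b pr (fun c _ => derivable_pt_id c) ab Hc) as [c [P E]].
  - intros c _. apply derivable_continuous_pt, derivable_pt_id.
  - exists c. split; [exact P|].
    assert (E1 : derive_pt f c (pr c P) = df c).
    { apply derive_pt_eq_0. apply is_derive_Reals. now apply Hd. }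
    rewrite E1 in E.
    assert (E2 : derive_pt id c (derivable_pt_id c) = 1) by apply derive_pt_id.
    rewrite E2 in E. unfold id in E. lra.
Qed.

Lemma mvt_derive (f df : R -> R) (a b : R) :
  a < b -> (forall t, a <= t <= b -> is_derive f t (df t)) ->
  exists c, a < c < b /\ f b - f a = df c * (b - a).
Proof.
  intros ab Hd. apply mvt; [exact ab| |].
  - intros t Ht. apply Hd. lra.
  - intros t Ht. apply (is_derive_continuity_pt _ _ (df t)). now apply Hd.
Qed.

Lemma mvt_sym (f df : R -> R) (a b : R) :
  (forall t, Rabs (t - a) <= Rabs (b - a) -> is_derive f t (df t)) ->
  exists c, Rabs (c - a) <= Rabs (b - a) /\ f b - f a = df c * (b - a).
Proof.
  intros Hd.
  destruct (MVT_cor4 f df a (Rabs (b - a)) Hd b (Rle_refl _)) as [c [E L]].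
  now exists c.
Qed.

(** The increment from (x, y) to (u, v) is split into a vertical step at abscissa x and a horizontal
    step at height v; the mean value theorem handles each. *)
Lemma has_grad_differentiable D f fx fy x y :
  open2 D -> has_grad D f fx fy -> D x y ->
  differentiable_pt_lim f x y (fx x y) (fy x y).
Proof.
  intros oD H Dxy eps.
  destruct (oD x y Dxy) as [d0 HD].
  destruct (H x y Dxy) as [_ [_ [Cx Cy]]].
  destruct (Cx (pos_div_2 eps)) as [d1 H1].
  destruct (Cy (pos_div_2 eps)) as [d2 H2].
  set (d := Rmin d0 (Rmin d1 d2)).
  assert (dpos : 0 < d) by (unfold d; repeat apply Rmin_pos; apply cond_pos).
  assert (Ld : d <= d0 /\ d <= d1 /\ d <= d2).
  { unfold d. split; [apply Rmin_l|split].
    - eapply Rle_trans; [apply Rmin_r|apply Rmin_l].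
    - eapply Rle_trans; [apply Rmin_r|apply Rmin_r]. }
  exists (mkposreal d dpos). simpl. intros u v Hu Hv.
  assert (Z : Rabs (x - x) < d) by (rewrite Rminus_diag, Rabs_R0; exact dpos).
  destruct (mvt_sym (fun t => f t v) (fun t => fx t v) x u) as [c [Lc Ec]].
  { intros t Ht. apply H. apply HD; lra. }
  destruct (mvt_sym (fun t => f x t) (fun t => fy x t) y v) as [e [Le Ee]].
  { intros t Ht. apply H. apply HD; lra. }
  replace (f u v - f x y - (fx x y * (u - x) + fy x y * (v - y))) with
    ((fx c v - fx x y) * (u - x) + (fy x e - fy x y) * (v - y)) by nra.
  assert (A1 : Rabs (fx c v - fx x y) < eps / 2) by (apply H1; lra).
  assert (A2 : Rabs (fy x e - fy x y) < eps / 2) by (apply H2; lra).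
  eapply Rle_trans; [apply Rabs_triang|]. rewrite !Rabs_mult.
  assert (M1 := Rmax_l (Rabs (u - x)) (Rabs (v - y))).
  assert (M2 := Rmax_r (Rabs (u - x)) (Rabs (v - y))).
  assert (P1 := Rabs_pos (u - x)). assert (P2 := Rabs_pos (v - y)).
  assert (P3 := Rabs_pos (fx c v - fx x y)). assert (P4 := Rabs_pos (fy x e - fy x y)).
  set (m := Rmax (Rabs (u - x)) (Rabs (v - y))) in *.
  apply Rle_trans with (eps / 2 * m + eps / 2 * m); [|lra].
  apply Rplus_le_compat; apply Rmult_le_compat; lra.
Qed.

Lemma has_grad_continuous D f fx fy x y :
  open2 D -> has_grad D f fx fy -> D x y -> continuity_2d_pt f x y.
Proof.
  intros oD H Dxy. apply differentiable_continuity_pt.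
  exists (fx x y), (fy x y). eapply has_grad_differentiable; eauto.
Qed.

Lemma has_grad_comp D f fx fy (g1 g2 : R -> R) (t l1 l2 : R) :
  open2 D -> has_grad D f fx fy -> D (g1 t) (g2 t) ->
  is_derive g1 t l1 -> is_derive g2 t l2 ->
  is_derive (fun s => f (g1 s) (g2 s)) t
    (fx (g1 t) (g2 t) * l1 + fy (g1 t) (g2 t) * l2).
Proof.
  intros oD H Dt H1 H2. apply is_derive_Reals.
  apply derivable_pt_lim_comp_2d; [|now apply is_derive_Reals..].
  eapply has_grad_differentiable; eauto.
Qed.

Lemma continuity_2d_comp (f : R -> R -> R) (g1 g2 : R -> R) (t : R) :
  continuity_2d_pt f (g1 t) (g2 t) -> continuity_pt g1 t -> continuity_pt g2 t ->
  continuity_pt (fun s => f (g1 s) (g2 s)) t.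
Proof.
  intros Hf H1 H2.
  apply continuity_pt_filterlim.
  apply continuity_pt_filterlim in H1. apply continuity_pt_filterlim in H2.
  apply continuity_2d_pt_filterlim in Hf.
  eapply (filterlim_comp_2 (F := locally t)); [exact H1|exact H2|].
  eapply filterlim_filter_le_1; [|exact Hf].
  intros P HP. destruct HP as [e He].
  exists (fun u => ball (g1 t) e u) (fun v => ball (g2 t) e v).
  - now exists e.
  - now exists e.
  - intros u v Hu Hv. apply He. now split.
Qed.

Lemma continuity_2d_comp2 (f g1 g2 : R -> R -> R) (x y : R) :
  continuity_2d_pt f (g1 x y) (g2 x y) ->
  continuity_2d_pt g1 x y -> continuity_2d_pt g2 x y ->
  continuity_2d_pt (fun u v => f (g1 u v) (g2 u v)) x y.
Proof.
  intros Hf H1 H2 eps. destruct (Hf eps) as [d Hd].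
  destruct (H1 d) as [d1 Hd1]. destruct (H2 d) as [d2 Hd2].
  assert (P : 0 < Rmin d1 d2) by (apply Rmin_pos; apply cond_pos).
  exists (mkposreal _ P). simpl. intros u v Hu Hv.
  apply Hd; [apply Hd1|apply Hd2]; eapply Rlt_le_trans;
    try eassumption; first [apply Rmin_l | apply Rmin_r].
Qed.

Lemma cont2_eps (f : R -> R -> R) (x y e : R) :
  continuity_2d_pt f x y -> 0 < e ->
  exists d, 0 < d /\ forall u v, Rabs (u - x) < d -> Rabs (v - y) < d ->
    Rabs (f u v - f x y) < e.
Proof.
  intros H He. destruct (H (mkposreal e He)) as [d Hd].
  exists d. split; [apply cond_pos|exact Hd].
Qed.

Lemma cont1_eps (f : R -> R) (x e : R) :
  continuity_pt f x -> 0 < e ->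
  exists d, 0 < d /\ forall u, Rabs (u - x) < d -> Rabs (f u - f x) < e.
Proof.
  intros H He. destruct (H e He) as [d [Hd0 Hd]].
  exists d. split; [exact Hd0|]. intros u Hu.
  destruct (Req_dec u x) as [->|N].
  - now rewrite Rminus_diag, Rabs_R0.
  - apply (Hd u). split; [|exact Hu]. split; [exact I|]. now apply not_eq_sym.
Qed.

Lemma derive_pos_right (f : R -> R) (x l : R) :
  is_derive f x l -> 0 < l ->
  exists d, 0 < d /\ (forall t, x < t < x + d -> f x < f t) /\
    (forall t, x - d < t < x -> f t < f x).
Proof.
  intros H L. apply is_derive_Reals in H.
  destruct (H l L) as [d Hd]. exists d. split; [apply cond_pos|].
  split; intros t Ht.
  - assert (B := Hd (t - x)). replace (x + (t - x)) with t in B by ring.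
    assert (Q : 0 < t - x) by lra.
    assert (B' : Rabs ((f t - f x) / (t - x) - l) < l).
    { apply B; [lra|]. rewrite Rabs_pos_eq; lra. }
    apply Rabs_def2 in B'. assert (0 < (f t - f x) / (t - x)) by lra.
    assert (0 < (f t - f x) / (t - x) * (t - x)) by (apply Rmult_lt_0_compat; lra).
    replace ((f t - f x) / (t - x) * (t - x)) with (f t - f x) in H1 by (field; lra). lra.
  - assert (B := Hd (t - x)). replace (x + (t - x)) with t in B by ring.
    assert (Q : 0 < x - t) by lra.
    assert (B' : Rabs ((f t - f x) / (t - x) - l) < l).
    { apply B; [lra|]. rewrite Rabs_left; lra. }
    apply Rabs_def2 in B'. assert (0 < (f t - f x) / (t - x)) by lra.
    assert (0 < (f t - f x) / (t - x) * (x - t)) by (apply Rmult_lt_0_compat; lra).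
    replace ((f t - f x) / (t - x) * (x - t)) with (f x - f t) in H1 by (field; lra). lra.
Qed.

Lemma local_min_derive (f : R -> R) (x l d : R) :
  0 < d -> (forall t, Rabs (t - x) < d -> f x <= f t) ->
  is_derive f x l -> l = 0.
Proof.
  intros Hd Hm H.
  destruct (Rtotal_order l 0) as [N|[E|P]]; [|exact E|].
  - assert (H' : is_derive (fun t => - f t) x (- l)) by now apply is_derive_opp in H.
    destruct (derive_pos_right _ _ _ H') as [e [He [R1 _]]]; [lra|].
    set (h := Rmin d e / 2).
    assert (0 < h /\ h < d /\ h < e).
    { unfold h. assert (0 < Rmin d e) by (apply Rmin_pos; lra).
      generalize (Rmin_l d e) (Rmin_r d e); lra. }
    assert (A := R1 (x + h)). assert (B := Hm (x + h)).
    replace (x + h - x) with h in B by ring. rewrite Rabs_pos_eq in B; lra.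
  - destruct (derive_pos_right _ _ _ H) as [e [He [_ L1]]]; [lra|].
    set (h := Rmin d e / 2).
    assert (0 < h /\ h < d /\ h < e).
    { unfold h. assert (0 < Rmin d e) by (apply Rmin_pos; lra).
      generalize (Rmin_l d e) (Rmin_r d e); lra. }
    assert (A := L1 (x - h)). assert (B := Hm (x - h)).
    replace (x - h - x) with (- h) in B by ring. rewrite Rabs_Ropp, Rabs_pos_eq in B; lra.
Qed.

Lemma local_min_derive2 (f df : R -> R) (x l d : R) :
  0 < d -> (forall t, Rabs (t - x) < d -> f x <= f t) ->
  (forall t, Rabs (t - x) < d -> is_derive f t (df t)) ->
  is_derive df x l -> 0 <= l.
Proof.
  intros Hd Hm H1 H2.
  assert (Z : Rabs (x - x) < d) by (rewrite Rminus_diag, Rabs_R0; exact Hd).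
  assert (E0 : df x = 0) by (eapply local_min_derive; eauto).
  destruct (Rle_or_lt 0 l) as [L|L]; [exact L|exfalso].
  assert (H' : is_derive (fun t => - df t) x (- l)) by now apply is_derive_opp in H2.
  destruct (derive_pos_right _ _ _ H') as [e [He [R1 _]]]; [lra|].
  set (h := Rmin d e / 2).
  assert (Hh : 0 < h /\ h < d /\ h < e).
  { unfold h. assert (0 < Rmin d e) by (apply Rmin_pos; lra).
    generalize (Rmin_l d e) (Rmin_r d e); lra. }
  destruct (mvt_derive f df x (x + h)) as [c [Lc Ec]]; [lra| |].
  { intros t Ht. apply H1. rewrite Rabs_pos_eq; lra. }
  assert (A := R1 c ltac:(lra)). rewrite E0 in A.
  assert (B := Hm (x + h)). replace (x + h - x) with h in * by ring.
  rewrite Rabs_pos_eq in B by lra. nra.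
Qed.

(** Bolzano-Weierstrass, from the compactness of a square: without a cluster point, every point has
    a neighbourhood that the sequence leaves for good after some index. *)
Lemma cluster_point_2d (X Y : nat -> R) (M : R) :
  (forall n, Rabs (X n) <= M) -> (forall n, Rabs (Y n) <= M) ->
  exists x y, forall e, 0 < e -> forall N, exists n, (N <= n)%nat /\
    Rabs (X n - x) < e /\ Rabs (Y n - y) < e.
Proof.
  intros HX HY. apply NNPP. intros NC.
  assert (K : forall x y, exists p : R * nat, 0 < fst p /\ forall n, (snd p <= n)%nat ->
    ~ (Rabs (X n - x) < fst p /\ Rabs (Y n - y) < fst p)).
  { intros x y. apply NNPP. intros NK. apply NC. exists x, y. intros e He N.
    apply NNPP. intros NN. apply NK. exists (e, N). split; [exact He|].
    intros n Hn Hc. apply NN. now exists n. }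
  set (p := fun x y => proj1_sig (constructive_indefinite_description _ (K x y))).
  assert (Hp : forall x y, 0 < fst (p x y) /\ forall n, (snd (p x y) <= n)%nat ->
    ~ (Rabs (X n - x) < fst (p x y) /\ Rabs (Y n - y) < fst (p x y))).
  { intros x y. unfold p. apply (proj2_sig (constructive_indefinite_description _ (K x y))). }
  (* The gauge also encodes the index: a uniform lower bound on it bounds the index after which the
     neighbourhood is avoided. *)
  assert (dp : forall x y, 0 < Rmin (fst (p x y)) (/ INR (S (snd (p x y))))).
  { intros x y. apply Rmin_pos; [apply Hp|]. apply Rinv_0_lt_compat, lt_0_INR, Nat.lt_0_succ. }
  destruct (compactness_value_2d (-M) M (-M) M (fun x y => mkposreal _ (dp x y))) as [d Hd].
  destruct (archimed_cor1 d (cond_pos d)) as [n [Hn n0]].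
  apply (Hd (X n) (Y n)).
  - apply Rabs_le_between, HX.
  - apply Rabs_le_between, HY.
  - intros [u [v [_ [_ [H1 [H2 H3]]]]]]. simpl in H1, H2, H3.
    destruct (Hp u v) as [e0 He]. apply (He n).
    + assert (L : / INR n < / INR (S (snd (p u v)))).
      { eapply Rlt_le_trans; [exact Hn|]. eapply Rle_trans; [exact H3|apply Rmin_r]. }
      apply Rinv_lt_cancel in L; [|now apply lt_0_INR].
      apply INR_lt in L. lia.
    + split; eapply Rlt_le_trans; try eassumption; apply Rmin_l.
Qed.

(* [S] need not be closed: the second alternative excludes the other limits of
   minimizing sequences. *)
Lemma min_attained (S : R -> R -> Prop) (f : R -> R -> R) (M x0 y0 : R) :
  S x0 y0 ->
  (forall x y, S x y -> Rabs x <= M /\ Rabs y <= M) ->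
  (forall x y, (S x y /\ continuity_2d_pt f x y) \/
     exists d, 0 < d /\ forall u v, S u v -> Rabs (u - x) < d -> Rabs (v - y) < d ->
       f x0 y0 <= f u v) ->
  exists x y, S x y /\ forall u v, S u v -> f x y <= f u v.
Proof.
  intros S0 Hb Hc.
  (* [f] may be unbounded below; composing with atan makes the infimum exist, and the sign turns it
     into a supremum. *)
  set (E := fun z => exists u v, S u v /\ z = - atan (f u v)).
  destruct (completeness E) as [m [Hm1 Hm2]].
  { exists (PI / 2). intros z [u [v [_ ->]]]. generalize (atan_bound (f u v)); lra. }
  { now exists (- atan (f x0 y0)), x0, y0. }
  assert (K : forall n : nat, exists p : R * R, S (fst p) (snd p) /\
    - atan (f (fst p) (snd p)) > m - / INR (Datatypes.S n)).
  { intros n. apply NNPP. intros NK.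
    assert (P : 0 < / INR (Datatypes.S n)) by apply Rinv_0_lt_compat, lt_0_INR, Nat.lt_0_succ.
    assert (m <= m - / INR (Datatypes.S n)); [|lra].
    apply Hm2. intros z [u [v [Suv ->]]]. apply Rnot_lt_le. intros L. apply NK.
    exists (u, v). now split. }
  set (p := fun n => proj1_sig (constructive_indefinite_description _ (K n))).
  assert (Hp : forall n, S (fst (p n)) (snd (p n)) /\
    - atan (f (fst (p n)) (snd (p n))) > m - / INR (Datatypes.S n)).
  { intros n. unfold p. apply (proj2_sig (constructive_indefinite_description _ (K n))). }
  destruct (cluster_point_2d (fun n => fst (p n)) (fun n => snd (p n)) M) as [x [y Hxy]].
  { intros n. apply (Hb _ _ (proj1 (Hp n))). }
  { intros n. apply (Hb _ _ (proj1 (Hp n))). }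
  (* A lower bound for [f] near the cluster point holds on all of [S], because the minimizing
     sequence keeps returning there. *)
  assert (Key : forall k d, 0 < d -> (forall u v, S u v -> Rabs (u - x) < d -> Rabs (v - y) < d ->
    k <= f u v) -> forall u v, S u v -> k <= f u v).
  { intros k d Hd Hk u v Suv. apply Rnot_lt_le. intros L.
    assert (L' := atan_increasing _ _ L).
    destruct (archimed_cor1 (atan k - atan (f u v))) as [N [HN N0]]; [lra|].
    destruct (Hxy d Hd N) as [n [Hn [A B]]].
    assert (Q := Hk _ _ (proj1 (Hp n)) A B).
    assert (Q' : atan k <= atan (f (fst (p n)) (snd (p n)))).
    { destruct (Rle_lt_or_eq_dec _ _ Q) as [Q1|Q1]; [left; now apply atan_increasing|now rewrite Q1; right]. }
    assert (W := proj2 (Hp n)).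
    assert (V : - atan (f u v) <= m) by (apply Hm1; now exists u, v).
    assert (/ INR (Datatypes.S n) <= / INR N).
    { apply Rinv_le_contravar; [now apply lt_0_INR|apply le_INR; lia]. }
    lra. }
  destruct (Hc x y) as [[Sxy Cf]|[d [Hd Hk]]].
  - exists x, y. split; [exact Sxy|]. intros u v Suv. apply Rnot_lt_le. intros L.
    destruct (cont2_eps f x y ((f x y - f u v) / 2) Cf ltac:(lra)) as [d [Hd Hdd]].
    assert (Q := Key ((f x y + f u v) / 2) d Hd). specialize (Q).
    assert (Q' : (f x y + f u v) / 2 <= f u v).
    { apply Q; [|exact Suv]. intros a b _ Ha Hb'. assert (T := Hdd a b Ha Hb').
      apply Rabs_def2 in T. lra. }
    lra.
  - exists x0, y0. split; [exact S0|]. now apply (Key _ d).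
Qed.

(** * Hopf's lemma and the strong maximum principle *)

Definition has_lap (D : R -> R -> Prop) (w wx wy wxx wyy : R -> R -> R) : Prop :=
  forall x y, D x y ->
    is_derive (fun t => w t y) x (wx x y) /\ is_derive (fun t => wx t y) x (wxx x y) /\
    is_derive (fun t => w x t) y (wy x y) /\ is_derive (fun t => wy x t) y (wyy x y).

Definition disc (a1 a2 r : R) (x y : R) : Prop := (x - a1) ^ 2 + (y - a2) ^ 2 < r ^ 2.

Lemma continuity_2d_sqdist a1 a2 x y :
  continuity_2d_pt (fun u v => (u - a1) ^ 2 + (v - a2) ^ 2) x y.
Proof.
  apply continuity_2d_pt_ext with
    (fun u v => (u - a1) * (u - a1) + (v - a2) * (v - a2)); [intros; ring|].
  repeat first [apply continuity_2d_pt_plus | apply continuity_2d_pt_minus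
    | apply continuity_2d_pt_mult | apply continuity_2d_pt_id1 | apply continuity_2d_pt_id2
    | apply continuity_2d_pt_const].
Qed.

Lemma open2_lt (f g : R -> R -> R) :
  (forall x y, continuity_2d_pt f x y) -> (forall x y, continuity_2d_pt g x y) ->
  open2 (fun x y => f x y < g x y).
Proof.
  intros Hf Hg x y L.
  assert (H : continuity_2d_pt (fun u v => g u v - f u v) x y) by (apply continuity_2d_pt_minus; auto).
  destruct (cont2_eps _ x y (g x y - f x y) H ltac:(lra)) as [d [Hd K]].
  exists (mkposreal d Hd). simpl. intros u v Hu Hv. specialize (K u v Hu Hv).
  apply Rabs_def2 in K. lra.
Qed.

Lemma open2_and (P Q : R -> R -> Prop) :
  open2 P -> open2 Q -> open2 (fun x y => P x y /\ Q x y).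
Proof.
  intros HP HQ x y [p q]. destruct (HP x y p) as [d1 H1]. destruct (HQ x y q) as [d2 H2].
  assert (A : 0 < Rmin d1 d2) by (apply Rmin_pos; apply cond_pos).
  exists (mkposreal _ A). simpl. intros u v Hu Hv.
  split; [apply H1|apply H2]; eapply Rlt_le_trans; try eassumption;
    first [apply Rmin_l|apply Rmin_r].
Qed.

Lemma open2_disc a1 a2 r : open2 (disc a1 a2 r).
Proof.
  apply (open2_lt (fun x y => (x - a1) ^ 2 + (y - a2) ^ 2) (fun _ _ => r ^ 2)).
  - intros. apply continuity_2d_sqdist.
  - intros. apply continuity_2d_pt_const.
Qed.

Lemma sq_le_abs a M : 0 <= M -> a ^ 2 <= M ^ 2 -> Rabs a <= M.
Proof. intros HM H. apply Rabs_le. split; nra. Qed.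

Lemma disc_box a1 a2 r x y :
  0 <= r -> (x - a1) ^ 2 + (y - a2) ^ 2 <= r ^ 2 ->
  Rabs x <= Rabs a1 + Rabs a2 + r /\ Rabs y <= Rabs a1 + Rabs a2 + r.
Proof.
  intros Hr H.
  assert (Sx := pow2_ge_0 (x - a1)). assert (Sy := pow2_ge_0 (y - a2)).
  assert (Rabs (x - a1) <= r) by (apply sq_le_abs; lra).
  assert (Rabs (y - a2) <= r) by (apply sq_le_abs; lra).
  assert (P1 := Rabs_triang (x - a1) a1). assert (P2 := Rabs_triang (y - a2) a2).
  replace (x - a1 + a1) with x in P1 by ring. replace (y - a2 + a2) with y in P2 by ring.
  assert (Q1 := Rabs_pos a1). assert (Q2 := Rabs_pos a2). lra.
Qed.

(** Comparison with the barrier m (exp (- al |z|^2) - exp (- al rho^2)), where z is the position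
    relative to the centre and m is the minimum of [w] on the concentric disc of half radius.
    Nothing is assumed of [w] on the bounding circle, and one k serves all directions: the
    conclusion is a linear lower bound in the relative depth t. *)
Lemma hopf (w wx wy wxx wyy : R -> R -> R) (a1 a2 rho C : R) :
  0 < rho -> 0 <= C ->
  has_lap (disc a1 a2 rho) w wx wy wxx wyy ->
  (forall x y, disc a1 a2 rho x y ->
     0 < w x y /\ continuity_2d_pt w x y /\ wxx x y + wyy x y <= C * w x y) ->
  exists k, 0 < k /\ forall n1 n2 t, n1 ^ 2 + n2 ^ 2 = 1 -> 0 < t < 1 ->
    k * t <= w (a1 + (1 - t) * rho * n1) (a2 + (1 - t) * rho * n2).
Proof.
  intros Hrho HC HL Hw.
  destruct (min_attained (fun x y => (x - a1) ^ 2 + (y - a2) ^ 2 <= (rho / 2) ^ 2) w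
    (Rabs a1 + Rabs a2 + rho / 2) a1 a2) as [m1 [m2 [Hm Hmin]]].
  { nra. }
  { intros x y H. now apply disc_box; [lra|]. }
  { intros x y. destruct (Rle_or_lt ((x - a1) ^ 2 + (y - a2) ^ 2) ((rho / 2) ^ 2)) as [L|L].
    - left. split; [exact L|]. apply Hw. unfold disc. nra.
    - right. destruct (cont2_eps _ x y _ (continuity_2d_sqdist a1 a2 x y)
        ltac:(apply Rlt_0_minus, L)) as [d [Hd K]].
      exists d. split; [exact Hd|]. intros u v Huv Hu Hv. specialize (K u v Hu Hv).
      apply Rabs_def2 in K. lra. }
  set (m := w m1 m2) in *.
  assert (mpos : 0 < m) by (apply Hw; unfold disc; nra).
  assert (r2 : 0 < rho ^ 2) by nra.
  (* Outside the half disc the Laplacian of g is at least al (al rho^2 - 4) g; the 5 makes the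
     bracket at least 1, and C + 1 makes the product exceed C g. *)
  set (al := 5 / rho ^ 2 + C + 1).
  assert (Hal1 : C + 1 <= al).
  { unfold al. assert (0 < 5 / rho ^ 2) by (apply Rdiv_lt_0_compat; lra). lra. }
  assert (Hal2 : 5 <= al * rho ^ 2).
  { unfold al. replace ((5 / rho ^ 2 + C + 1) * rho ^ 2) with (5 + (C + 1) * rho ^ 2) by (field; lra). nra. }
  set (K := exp (- al * rho ^ 2)).
  assert (Kpos : 0 < K) by apply exp_pos.
  set (g := fun x y => exp (- al * ((x - a1) ^ 2 + (y - a2) ^ 2))).
  set (be := fun x y => g x y - K).
  assert (gpos : forall x y, 0 < g x y) by (intros; apply exp_pos).
  assert (gle1 : forall x y, g x y <= 1).
  { intros. unfold g. rewrite <- exp_0. destruct (Req_dec ((x - a1) ^ 2 + (y - a2) ^ 2) 0) as [->|N].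
    - rewrite Rmult_0_r. lra.
    - left. apply exp_increasing. assert (0 < (x - a1) ^ 2 + (y - a2) ^ 2) by (generalize (pow2_ge_0 (x - a1)) (pow2_ge_0 (y - a2)); lra). nra. }
  assert (beC : forall x y, continuity_2d_pt be x y).
  { intros x y. apply continuity_2d_pt_minus; [|apply continuity_2d_pt_const].
    apply (continuity_1d_2d_pt_comp exp (fun u v => - al * ((u - a1) ^ 2 + (v - a2) ^ 2))).
    - apply derivable_continuous_pt, derivable_pt_exp.
    - apply continuity_2d_pt_mult; [apply continuity_2d_pt_const|apply continuity_2d_sqdist]. }
  set (f := fun x y => w x y - m * be x y).
  (* A negative minimum of w - m be lies outside the half disc, since inside w >= m >= m be. There
     the Laplacian of w is at least m (C + 1) g, against the upper bound C w <= C m g. *)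
  assert (Claim : forall x y, disc a1 a2 rho x y -> 0 <= f x y).
  { intros x0 y0 H0. apply Rnot_lt_le. intros Neg.
    destruct (min_attained (disc a1 a2 rho) f (Rabs a1 + Rabs a2 + rho) x0 y0 H0)
      as [x [y [Hxy Hfm]]].
    { intros x y H. apply disc_box; [lra|]. unfold disc in H. lra. }
    { intros x y. destruct (Rlt_le_dec ((x - a1) ^ 2 + (y - a2) ^ 2) (rho ^ 2)) as [L|L].
      - left. split; [exact L|]. apply continuity_2d_pt_minus; [now apply Hw|].
        apply continuity_2d_pt_mult; [apply continuity_2d_pt_const|apply beC].
      (* On and beyond the circle be <= 0, while w > 0 inside: near such points f cannot fall below
         the negative value f x0 y0. *)
      - right. assert (B0 : be x y <= 0).
        { unfold be, g, K. destruct L as [L|<-]; [|lra].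
          assert (exp (- al * ((x - a1) ^ 2 + (y - a2) ^ 2)) < exp (- al * rho ^ 2)); [|lra].
          apply exp_increasing. nra. }
        assert (e0 : 0 < - f x0 y0 / m) by (apply Rdiv_lt_0_compat; lra).
        destruct (cont2_eps be x y _ (beC x y) e0) as [d [Hd Q]].
        exists d. split; [exact Hd|]. intros u v Duv Hu Hv.
        specialize (Q u v Hu Hv). apply Rabs_def2 in Q.
        assert (P := proj1 (Hw u v Duv)). unfold f at 2.
        assert (E1 : be u v <= - f x0 y0 / m) by lra.
        apply (Rmult_le_compat_l m) in E1; [|lra].
        replace (m * (- f x0 y0 / m)) with (- f x0 y0) in E1 by (field; lra). lra. }
    assert (fneg : f x y < 0) by (generalize (Hfm x0 y0 H0); lra).
    destruct (open2_disc a1 a2 rho x y Hxy) as [d Hd].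
    destruct (Hw x y Hxy) as [wpos [_ wlap]].
    assert (Zx : Rabs (x - x) < d) by (rewrite Rminus_diag, Rabs_R0; apply cond_pos).
    assert (Zy : Rabs (y - y) < d) by (rewrite Rminus_diag, Rabs_R0; apply cond_pos).
    assert (far : (rho / 2) ^ 2 < (x - a1) ^ 2 + (y - a2) ^ 2).
    { apply Rnot_le_lt. intros L. assert (W := Hmin x y L).
      unfold f, be in fneg. fold m in W. generalize (gle1 x y) (gpos x y). nra. }
    assert (D1 : 0 <= wxx x y - m * ((-2 * al + 4 * al ^ 2 * (x - a1) ^ 2) * g x y)).
    { apply (local_min_derive2 (fun t => f t y)
        (fun t => wx t y - m * (-2 * al * (t - a1) * g t y)) x _ d (cond_pos d)).
      - intros t Ht. apply Hfm. now apply Hd.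
      - intros t Ht. destruct (HL t y (Hd t y Ht Zy)) as [H1 _].
        apply derive_minus; [exact H1|]. unfold be, g. auto_derive; [easy|]. unfold Rminus. simpl. ring.
      - destruct (HL x y Hxy) as [_ [H2 _]].
        apply derive_minus; [exact H2|]. unfold g. auto_derive; [easy|]. unfold Rminus. simpl. ring. }
    assert (D2 : 0 <= wyy x y - m * ((-2 * al + 4 * al ^ 2 * (y - a2) ^ 2) * g x y)).
    { apply (local_min_derive2 (fun t => f x t)
        (fun t => wy x t - m * (-2 * al * (t - a2) * g x t)) y _ d (cond_pos d)).
      - intros t Ht. apply Hfm. now apply Hd.
      - intros t Ht. destruct (HL x t (Hd x t Zx Ht)) as [_ [_ [H1 _]]].
        apply derive_minus; [exact H1|]. unfold be, g. auto_derive; [easy|]. unfold Rminus. simpl. ring.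
      - destruct (HL x y Hxy) as [_ [_ [_ H2]]].
        apply derive_minus; [exact H2|]. unfold g. auto_derive; [easy|]. unfold Rminus. simpl. ring. }
    assert (G := gpos x y).
    set (q := (x - a1) ^ 2 + (y - a2) ^ 2) in *.
    assert (E : m * ((4 * al ^ 2 * q - 4 * al) * g x y) <= wxx x y + wyy x y).
    { unfold q. nra. }
    assert (E2 : C + 1 <= 4 * al ^ 2 * q - 4 * al).
    { assert (al * rho ^ 2 <= 4 * al * q) by nra.
      assert (1 <= 4 * al * q - 4) by lra.
      replace (4 * al ^ 2 * q - 4 * al) with (al * (4 * al * q - 4)) by ring. nra. }
    assert (E3 : m * ((C + 1) * g x y) <= m * ((4 * al ^ 2 * q - 4 * al) * g x y)).
    { apply Rmult_le_compat_l; [lra|]. apply Rmult_le_compat_r; lra. }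
    assert (E4 : C * w x y <= C * (m * g x y)).
    { apply Rmult_le_compat_l; [lra|]. unfold f, be in fneg. nra. }
    assert (0 < m * g x y) by (apply Rmult_lt_0_compat; lra). nra. }
  (* The constant comes from exp z >= 1 + z and 2 t - t^2 >= t. *)
  exists (m * (K * (al * rho ^ 2))). split.
  { repeat apply Rmult_lt_0_compat; lra. }
  intros n1 n2 t Hn Ht.
  set (X := a1 + (1 - t) * rho * n1). set (Y := a2 + (1 - t) * rho * n2).
  assert (Q : (X - a1) ^ 2 + (Y - a2) ^ 2 = (1 - t) ^ 2 * rho ^ 2).
  { unfold X, Y. replace ((1 - t) ^ 2 * rho ^ 2) with ((1 - t) ^ 2 * rho ^ 2 * (n1 ^ 2 + n2 ^ 2)) by (rewrite Hn; ring). ring. }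
  assert (DX : disc a1 a2 rho X Y). { unfold disc. rewrite Q. nra. }
  assert (F := Claim X Y DX). unfold f, be, g in F. rewrite Q in F.
  replace (- al * ((1 - t) ^ 2 * rho ^ 2)) with (- al * rho ^ 2 + al * rho ^ 2 * (2 * t - t ^ 2)) in F by ring.
  rewrite exp_plus in F. fold K in F.
  assert (I := exp_ineq1_le (al * rho ^ 2 * (2 * t - t ^ 2))).
  set (z := exp (al * rho ^ 2 * (2 * t - t ^ 2))) in *.
  assert (t <= 2 * t - t ^ 2) by nra.
  assert (al * rho ^ 2 * t <= z - 1) by nra.
  assert (K * (al * rho ^ 2 * t) <= K * (z - 1)) by (apply Rmult_le_compat_l; lra).
  assert (m * (K * (al * rho ^ 2 * t)) <= m * (K * (z - 1))) by (apply Rmult_le_compat_l; lra).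
  lra.
Qed.

(** An interior zero of a nonnegative function is a minimum, so the derivative along the radius
    vanishes there; Hopf's lemma forces linear growth along that radius. *)
Lemma hopf_touching (D : R -> R -> Prop) (w wx wy wxx wyy : R -> R -> R) (a1 a2 rho C x y : R) :
  open2 D -> has_grad D w wx wy -> has_lap D w wx wy wxx wyy ->
  (forall u v, D u v -> 0 <= w u v) ->
  0 < rho -> 0 <= C ->
  (forall u v, disc a1 a2 rho u v -> D u v /\ 0 < w u v /\ wxx u v + wyy u v <= C * w u v) ->
  D x y -> w x y = 0 -> (x - a1) ^ 2 + (y - a2) ^ 2 = rho ^ 2 -> False.
Proof.
  intros oD HG HL Hw Hr HC Hd Dxy w0 Hxy.
  destruct (hopf w wx wy wxx wyy a1 a2 rho C Hr HC) as [k [kpos Hk]].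
  { intros u v Huv. apply HL. now apply Hd. }
  { intros u v Huv. destruct (Hd u v Huv) as [Duv [P I]]. split; [exact P|]. split; [|exact I].
    eapply has_grad_continuous; eauto. }
  set (n1 := (x - a1) / rho). set (n2 := (y - a2) / rho).
  assert (Hn : n1 ^ 2 + n2 ^ 2 = 1).
  { unfold n1, n2. replace (((x - a1) / rho) ^ 2 + ((y - a2) / rho) ^ 2) with
      (((x - a1) ^ 2 + (y - a2) ^ 2) / rho ^ 2) by (field; lra). rewrite Hxy. field. lra. }
  set (g1 := fun t => a1 + (1 - t) * rho * n1). set (g2 := fun t => a2 + (1 - t) * rho * n2).
  assert (E1 : g1 0 = x) by (unfold g1, n1; field; lra).
  assert (E2 : g2 0 = y) by (unfold g2, n2; field; lra).
  assert (G : is_derive (fun s => w (g1 s) (g2 s)) 0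
    (wx (g1 0) (g2 0) * (- rho * n1) + wy (g1 0) (g2 0) * (- rho * n2))).
  { apply (has_grad_comp D w wx wy g1 g2); try assumption.
    - now rewrite E1, E2.
    - unfold g1. auto_derive; [easy|ring].
    - unfold g2. auto_derive; [easy|ring]. }
  destruct (oD x y Dxy) as [d Hdd].
  assert (c1 : continuity_pt g1 0).
  { apply (is_derive_continuity_pt _ _ (- rho * n1)). unfold g1. auto_derive; [easy|ring]. }
  assert (c2 : continuity_pt g2 0).
  { apply (is_derive_continuity_pt _ _ (- rho * n2)). unfold g2. auto_derive; [easy|ring]. }
  destruct (cont1_eps g1 0 d c1 (cond_pos d)) as [d1 [Hd1 K1]].
  destruct (cont1_eps g2 0 d c2 (cond_pos d)) as [d2 [Hd2 K2]].
  assert (Z := G). apply (local_min_derive _ _ _ (Rmin d1 d2)) in Z.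
  - rewrite Z in G.
    assert (G' : is_derive (fun s => (k / 2) * s - w (g1 s) (g2 s)) 0 (k / 2 - 0)).
    { apply derive_minus; [|exact G]. auto_derive; [easy|ring]. }
    destruct (derive_pos_right _ _ _ G') as [e [He [Re _]]]; [lra|].
    set (t := Rmin e 1 / 2).
    assert (Ht : 0 < t < e /\ t < 1).
    { unfold t. assert (0 < Rmin e 1) by (apply Rmin_pos; lra).
      generalize (Rmin_l e 1) (Rmin_r e 1). lra. }
    assert (R1 := Re t ltac:(lra)). cbv beta in R1. rewrite E1, E2, w0 in R1.
    assert (R2 := Hk n1 n2 t Hn ltac:(lra)). fold (g1 t) (g2 t) in R2. nra.
  - apply Rmin_pos; assumption.
  - intros t Ht. rewrite E1, E2, w0. apply Hw. apply Hdd.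
    + rewrite <- E1. apply K1. eapply Rlt_le_trans; [exact Ht|apply Rmin_l].
    + rewrite <- E2. apply K2. eapply Rlt_le_trans; [exact Ht|apply Rmin_r].
Qed.

(* [D] need not be convex: the segment from a positive point to a zero may leave
   [D] where [w] is known to be positive. *)
Lemma strong_max (D : R -> R -> Prop) (w wx wy wxx wyy : R -> R -> R) (xa ya xz yz : R) :
  open2 D -> has_grad D w wx wy -> has_lap D w wx wy wxx wyy ->
  (forall u v, D u v -> 0 <= w u v) ->
  (forall x y, D x y -> w x y = 0 -> exists d C, 0 < d /\ 0 <= C /\
     forall u v, Rabs (u - x) < d -> Rabs (v - y) < d ->
       D u v /\ wxx u v + wyy u v <= C * w u v) ->
  (forall t, 0 <= t <= 1 -> D (xa + t * (xz - xa)) (ya + t * (yz - ya)) \/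
     exists d, 0 < d /\ forall u v, D u v -> Rabs (u - (xa + t * (xz - xa))) < d ->
       Rabs (v - (ya + t * (yz - ya))) < d -> 0 < w u v) ->
  D xa ya -> 0 < w xa ya -> D xz yz -> w xz yz <> 0.
Proof.
  intros oD HG HL Hw Hloc Hseg Da wa Dz wz.
  set (g1 := fun t => xa + t * (xz - xa)). set (g2 := fun t => ya + t * (yz - ya)).
  assert (c1 : forall t, continuity_pt g1 t).
  { intros t. apply (is_derive_continuity_pt _ _ (xz - xa)). unfold g1. auto_derive; [easy|ring]. }
  assert (c2 : forall t, continuity_pt g2 t).
  { intros t. apply (is_derive_continuity_pt _ _ (yz - ya)). unfold g2. auto_derive; [easy|ring]. }
  assert (wC : forall x y, D x y -> continuity_2d_pt w x y).
  { intros x y H. eapply has_grad_continuous; eauto. }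
  (* T is the first zero of [w] on the segment. The coordinate s = 0 is a dummy, [min_attained]
     being two-dimensional. *)
  destruct (min_attained (fun t s => s = 0 /\ 0 <= t <= 1 /\ D (g1 t) (g2 t) /\ w (g1 t) (g2 t) = 0)
    (fun t _ => t) 1 1 0) as [T [s0 [[_ [T01 [DT wT]]] HT]]].
  { split; [easy|]. split; [lra|]. unfold g1, g2.
    replace (xa + 1 * (xz - xa)) with xz by ring. replace (ya + 1 * (yz - ya)) with yz by ring.
    now split. }
  { intros t s [-> [Ht _]]. rewrite Rabs_R0. split; [apply Rabs_le; lra|lra]. }
  { intros t s.
    destruct (classic (s = 0 /\ 0 <= t <= 1 /\ D (g1 t) (g2 t) /\ w (g1 t) (g2 t) = 0)) as [H|NH].
    { left. split; [exact H|]. apply continuity_2d_pt_id1. }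
    right.
    assert (K : exists d, 0 < d /\ forall t' s', Rabs (t' - t) < d -> Rabs (s' - s) < d ->
      ~ (s' = 0 /\ 0 <= t' <= 1 /\ D (g1 t') (g2 t') /\ w (g1 t') (g2 t') = 0)).
    { destruct (Req_dec s 0) as [->|Ns].
      2: { exists (Rabs s). split; [now apply Rabs_pos_lt|]. intros t' s' _ H [-> _].
           rewrite Rminus_0_l, Rabs_Ropp in H. lra. }
      destruct (Rlt_le_dec t 0) as [L0|L0].
      { exists (- t). split; [lra|]. intros t' s' H _ [_ [H' _]]. apply Rabs_def2 in H. lra. }
      destruct (Rlt_le_dec 1 t) as [L1|L1].
      { exists (t - 1). split; [lra|]. intros t' s' H _ [_ [H' _]]. apply Rabs_def2 in H. lra. }
      assert (N : exists d, 0 < d /\ forall u v, D u v -> Rabs (u - g1 t) < d ->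
         Rabs (v - g2 t) < d -> 0 < w u v).
      { destruct (Hseg t ltac:(lra)) as [Dt|E]; [|exact E].
        fold (g1 t) (g2 t) in Dt.
        assert (W : 0 < w (g1 t) (g2 t)).
        { destruct (Hw _ _ Dt) as [P|P]; [exact P|]. exfalso. apply NH. repeat split; try lra; easy. }
        destruct (cont2_eps w _ _ _ (wC _ _ Dt) W) as [d [Hd K]].
        exists d. split; [exact Hd|]. intros u v _ Hu Hv. specialize (K u v Hu Hv).
        apply Rabs_def2 in K. lra. }
      destruct N as [d [Hd N]].
      destruct (cont1_eps g1 t d (c1 t) Hd) as [d1 [Hd1 K1]].
      destruct (cont1_eps g2 t d (c2 t) Hd) as [d2 [Hd2 K2]].
      exists (Rmin d1 d2). split; [now apply Rmin_pos|].
      intros t' s' Ht' _ [_ [_ [D' W']]].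
      assert (0 < w (g1 t') (g2 t')); [|lra].
      apply N; [exact D'|apply K1|apply K2]; eapply Rlt_le_trans; try eassumption;
        first [apply Rmin_l|apply Rmin_r]. }
    destruct K as [d [Hd K]]. exists d. split; [exact Hd|]. intros t' s' H Ht' Hs'.
    now destruct (K t' s' Ht' Hs'). }
  assert (Tpos : 0 < T).
  { destruct (Req_dec T 0) as [E|N]; [|lra]. rewrite E in wT. unfold g1, g2 in wT.
    rewrite !Rmult_0_l, !Rplus_0_r in wT. lra. }
  destruct (Hloc _ _ DT wT) as [d [C [Hd [HC Hdd]]]].
  destruct (cont1_eps g1 T (d / 8) (c1 T) ltac:(lra)) as [d1 [Hd1 K1]].
  destruct (cont1_eps g2 T (d / 8) (c2 T) ltac:(lra)) as [d2 [Hd2 K2]].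
  (* A point just before T: [w] is positive there, and it is within d / 8 of the zero in each
     coordinate. *)
  set (t := T - Rmin T (Rmin d1 d2) / 2).
  assert (M : 0 < Rmin T (Rmin d1 d2)) by (repeat apply Rmin_pos; lra).
  assert (M1 := Rmin_l T (Rmin d1 d2)). assert (M2 := Rmin_r T (Rmin d1 d2)).
  assert (M3 := Rmin_l d1 d2). assert (M4 := Rmin_r d1 d2).
  assert (Ht : 0 < t < T /\ T - t < d1 /\ T - t < d2) by (unfold t; lra).
  set (z1 := g1 T) in *. set (z2 := g2 T) in *.
  assert (A1 : Rabs (g1 t - z1) < d / 8) by (apply K1; rewrite Rabs_left; lra).
  assert (A2 : Rabs (g2 t - z2) < d / 8) by (apply K2; rewrite Rabs_left; lra).
  set (a1 := g1 t) in *. set (a2 := g2 t) in *.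
  destruct (Hdd a1 a2 ltac:(lra) ltac:(lra)) as [Daa _].
  assert (wA : 0 < w a1 a2).
  { destruct (Hw _ _ Daa) as [P|P]; [exact P|].
    assert (T <= t); [|lra]. apply (HT t 0). repeat split; try lra; try easy. }
  (* Nearest zero to (a1, a2) in the box of half side d / 2. The open disc about (a1, a2) through it
     has radius less than sqrt 2 d / 8, hence stays in the box and contains no zero: [hopf_touching]
     applies. *)
  destruct (min_attained (fun x y => Rabs (x - z1) <= d / 2 /\ Rabs (y - z2) <= d / 2 /\ w x y = 0)
    (fun x y => (x - a1) ^ 2 + (y - a2) ^ 2) (Rabs z1 + Rabs z2 + d) z1 z2)
    as [x [y [[Hx [Hy wxy]] Hmin]]].
  { rewrite !Rminus_diag, Rabs_R0. repeat split; lra. }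
  { intros x y [Hx [Hy _]]. generalize (Rabs_triang (x - z1) z1) (Rabs_triang (y - z2) z2).
    replace (x - z1 + z1) with x by ring. replace (y - z2 + z2) with y by ring.
    generalize (Rabs_pos z1) (Rabs_pos z2). lra. }
  { intros x y.
    assert (Far : forall a z, d / 2 < Rabs (a - z) -> forall a', Rabs (a' - a) < Rabs (a - z) - d / 2 ->
       ~ Rabs (a' - z) <= d / 2).
    { intros a z H a' H' H''. generalize (Rabs_triang (a - a') (a' - z)).
      replace (a - a' + (a' - z)) with (a - z) by ring. rewrite (Rabs_minus_sym a a'). lra. }
    destruct (Rlt_le_dec (d / 2) (Rabs (x - z1))) as [L1|L1].
    { right. exists (Rabs (x - z1) - d / 2). split; [lra|]. intros u v [Hu _] H _.
      now destruct (Far x z1 L1 u H). }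
    destruct (Rlt_le_dec (d / 2) (Rabs (y - z2))) as [L2|L2].
    { right. exists (Rabs (y - z2) - d / 2). split; [lra|]. intros u v [_ [Hv _]] _ H.
      now destruct (Far y z2 L2 v H). }
    destruct (Hdd x y ltac:(lra) ltac:(lra)) as [Dxy _].
    destruct (Hw _ _ Dxy) as [P|P].
    - right. destruct (cont2_eps w x y _ (wC _ _ Dxy) P) as [e [He K]].
      exists e. split; [exact He|]. intros u v [_ [_ W]] Hu Hv. specialize (K u v Hu Hv).
      apply Rabs_def2 in K. lra.
    - left. split; [now repeat split|]. apply continuity_2d_sqdist. }
  destruct (Hdd x y ltac:(lra) ltac:(lra)) as [Dxy _].
  set (r2 := (x - a1) ^ 2 + (y - a2) ^ 2) in *.
  assert (r2le : r2 <= (z1 - a1) ^ 2 + (z2 - a2) ^ 2).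
  { apply Hmin. rewrite !Rminus_diag, Rabs_R0. repeat split; lra. }
  assert (r2pos : 0 < r2).
  { unfold r2. generalize (pow2_ge_0 (x - a1)) (pow2_ge_0 (y - a2)). intros P1 P2.
    destruct (Req_dec x a1) as [Ex|Nx].
    - destruct (Req_dec y a2) as [Ey|Ny]; [subst; lra|].
      assert (0 < (y - a2) ^ 2) by (apply pow2_gt_0; lra). lra.
    - assert (0 < (x - a1) ^ 2) by (apply pow2_gt_0; lra). lra. }
  set (rho := sqrt r2).
  assert (rhopos : 0 < rho) by now apply sqrt_lt_R0.
  assert (rho2 : rho ^ 2 = r2) by (apply pow2_sqrt; lra).
  apply (hopf_touching D w wx wy wxx wyy a1 a2 rho C x y); try assumption; [|now rewrite rho2].
  intros u v Huv. unfold disc in Huv. rewrite rho2 in Huv.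
  apply Rabs_def2 in A1. apply Rabs_def2 in A2.
  assert (r2lt : r2 < 2 * (d / 8) ^ 2) by nra.
  assert (Bu : Rabs (u - z1) < d / 2).
  { apply Rabs_def1; generalize (pow2_ge_0 (v - a2)); nra. }
  assert (Bv : Rabs (v - z2) < d / 2).
  { apply Rabs_def1; generalize (pow2_ge_0 (u - a1)); nra. }
  destruct (Hdd u v ltac:(lra) ltac:(lra)) as [Duv Iuv].
  split; [exact Duv|]. split; [|exact Iuv].
  destruct (Hw _ _ Duv) as [P|P]; [exact P|exfalso].
  assert (r2 <= (u - a1) ^ 2 + (v - a2) ^ 2); [|lra].
  apply Hmin. repeat split; lra.
Qed.

(** * Moving planes in the punctured disc *)

Definition pdisc (b x y : R) : Prop := 0 < x ^ 2 + y ^ 2 < b ^ 2.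

Lemma open2_pdisc b : open2 (pdisc b).
Proof.
  assert (E : forall x y, continuity_2d_pt (fun u v => u ^ 2 + v ^ 2) x y).
  { intros. apply continuity_2d_pt_ext with (fun u v => (u - 0) ^ 2 + (v - 0) ^ 2);
      [intros; ring|apply continuity_2d_sqdist]. }
  apply open2_and.
  - apply (open2_lt (fun _ _ => 0) (fun x y => x ^ 2 + y ^ 2)); [|exact E].
    intros. apply continuity_2d_pt_const.
  - apply (open2_lt (fun x y => x ^ 2 + y ^ 2) (fun _ _ => b ^ 2)); [exact E|].
    intros. apply continuity_2d_pt_const.
Qed.

Lemma sq_sum_pos_l x y : x <> 0 -> 0 < x ^ 2 + y ^ 2.
Proof. intros H. generalize (pow2_gt_0 x H) (pow2_ge_0 y). lra. Qed.

Lemma sq_sum_pos_r x y : y <> 0 -> 0 < x ^ 2 + y ^ 2.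
Proof. intros H. generalize (pow2_gt_0 y H) (pow2_ge_0 x). lra. Qed.

Lemma sq_sum_eq0 x y : x ^ 2 + y ^ 2 = 0 -> x = 0 /\ y = 0.
Proof.
  intros H. split.
  - destruct (Req_dec x 0) as [E|N]; [exact E|]. generalize (sq_sum_pos_l x y N). lra.
  - destruct (Req_dec y 0) as [E|N]; [exact E|]. generalize (sq_sum_pos_r x y N). lra.
Qed.

Lemma small_box_sq (r x y : R) : 0 < r -> Rabs x < r / 2 -> Rabs y < r / 2 -> x ^ 2 + y ^ 2 < r ^ 2.
Proof. intros Hr Hx Hy. apply Rabs_def2 in Hx. apply Rabs_def2 in Hy. nra. Qed.

Lemma box_sq_ge (r x0 y0 : R) : 0 < r -> x0 ^ 2 + y0 ^ 2 > r ^ 2 ->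
  exists d, 0 < d /\ forall u v, Rabs (u - x0) < d -> Rabs (v - y0) < d -> r ^ 2 < u ^ 2 + v ^ 2.
Proof.
  intros Hr H.
  destruct (open2_lt (fun _ _ => r ^ 2) (fun u v => (u - 0) ^ 2 + (v - 0) ^ 2)
    (fun x y => continuity_2d_pt_const x y _) (continuity_2d_sqdist 0 0) x0 y0) as [d Hd].
  { rewrite !Rminus_0_r. exact H. }
  exists d. split; [apply cond_pos|]. intros u v Hu Hv. specialize (Hd u v Hu Hv).
  now rewrite !Rminus_0_r in Hd.
Qed.

(** [mps_lip] stands for an equation Delta u = F(u) with F locally Lipschitz, without constructing
    F; on equal values of [u] it says that the Laplacian depends on [u] only. [mps_origin] expresses
    that [u] is asymptotically maximal at 0 without giving it a value or a limit there. *)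
Record moving_plane_setting (b : R) (u p q pxx qyy : R -> R -> R) : Prop := {
  mps_b : 0 < b;
  mps_grad : has_grad (pdisc b) u p q;
  mps_lap : has_lap (pdisc b) u p q pxx qyy;
  mps_pos : forall x y, pdisc b x y -> 0 < u x y;
  mps_boundary : forall e, 0 < e -> exists r, 0 < r < b /\
    forall x y, pdisc b x y -> r ^ 2 < x ^ 2 + y ^ 2 -> u x y < e;
  mps_origin : forall x y, pdisc b x y -> exists r, 0 < r /\
    forall x' y', pdisc b x' y' -> x' ^ 2 + y' ^ 2 < r ^ 2 -> u x y < u x' y';
  mps_lip : forall x y, pdisc b x y -> exists eta C, 0 < eta /\ 0 <= C /\
    forall x1 y1 x2 y2, pdisc b x1 y1 -> pdisc b x2 y2 ->
      Rabs (u x1 y1 - u x y) < eta -> Rabs (u x2 y2 - u x y) < eta ->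
      Rabs ((pxx x1 y1 + qyy x1 y1) - (pxx x2 y2 + qyy x2 y2)) <= C * Rabs (u x1 y1 - u x2 y2)
}.

Arguments mps_b {_ _ _ _ _ _}.
Arguments mps_grad {_ _ _ _ _ _}.
Arguments mps_lap {_ _ _ _ _ _}.
Arguments mps_pos {_ _ _ _ _ _}.
Arguments mps_boundary {_ _ _ _ _ _}.
Arguments mps_origin {_ _ _ _ _ _}.
Arguments mps_lip {_ _ _ _ _ _}.

(** For l > 0 the last condition only removes the point whose mirror image is the origin
    ([refl_in]). *)
Definition cap (b l x y : R) : Prop :=
  (l < x /\ pdisc b x y) /\ pdisc b (2 * l - x) y.

Section MovingPlane.

Variables (b : R) (u p q pxx qyy : R -> R -> R).
Hypothesis H : moving_plane_setting b u p q pxx qyy.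

Let hb := mps_b H.

Lemma mp_cont x y : pdisc b x y -> continuity_2d_pt u x y.
Proof. intros P. eapply has_grad_continuous; [apply open2_pdisc|apply (mps_grad H)|exact P]. Qed.

(** [mps_origin] made uniform near (x, y): an intermediate value u (r' / 2, 0) separates the values
    near (x, y) from those near the origin. *)
Lemma mp_origin_gap x y : pdisc b x y -> exists d k, 0 < d /\ 0 < k /\
  (forall x1 y1 x' y', Rabs (x1 - x) < d -> Rabs (y1 - y) < d ->
     pdisc b x' y' -> Rabs x' < d -> Rabs y' < d -> u x1 y1 < u x' y') /\
  (forall x' y', pdisc b x' y' -> Rabs x' < d -> Rabs y' < d -> k < u x' y').
Proof.
  intros P. destruct (mps_origin H x y P) as [r [Hr K]].
  set (r' := Rmin r b). assert (0 < r') by (apply Rmin_pos; lra).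
  assert (L1 := Rmin_l r b). assert (L2 := Rmin_r r b). fold r' in L1, L2.
  assert (Q : pdisc b (r' / 2) 0) by (split; nra).
  assert (V : u x y < u (r' / 2) 0) by (apply K; [exact Q|nra]).
  destruct (mps_origin H _ _ Q) as [r1 [Hr1 K1]].
  destruct (cont2_eps u x y _ (mp_cont x y P) (proj2 (Rlt_0_minus _ _) V)) as [d [Hd K2]].
  exists (Rmin d (r1 / 2)), (u (r' / 2) 0). split; [apply Rmin_pos; lra|].
  split; [now apply (mps_pos H)|].
  assert (M1 := Rmin_l d (r1 / 2)). assert (M2 := Rmin_r d (r1 / 2)).
  split.
  - intros x1 y1 x' y' A1 A2 P' A3 A4. specialize (K2 x1 y1 ltac:(lra) ltac:(lra)).
    apply Rabs_def2 in K2.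
    assert (u (r' / 2) 0 < u x' y') by (apply K1; [exact P'|apply small_box_sq; lra]). lra.
  - intros x' y' P' A3 A4. apply K1; [exact P'|apply small_box_sq; lra].
Qed.

Lemma open2_refl (D : R -> R -> Prop) l : open2 D -> open2 (fun x y => D (2 * l - x) y).
Proof.
  intros oD x y Dxy. destruct (oD _ _ Dxy) as [d Hd]. exists d. intros a c Ha Hc.
  apply Hd; [|exact Hc]. replace (2 * l - a - (2 * l - x)) with (- (a - x)) by ring.
  now rewrite Rabs_Ropp.
Qed.

Lemma open2_cap l : open2 (cap b l).
Proof.
  apply open2_and; [apply open2_and|apply (open2_refl (pdisc b) l), open2_pdisc].
  - apply (open2_lt (fun _ _ => l) (fun x _ => x)).
    + intros. apply continuity_2d_pt_const.
    + intros. apply continuity_2d_pt_id1.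
  - apply open2_pdisc.
Qed.

Let w l x y := u (2 * l - x) y - u x y.

Lemma derive_refl (f : R -> R) (l x a : R) :
  is_derive f (2 * l - x) a -> is_derive (fun t => f (2 * l - t)) x (- a).
Proof.
  intros Hf. apply is_derive_eq with (-1 * a); [|ring].
  apply (derive_comp f (fun t => 2 * l - t) x a (-1) Hf). auto_derive; [easy|ring].
Qed.

Lemma continuity_2d_refl (f : R -> R -> R) (l x y : R) :
  continuity_2d_pt f (2 * l - x) y -> continuity_2d_pt (fun a c => f (2 * l - a) c) x y.
Proof.
  intros Hf. apply (continuity_2d_comp2 f (fun a _ => 2 * l - a) (fun _ c => c)); [exact Hf| |].
  - apply continuity_2d_pt_minus; [apply continuity_2d_pt_const|apply continuity_2d_pt_id1].
  - apply continuity_2d_pt_id2.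
Qed.

Lemma mp_diff_grad l : has_grad (cap b l) (w l)
  (fun x y => - p (2 * l - x) y - p x y) (fun x y => q (2 * l - x) y - q x y).
Proof.
  intros x y [[_ P] P'].
  destruct (mps_grad H x y P) as [A1 [A2 [A3 A4]]].
  destruct (mps_grad H _ y P') as [B1 [B2 [B3 B4]]].
  split; [|split; [|split]].
  - apply derive_minus; [|exact A1]. now apply (derive_refl (fun t => u t y)).
  - now apply derive_minus.
  - apply continuity_2d_pt_minus; [apply continuity_2d_pt_opp|exact A3].
    now apply continuity_2d_refl.
  - apply continuity_2d_pt_minus; [now apply continuity_2d_refl|exact A4].
Qed.

Lemma mp_diff_lap l : has_lap (cap b l) (w l)
  (fun x y => - p (2 * l - x) y - p x y) (fun x y => q (2 * l - x) y - q x y)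
  (fun x y => pxx (2 * l - x) y - pxx x y) (fun x y => qyy (2 * l - x) y - qyy x y).
Proof.
  intros x y C. assert (C' := C). destruct C' as [[_ P] P'].
  destruct (mps_lap H x y P) as [A1 [A2 [A3 A4]]].
  destruct (mps_lap H _ y P') as [B1 [B2 [B3 B4]]].
  destruct (mp_diff_grad l x y C) as [G1 [G2 _]].
  split; [exact G1|split; [|split; [exact G2|]]].
  - apply derive_minus; [|exact A2]. apply is_derive_eq with (- - pxx (2 * l - x) y); [|ring].
    apply derive_opp. now apply (derive_refl (fun t => p t y)).
  - now apply derive_minus.
Qed.

Lemma refl_in l x y : 0 < l -> l < x -> pdisc b x y -> 0 < (2 * l - x) ^ 2 + y ^ 2 ->
  pdisc b (2 * l - x) y.
Proof. intros Hl Hx [P1 P2] P3. split; [exact P3|]. nra. Qed.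

(* At a zero of [w l] both points lie on the same level of [u], where the vorticity
   is Lipschitz in [u]; this makes [w l] a supersolution of a linear equation. *)
Lemma mp_loc l x y : pdisc b x y -> pdisc b (2 * l - x) y -> w l x y = 0 ->
  exists d C, 0 < d /\ 0 <= C /\ forall a c, Rabs (a - x) < d -> Rabs (c - y) < d ->
    pdisc b a c /\ pdisc b (2 * l - a) c /\
    (0 <= w l a c -> (pxx (2 * l - a) c - pxx a c) + (qyy (2 * l - a) c - qyy a c) <= C * w l a c).
Proof.
  intros P P' W. unfold w in W.
  destruct (mps_lip H x y P) as [eta [C [He [HC K]]]].
  destruct (cont2_eps u x y eta (mp_cont _ _ P) He) as [d1 [Hd1 K1]].
  destruct (cont2_eps _ x y eta (continuity_2d_refl u l x y (mp_cont _ _ P')) He) as [d2 [Hd2 K2]].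
  destruct (open2_pdisc b x y P) as [d3 K3].
  destruct (open2_refl (pdisc b) l (open2_pdisc b) x y P') as [d4 K4].
  assert (P3 := cond_pos d3). assert (P4 := cond_pos d4).
  set (d := Rmin (Rmin d1 d2) (Rmin d3 d4)).
  assert (L1 : d <= d1 /\ d <= d2 /\ d <= d3 /\ d <= d4).
  { unfold d. generalize (Rmin_l (Rmin d1 d2) (Rmin d3 d4)) (Rmin_r (Rmin d1 d2) (Rmin d3 d4))
      (Rmin_l d1 d2) (Rmin_r d1 d2) (Rmin_l d3 d4) (Rmin_r d3 d4). lra. }
  exists d, C. split; [unfold d; repeat apply Rmin_pos; lra|]. split; [exact HC|].
  intros a c Ha Hc. split; [apply K3; lra|]. split; [apply K4; lra|]. intros W0.
  assert (Q := K (2 * l - a) c a c ltac:(apply K4; lra) ltac:(apply K3; lra)).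
  unfold w in W0 |- *. rewrite (Rabs_pos_eq (u (2 * l - a) c - u a c)) in Q by exact W0.
  assert (Q2 := K2 a c ltac:(lra) ltac:(lra)). cbv beta in Q2.
  replace (u (2 * l - x) y) with (u x y) in Q2 by lra.
  specialize (Q Q2 (K1 a c ltac:(lra) ltac:(lra))).
  apply Rabs_le_between in Q. lra.
Qed.

(** Strong maximum principle in the cap. A segment joining two of its points may cross the mirror
    image of the origin, which is not in the cap; near it [w l] is positive because [u] is
    asymptotically maximal at 0. *)
Lemma cap_strict l : 0 < l < b ->
  (forall x y, cap b l x y -> 0 <= w l x y) -> forall x y, cap b l x y -> 0 < w l x y.
Proof.
  intros Hl Hw x y Hxy. destruct (Hw x y Hxy) as [P|E]; [exact P|exfalso].
  (* A point close to [C_b]; off the horizontal axis, its reflection is not the origin. *)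
  assert (HA : exists xa ya, cap b l xa ya /\ 0 < w l xa ya).
  { set (xb := (l + b) / 2). set (yb := sqrt (b ^ 2 - xb ^ 2)).
    assert (Bxb : l < xb < b) by (unfold xb; lra).
    assert (yb0 : 0 < yb) by (apply sqrt_lt_R0; nra).
    assert (yb2 : xb ^ 2 + yb ^ 2 = b ^ 2) by (unfold yb; rewrite pow2_sqrt; nra).
    assert (Q : pdisc b (2 * l - xb) yb) by (split; [apply sq_sum_pos_r; lra|nra]).
    assert (Qp := mps_pos H _ _ Q).
    destruct (cont2_eps u _ _ (u (2 * l - xb) yb / 2) (mp_cont _ _ Q) ltac:(lra)) as [d [Hd K]].
    destruct (mps_boundary H (u (2 * l - xb) yb / 2) ltac:(lra)) as [r [Hr Kr]].
    destruct (box_sq_ge r xb yb ltac:(lra) ltac:(nra)) as [d' [Hd' K']].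
    set (m := Rmin (Rmin d d') (xb - l)).
    assert (Hm : 0 < m <= d /\ m <= d' /\ m <= xb - l).
    { unfold m. generalize (Rmin_l (Rmin d d') (xb - l)) (Rmin_r (Rmin d d') (xb - l))
        (Rmin_l d d') (Rmin_r d d'). assert (0 < Rmin d d') by (apply Rmin_pos; lra).
      assert (0 < Rmin (Rmin d d') (xb - l)) by (apply Rmin_pos; lra). lra. }
    exists (xb - m / 2), yb.
    assert (C : cap b l (xb - m / 2) yb).
    { assert (T : pdisc b (xb - m / 2) yb) by (split; [apply sq_sum_pos_r; lra|nra]).
      split; [split; [lra|exact T]|]. apply refl_in; [lra|lra|exact T|apply sq_sum_pos_r; lra]. }
    split; [exact C|]. unfold w.
    assert (U1 : u (xb - m / 2) yb < u (2 * l - xb) yb / 2).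
    { apply Kr; [apply C|]. apply K'; [rewrite Rabs_left; lra|rewrite Rminus_diag, Rabs_R0; lra]. }
    assert (U2 := K (2 * l - (xb - m / 2)) yb).
    replace (2 * l - (xb - m / 2) - (2 * l - xb)) with (m / 2) in U2 by lra.
    rewrite Rminus_diag, Rabs_R0, (Rabs_pos_eq (m / 2)) in U2 by lra.
    specialize (U2 ltac:(lra) ltac:(lra)). apply Rabs_def2 in U2. lra. }
  destruct HA as [xa [ya [Ca Wa]]].
  assert (E' := eq_sym E). revert E'.
  apply (strong_max (cap b l) (w l) _ _ _ _ xa ya x y (open2_cap l) (mp_diff_grad l)
    (mp_diff_lap l) Hw); [| |exact Ca|exact Wa|exact Hxy].
  - intros x1 y1 C1 W1. assert (C1' := C1). destruct C1' as [[lx P1] P1'].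
    destruct (mp_loc l x1 y1 P1 P1' W1) as [d [C [Hd [HC K]]]].
    exists (Rmin d (x1 - l)), C. split; [apply Rmin_pos; lra|]. split; [exact HC|].
    intros a c Ha Hc.
    assert (M1 := Rmin_l d (x1 - l)). assert (M2 := Rmin_r d (x1 - l)).
    destruct (K a c ltac:(lra) ltac:(lra)) as [Pa [Pa' I]].
    assert (Cac : cap b l a c).
    { split; [split; [apply Rabs_def2 in Ha; lra|exact Pa]|exact Pa']. }
    split; [exact Cac|]. apply I. now apply Hw.
  - intros t Ht.
    set (X := xa + t * (x - xa)). set (Y := ya + t * (y - ya)).
    assert (lX : l < X).
    { destruct Ca as [[lxa _] _]. destruct Hxy as [[lx _] _]. unfold X.
      destruct (Rle_lt_dec xa x); nra. }
    assert (PX : pdisc b X Y).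
    { split; [apply sq_sum_pos_l; lra|].
      destruct Ca as [[_ [_ Ba]] _]. destruct Hxy as [[_ [_ Bx]] _].
      assert (I1 : X ^ 2 <= (1 - t) * xa ^ 2 + t * x ^ 2).
      { assert (0 <= t * (1 - t) * (x - xa) ^ 2) by (apply Rmult_le_pos; [nra|apply pow2_ge_0]).
        unfold X. nra. }
      assert (I2 : Y ^ 2 <= (1 - t) * ya ^ 2 + t * y ^ 2).
      { assert (0 <= t * (1 - t) * (y - ya) ^ 2) by (apply Rmult_le_pos; [nra|apply pow2_ge_0]).
        unfold Y. nra. }
      assert ((1 - t) * (xa ^ 2 + ya ^ 2) + t * (x ^ 2 + y ^ 2) < b ^ 2).
      { destruct (Req_dec t 0) as [->|N0]; [lra|].
        assert (t * (x ^ 2 + y ^ 2) < t * b ^ 2) by (apply Rmult_lt_compat_l; lra).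
        assert ((1 - t) * (xa ^ 2 + ya ^ 2) <= (1 - t) * b ^ 2) by (apply Rmult_le_compat_l; lra). lra. }
      lra. }
    destruct (Req_dec ((2 * l - X) ^ 2 + Y ^ 2) 0) as [Z|N].
    + right. destruct (mp_origin_gap X Y PX) as [d [k [Hd [_ [K _]]]]].
      exists d. split; [exact Hd|]. intros a c Cac Ha Hc.
      apply sq_sum_eq0 in Z. destruct Z as [ZX ZY].
      assert (u a c < u (2 * l - a) c); [|unfold w; lra].
      apply K; [exact Ha|exact Hc|apply Cac| |].
      * replace (2 * l - a) with (- (a - X)) by lra. now rewrite Rabs_Ropp.
      * now rewrite ZY, Rminus_0_r in Hc.
    + left. split; [split; [exact lX|exact PX]|]. apply refl_in; [lra|exact lX|exact PX|].
      generalize (pow2_ge_0 (2 * l - X)) (pow2_ge_0 Y). lra.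
Qed.

(** Turns a bad pair into a sign of [p] at a point between, an information that survives when the
    two points merge. *)
Lemma mp_rolle l x y : (forall t, 2 * l - x <= t <= x -> pdisc b t y) -> l < x ->
  u (2 * l - x) y <= u x y -> exists t, 2 * l - x < t < x /\ 0 <= p t y.
Proof.
  intros Hs lx L.
  destruct (mvt_derive (fun t => u t y) (fun t => p t y) (2 * l - x) x) as [t [Ht E]]; [lra| |].
  - intros t Ht. apply (mps_grad H). now apply Hs.
  - exists t. split; [exact Ht|]. nra.
Qed.

Lemma pdisc_abs x y : pdisc b x y -> Rabs x < b /\ Rabs y < b.
Proof.
  intros [_ P]. generalize (pow2_ge_0 x) (pow2_ge_0 y). intros. split; apply Rabs_def1; nra.
Qed.

(** The inequality is required at interior points only, because [p] may tend to 0 at a stagnation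
    point of C_b. *)
Hypothesis Hbdry : forall x y, x ^ 2 + y ^ 2 = b ^ 2 -> 0 < x -> exists d, 0 < d /\
  forall x' y', pdisc b x' y' -> Rabs (x' - x) < d -> Rabs (y' - y) < d -> p x' y' < 0.

(** [ls] is the supremum of the positions that admit a bad pair, which are bounded by b. Pairs for
    positions tending to [ls] have a limit pair, and each possible location of this limit is
    contradictory. *)
Lemma moving_plane_strict l x y : 0 < l -> cap b l x y -> u x y < u (2 * l - x) y.
Proof.
  intros l0 C0. apply Rnot_le_lt. intros Bad0.
  set (bad := fun m => 0 < m /\ exists x y, cap b m x y /\ u (2 * m - x) y <= u x y).
  assert (bad_lt : forall m, bad m -> m < b).
  { intros m [_ [x1 [y1 [[[L P] _] _]]]]. apply pdisc_abs in P.
    destruct P as [P _]. apply Rabs_def2 in P. lra. }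
  destruct (completeness bad) as [ls [S1 S2]].
  { exists b. intros m Hm. left. now apply bad_lt. }
  { exists l. split; [exact l0|]. now exists x, y. }
  assert (ls0 : 0 < ls).
  { assert (l <= ls); [|lra]. apply S1. split; [exact l0|]. now exists x, y. }
  assert (lsb : ls <= b) by (apply S2; intros m Hm; left; now apply bad_lt).
  assert (good : forall m a c, ls < m -> cap b m a c -> 0 < w m a c).
  { intros m a c Hm Cac. apply Rnot_le_lt. intros L. assert (m <= ls); [|lra].
    apply S1. split; [lra|]. exists a, c. unfold w in L. split; [exact Cac|lra]. }
  (* A strict violation at [ls] would persist for planes slightly further right, all of which are
     good. *)
  assert (wls : forall a c, cap b ls a c -> 0 <= w ls a c).
  { intros a c Cac. apply Rnot_lt_le. intros L. unfold w in L.
    destruct Cac as [[la Pa] Pa'].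
    destruct (cont2_eps u _ _ (u a c - u (2 * ls - a) c) (mp_cont _ _ Pa') ltac:(lra)) as [d [Hd K]].
    destruct (open2_pdisc b _ _ Pa') as [d2 K2]. assert (Q2 := cond_pos d2).
    set (m := Rmin (Rmin d d2) (a - ls)).
    assert (Hm : 0 < m <= d /\ m <= d2 /\ m <= a - ls).
    { unfold m. generalize (Rmin_l (Rmin d d2) (a - ls)) (Rmin_r (Rmin d d2) (a - ls))
        (Rmin_l d d2) (Rmin_r d d2). assert (0 < Rmin d d2) by (apply Rmin_pos; lra).
      assert (0 < Rmin (Rmin d d2) (a - ls)) by (apply Rmin_pos; lra). lra. }
    set (mu := ls + m / 3).
    assert (E : Rabs (2 * mu - a - (2 * ls - a)) < m).
    { unfold mu. rewrite Rabs_pos_eq; lra. }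
    assert (E0 : Rabs (c - c) < m) by (rewrite Rminus_diag, Rabs_R0; lra).
    assert (G : 0 < w mu a c).
    { apply good; [unfold mu; lra|]. split; [split; [unfold mu; lra|exact Pa]|].
      apply K2; lra. }
    assert (T := K (2 * mu - a) c ltac:(lra) ltac:(lra)). apply Rabs_def2 in T.
    unfold w in G. lra. }
  assert (strict : forall a c, cap b ls a c -> 0 < w ls a c).
  { intros a c Cac. apply cap_strict; [|exact wls|exact Cac]. split; [exact ls0|].
    destruct Cac as [[L P] _]. apply pdisc_abs in P. destruct P as [P _]. apply Rabs_def2 in P. lra. }
  assert (Seq : forall n : nat, exists z : R * (R * R), (0 < fst z /\ Rabs (fst z - ls) < / INR (S n)) /\
    cap b (fst z) (fst (snd z)) (snd (snd z)) /\
    u (2 * fst z - fst (snd z)) (snd (snd z)) <= u (fst (snd z)) (snd (snd z))).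
  { intros n. assert (P : 0 < / INR (S n)) by apply Rinv_0_lt_compat, lt_0_INR, Nat.lt_0_succ.
    apply NNPP. intros NN. assert (ls <= ls - / INR (S n)); [|lra].
    apply S2. intros m Hm. apply Rnot_lt_le. intros L. apply NN.
    assert (m <= ls) by now apply S1.
    destruct Hm as [m0 [x1 [y1 [C1 U1]]]]. exists (m, (x1, y1)). cbn [fst snd]. split; [|now split].
    split; [exact m0|]. apply Rabs_def1; lra. }
  set (z := fun n => proj1_sig (constructive_indefinite_description _ (Seq n))).
  assert (Hz : forall n, (0 < fst (z n) /\ Rabs (fst (z n) - ls) < / INR (S n)) /\
    cap b (fst (z n)) (fst (snd (z n))) (snd (snd (z n))) /\
    u (2 * fst (z n) - fst (snd (z n))) (snd (snd (z n))) <= u (fst (snd (z n))) (snd (snd (z n)))).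
  { intros n. unfold z. apply (proj2_sig (constructive_indefinite_description _ (Seq n))). }
  destruct (cluster_point_2d (fun n => fst (snd (z n))) (fun n => snd (snd (z n))) b)
    as [X [Y HXY]].
  { intros n. left. destruct (Hz n) as [_ [[[_ P] _] _]]. now apply pdisc_abs in P. }
  { intros n. left. destruct (Hz n) as [_ [[[_ P] _] _]]. now apply pdisc_abs in P. }
  (* Bad pairs accumulate: their right points at (X, Y), their left points at (2 ls - X, Y). *)
  assert (Near : forall e, 0 < e -> exists m a c, 0 < m /\ Rabs (m - ls) < e /\ Rabs (a - X) < e /\
    Rabs (c - Y) < e /\ Rabs ((2 * m - a) - (2 * ls - X)) < 3 * e /\ cap b m a c /\ u (2 * m - a) c <= u a c).
  { intros e He. destruct (archimed_cor1 e He) as [N [HN N0]].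
    destruct (HXY e He N) as [n [Hn [A1 A2]]]. destruct (Hz n) as [[m0 Hm] [Cn Un]].
    exists (fst (z n)), (fst (snd (z n))), (snd (snd (z n))).
    assert (/ INR (S n) <= / INR N).
    { apply Rinv_le_contravar; [now apply lt_0_INR|apply le_INR; lia]. }
    split; [exact m0|]. split; [lra|]. split; [exact A1|]. split; [exact A2|]. split; [|now split].
    assert (Hm' : Rabs (fst (z n) - ls) < e) by lra.
    apply Rabs_def2 in A1. apply Rabs_def2 in Hm'. apply Rabs_def1; lra. }
  clear z Hz HXY Seq.
  assert (Xls : ls <= X).
  { apply Rnot_lt_le. intros L. destruct (Near ((ls - X) / 2) ltac:(lra))
      as [m [a [c [_ [A1 [A2 [_ [_ [[[A3 _] _] _]]]]]]]]].
    apply Rabs_def2 in A1. apply Rabs_def2 in A2. lra. }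
  assert (XYb : X ^ 2 + Y ^ 2 <= b ^ 2).
  { apply Rnot_lt_le. intros L.
    destruct (box_sq_ge b X Y hb L) as [d [Hd K]].
    destruct (Near d Hd) as [m [a [c [_ [_ [A2 [A3 [_ [[[_ [_ A4]] _] _]]]]]]]]].
    specialize (K a c A2 A3). lra. }
  assert (XY0 : 0 < X ^ 2 + Y ^ 2) by (apply sq_sum_pos_l; lra).
  (* The left limit may be the origin, where [u] has no value; a positive lower bound of [u] near it
     is what the case of (X, Y) on C_b uses. *)
  assert (Lower : (2 * ls - X) ^ 2 + Y ^ 2 < b ^ 2 -> exists d k, 0 < d /\ 0 < k /\ forall a c,
    pdisc b a c -> Rabs (a - (2 * ls - X)) < d -> Rabs (c - Y) < d -> k < u a c).
  { intros B2. destruct (Req_dec ((2 * ls - X) ^ 2 + Y ^ 2) 0) as [Z|N].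
    - apply sq_sum_eq0 in Z. destruct Z as [Z1 Z2].
      destruct (mp_origin_gap (b / 2) 0) as [d [k [Hd [Hk [_ K]]]]]; [split; nra|].
      exists d, k. split; [exact Hd|]. split; [exact Hk|]. intros a c P A1 A2.
      rewrite Z1, Rminus_0_r in A1. rewrite Z2, Rminus_0_r in A2. now apply K.
    - assert (P : pdisc b (2 * ls - X) Y).
      { split; [|exact B2]. generalize (pow2_ge_0 (2 * ls - X)) (pow2_ge_0 Y). lra. }
      assert (Up := mps_pos H _ _ P).
      destruct (cont2_eps u _ _ (u (2 * ls - X) Y / 2) (mp_cont _ _ P) ltac:(lra)) as [d [Hd K]].
      exists d, (u (2 * ls - X) Y / 2). split; [exact Hd|]. split; [lra|].
      intros a c _ A1 A2. specialize (K a c A1 A2). apply Rabs_def2 in K. lra. }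
  destruct XYb as [XYb|XYb].
  - assert (P : pdisc b X Y) by now split.
    destruct (Rle_lt_or_eq_dec _ _ Xls) as [lX|EX].
    + destruct (Req_dec ((2 * ls - X) ^ 2 + Y ^ 2) 0) as [Z|N].
      (* The left points tend to the origin, where [u] exceeds its values near (X, Y): the pairs
         cannot be bad. *)
      * apply sq_sum_eq0 in Z. destruct Z as [Z1 Z2].
        destruct (mp_origin_gap X Y P) as [d [k [Hd [_ [K _]]]]].
        destruct (Near (d / 3) ltac:(lra)) as [m [a [c [_ [_ [A2 [A3 [A4 [[_ Pr] A6]]]]]]]]].
        rewrite Z1, Rminus_0_r in A4. 
        assert (A3' := A3). rewrite Z2, Rminus_0_r in A3'.
        assert (u a c < u (2 * m - a) c); [|lra].
        apply K; [lra|lra|exact Pr|lra|lra].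
      * assert (P' : pdisc b (2 * ls - X) Y).
        { apply refl_in; [lra|lra|exact P|]. generalize (pow2_ge_0 (2 * ls - X)) (pow2_ge_0 Y). lra. }
        assert (W : 0 < w ls X Y) by (apply strict; split; [split; [exact lX|exact P]|exact P']).
        unfold w in W. set (g := u (2 * ls - X) Y - u X Y) in *.
        destruct (cont2_eps u _ _ (g / 2) (mp_cont _ _ P) ltac:(lra)) as [d1 [Hd1 K1]].
        destruct (cont2_eps u _ _ (g / 2) (mp_cont _ _ P') ltac:(lra)) as [d2 [Hd2 K2]].
        assert (M0 : 0 < Rmin d1 d2) by (apply Rmin_pos; lra).
        assert (M1 := Rmin_l d1 d2). assert (M2 := Rmin_r d1 d2).
        destruct (Near (Rmin d1 d2 / 3) ltac:(lra)) as [m [a [c [_ [_ [A2 [A3 [A4 [_ A6]]]]]]]]].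
        specialize (K1 a c ltac:(lra) ltac:(lra)). specialize (K2 (2 * m - a) c ltac:(lra) ltac:(lra)).
        apply Rabs_def2 in K1. apply Rabs_def2 in K2. unfold g in *. lra.
    + (* The segments joining the pairs shrink to [(X, Y)], on the plane [x = ls]. *)
      assert (pge : 0 <= p X Y).
      { apply Rnot_lt_le. intros pn.
        destruct (mps_grad H X Y P) as [_ [_ [Cp _]]].
        destruct (cont2_eps p _ _ (- p X Y) Cp ltac:(lra)) as [d1 [Hd1 K1]].
        destruct (open2_pdisc b X Y P) as [d2 K2]. assert (Hd2 := cond_pos d2).
        assert (M0 : 0 < Rmin d1 d2) by (apply Rmin_pos; lra).
        assert (M1 := Rmin_l d1 d2). assert (M2 := Rmin_r d1 d2).
        destruct (Near (Rmin d1 d2 / 3) ltac:(lra)) as [m [a [c [_ [A1 [A2 [A3 [A4 [[[A7 _] _] A6]]]]]]]]].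
        apply Rabs_def2 in A2. apply Rabs_def2 in A4.
        destruct (mp_rolle m a c) as [t [Ht Hp]]; [|exact A7|exact A6|].
        - intros t Ht. apply K2; [apply Rabs_def1; lra|lra].
        - assert (T := K1 t c ltac:(apply Rabs_def1; lra) ltac:(lra)). apply Rabs_def2 in T. lra. }
      rewrite <- EX in *. clear X EX.
      assert (W0 : w ls ls Y = 0) by (unfold w; replace (2 * ls - ls) with ls by ring; ring).
      assert (P' : pdisc b (2 * ls - ls) Y) by (replace (2 * ls - ls) with ls by ring; exact P).
      destruct (mp_loc ls ls Y P P' W0) as [d [C [Hd [HC K]]]].
      (* The disc of radius rho centred at (ls + rho, Y) touches the plane x = ls at (ls, Y) and
         lies in the region where [mp_loc] gives the differential inequality. *)
      set (rho := d / 2). assert (rho0 : 0 < rho) by (unfold rho; lra).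
      assert (Sub : forall a c, disc (ls + rho) Y rho a c -> ls < a /\ Rabs (a - ls) < d /\ Rabs (c - Y) < d).
      { intros a c D0. unfold disc in D0.
        assert (T1 := pow2_ge_0 (a - (ls + rho))). assert (T2 := pow2_ge_0 (c - Y)).
        assert (- rho < a - (ls + rho) < rho) by nra. assert (- rho < c - Y < rho) by nra.
        unfold rho in *. split; [lra|]. split; apply Rabs_def1; lra. }
      assert (SubC : forall a c, disc (ls + rho) Y rho a c -> cap b ls a c).
      { intros a c D0. destruct (Sub a c D0) as [L [A1 A2]]. destruct (K a c A1 A2) as [Q1 [Q2 _]].
        split; [split; [exact L|exact Q1]|exact Q2]. }
      assert (HLd : has_lap (disc (ls + rho) Y rho) (w ls)
        (fun x y => - p (2 * ls - x) y - p x y) (fun x y => q (2 * ls - x) y - q x y)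
        (fun x y => pxx (2 * ls - x) y - pxx x y) (fun x y => qyy (2 * ls - x) y - qyy x y)).
      { intros a c D0. apply (mp_diff_lap ls). now apply SubC. }
      destruct (hopf _ _ _ _ _ (ls + rho) Y rho C rho0 HC HLd) as [k [k0 Hk]].
      { intros a c D0. assert (Cac := SubC a c D0). split; [now apply strict|]. split.
        - eapply has_grad_continuous; [apply open2_cap|apply mp_diff_grad|exact Cac].
        - destruct (Sub a c D0) as [L [A1 A2]]. apply (K a c A1 A2). now apply wls. }
      destruct (mps_grad H ls Y P) as [Du _].
      (* The derivative is k / 2 + 2 rho p (ls, Y) > 0, since p >= 0 there. So the reflected
         difference stays below k t / 2 for small t, against the bound k t of Hopf's lemma. *)
      assert (G : is_derive (fun t => k / 2 * t - (u (ls - rho * t) Y - u (ls + rho * t) Y)) 0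
        (k / 2 - (- rho * p ls Y - rho * p ls Y))).
      { apply derive_minus; [auto_derive; [easy|ring]|]. apply derive_minus.
        - apply (derive_comp (fun s => u s Y) (fun t => ls - rho * t)).
          + now rewrite Rmult_0_r, Rminus_0_r.
          + auto_derive; [easy|ring].
        - apply (derive_comp (fun s => u s Y) (fun t => ls + rho * t)).
          + now rewrite Rmult_0_r, Rplus_0_r.
          + auto_derive; [easy|ring]. }
      destruct (derive_pos_right _ _ _ G) as [e [He [Re _]]]; [nra|].
      set (t := Rmin e 1 / 2).
      assert (Ht : 0 < t < e /\ t < 1).
      { unfold t. assert (0 < Rmin e 1) by (apply Rmin_pos; lra).
        generalize (Rmin_l e 1) (Rmin_r e 1). lra. }
      assert (R1 := Re t ltac:(lra)). cbv beta in R1.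
      rewrite !Rmult_0_r, Rminus_0_r, Rplus_0_r in R1.
      assert (R2 := Hk (-1) 0 t ltac:(ring) ltac:(lra)). unfold w in R2.
      replace (ls + rho + (1 - t) * rho * -1) with (ls + rho * t) in R2 by ring.
      replace (2 * ls - (ls + rho * t)) with (ls - rho * t) in R2 by ring.
      replace (Y + (1 - t) * rho * 0) with Y in R2 by ring. nra.
  - destruct (Rle_lt_or_eq_dec _ _ Xls) as [lX|EX].
    (* The right points tend to C_b, where [u] tends to 0, while [u] stays above k at the left
       points. *)
    + destruct Lower as [d [k [Hd [Hk K]]]]; [nra|].
      destruct (mps_boundary H k Hk) as [r [Hr Kr]].
      destruct (box_sq_ge r X Y ltac:(lra) ltac:(nra)) as [d' [Hd' K']].
      assert (M0 : 0 < Rmin d d') by (apply Rmin_pos; lra).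
      assert (M1 := Rmin_l d d'). assert (M2 := Rmin_r d d').
      destruct (Near (Rmin d d' / 3) ltac:(lra)) as [m [a [c [_ [A1 [A2 [A3 [A4 [[[A7 A8] A9] A6]]]]]]]]].
      assert (k < u (2 * m - a) c) by (apply K; [exact A9|lra|lra]).
      assert (u a c < k) by (apply Kr; [exact A8|apply K'; lra]). lra.
    + destruct (Hbdry X Y XYb ltac:(lra)) as [d [Hd K]].
      (* The bound e <= X keeps the segments between paired points in the half plane x > 0, away
         from the origin. *)
      set (e := Rmin d X). assert (M0 : 0 < e) by (apply Rmin_pos; lra).
      assert (M1 := Rmin_l d X). assert (M2 := Rmin_r d X). fold e in M1, M2.
      destruct (Near (e / 3) ltac:(lra)) as [m [a [c [m0 [A1 [A2 [A3 [A4 [[[A7 A8] A9] A6]]]]]]]]].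
      apply Rabs_def2 in A2. apply Rabs_def2 in A4.
      assert (Seg : forall t, 2 * m - a <= t <= a -> pdisc b t c).
      { intros t Ht. split; [apply sq_sum_pos_l; lra|]. destruct A8 as [_ A8]. nra. }
      destruct (mp_rolle m a c Seg A7 A6) as [t [Ht Hp]].
      assert (p t c < 0); [|lra].
      apply K; [apply Seg; lra|apply Rabs_def1; lra|lra].
Qed.

(** A violation for the plane x = 0 would persist, by continuity of [u] at (- x, y), for slightly
    positive l. *)
Theorem moving_plane x y : pdisc b x y -> 0 < x -> u x y <= u (- x) y.
Proof.
  intros P x0. apply Rnot_lt_le. intros L.
  assert (P' : pdisc b (- x) y) by (destruct P; split; nra).
  destruct (cont2_eps u _ _ (u x y - u (- x) y) (mp_cont _ _ P') ltac:(lra)) as [d [Hd K]].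
  destruct (open2_pdisc b _ _ P') as [d2 K2]. assert (Hd2 := cond_pos d2).
  set (m := Rmin (Rmin d d2) x).
  assert (Hm : 0 < m <= d /\ m <= d2 /\ m <= x).
  { unfold m. generalize (Rmin_l (Rmin d d2) x) (Rmin_r (Rmin d d2) x)
      (Rmin_l d d2) (Rmin_r d d2). assert (0 < Rmin d d2) by (apply Rmin_pos; lra).
    assert (0 < Rmin (Rmin d d2) x) by (apply Rmin_pos; lra). lra. }
  assert (E : Rabs (2 * (m / 3) - x - - x) < m) by (rewrite Rabs_pos_eq; lra).
  assert (E0 : Rabs (y - y) < m) by (rewrite Rminus_diag, Rabs_R0; lra).
  assert (S := moving_plane_strict (m / 3) x y ltac:(lra)).
  assert (C : cap b (m / 3) x y).
  { split; [split; [lra|exact P]|]. apply K2; lra. }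
  specialize (S C). specialize (K (2 * (m / 3) - x) y ltac:(lra) ltac:(lra)).
  apply Rabs_def2 in K. lra.
Qed.

End MovingPlane.

(** * Radial symmetry *)

(** Form of [moving_plane_setting] that makes sense in every frame at once: the full Hessian is
    named, so that the pure second derivatives of a rotated function can be expressed, and
    [ds_slope] covers every outward direction. *)
Record disc_setting (b : R) (u p q p1 p2 q1 q2 : R -> R -> R) : Prop := {
  ds_b : 0 < b;
  ds_grad : has_grad (pdisc b) u p q;
  ds_grad_p : has_grad (pdisc b) p p1 p2;
  ds_grad_q : has_grad (pdisc b) q q1 q2;
  ds_pos : forall x y, pdisc b x y -> 0 < u x y;
  ds_boundary : forall e, 0 < e -> exists r, 0 < r < b /\
    forall x y, pdisc b x y -> r ^ 2 < x ^ 2 + y ^ 2 -> u x y < e;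
  ds_origin : forall x y, pdisc b x y -> exists r, 0 < r /\
    forall x' y', pdisc b x' y' -> x' ^ 2 + y' ^ 2 < r ^ 2 -> u x y < u x' y';
  ds_lip : forall x y, pdisc b x y -> exists eta C, 0 < eta /\ 0 <= C /\
    forall x1 y1 x2 y2, pdisc b x1 y1 -> pdisc b x2 y2 ->
      Rabs (u x1 y1 - u x y) < eta -> Rabs (u x2 y2 - u x y) < eta ->
      Rabs ((p1 x1 y1 + q2 x1 y1) - (p1 x2 y2 + q2 x2 y2)) <= C * Rabs (u x1 y1 - u x2 y2);
  ds_slope : forall x y e1 e2, x ^ 2 + y ^ 2 = b ^ 2 -> 0 < e1 * x + e2 * y -> exists d, 0 < d /\
    forall x' y', pdisc b x' y' -> Rabs (x' - x) < d -> Rabs (y' - y) < d ->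
      e1 * p x' y' + e2 * q x' y' < 0
}.

Arguments ds_b {_ _ _ _ _ _ _ _}.
Arguments ds_grad {_ _ _ _ _ _ _ _}.
Arguments ds_grad_p {_ _ _ _ _ _ _ _}.
Arguments ds_grad_q {_ _ _ _ _ _ _ _}.
Arguments ds_pos {_ _ _ _ _ _ _ _}.
Arguments ds_boundary {_ _ _ _ _ _ _ _}.
Arguments ds_origin {_ _ _ _ _ _ _ _}.
Arguments ds_lip {_ _ _ _ _ _ _ _}.
Arguments ds_slope {_ _ _ _ _ _ _ _}.

Definition rot (e1 e2 : R) (f : R -> R -> R) (x y : R) : R :=
  f (e1 * x - e2 * y) (e2 * x + e1 * y).

Lemma rot_sq e1 e2 x y : e1 ^ 2 + e2 ^ 2 = 1 ->
  (e1 * x - e2 * y) ^ 2 + (e2 * x + e1 * y) ^ 2 = x ^ 2 + y ^ 2.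
Proof.
  intros He. replace ((e1 * x - e2 * y) ^ 2 + (e2 * x + e1 * y) ^ 2) with
    ((e1 ^ 2 + e2 ^ 2) * (x ^ 2 + y ^ 2)) by ring. rewrite He. ring.
Qed.

Lemma rot_pdisc b e1 e2 x y : e1 ^ 2 + e2 ^ 2 = 1 ->
  pdisc b x y -> pdisc b (e1 * x - e2 * y) (e2 * x + e1 * y).
Proof. intros He P. unfold pdisc. now rewrite rot_sq. Qed.

Lemma continuity_2d_linear a c x y : continuity_2d_pt (fun s t => a * s + c * t) x y.
Proof.
  apply continuity_2d_pt_plus; apply continuity_2d_pt_mult;
    first [apply continuity_2d_pt_const|apply continuity_2d_pt_id1|apply continuity_2d_pt_id2].
Qed.

Lemma continuity_2d_rot e1 e2 f x y :
  continuity_2d_pt f (e1 * x - e2 * y) (e2 * x + e1 * y) -> continuity_2d_pt (rot e1 e2 f) x y.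
Proof.
  intros Hf. apply (continuity_2d_comp2 f (fun s t => e1 * s - e2 * t) (fun s t => e2 * s + e1 * t));
    [exact Hf| |apply continuity_2d_linear].
  apply continuity_2d_pt_ext with (fun s t => e1 * s + - e2 * t); [intros; ring|apply continuity_2d_linear].
Qed.

Lemma has_grad_rot b e1 e2 f fx fy : e1 ^ 2 + e2 ^ 2 = 1 ->
  has_grad (pdisc b) f fx fy ->
  has_grad (pdisc b) (rot e1 e2 f)
    (fun x y => e1 * rot e1 e2 fx x y + e2 * rot e1 e2 fy x y)
    (fun x y => - e2 * rot e1 e2 fx x y + e1 * rot e1 e2 fy x y).
Proof.
  intros He Hf x y P. assert (P' := rot_pdisc b e1 e2 x y He P).
  destruct (Hf _ _ P') as [_ [_ [C1 C2]]].
  assert (K : forall a c, continuity_2d_pt (fun x y => a * rot e1 e2 fx x y + c * rot e1 e2 fy x y) x y).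
  { intros a c. apply continuity_2d_pt_plus; apply continuity_2d_pt_mult;
      first [apply continuity_2d_pt_const|now apply continuity_2d_rot]. }
  split; [|split; [|split; apply K]].
  - apply is_derive_eq with (rot e1 e2 fx x y * e1 + rot e1 e2 fy x y * e2); [|ring].
    apply (has_grad_comp (pdisc b) f fx fy (fun s => e1 * s - e2 * y) (fun s => e2 * s + e1 * y));
      [apply open2_pdisc|exact Hf|exact P'| |]; auto_derive; try easy; ring.
  - apply is_derive_eq with (rot e1 e2 fx x y * (- e2) + rot e1 e2 fy x y * e1); [|ring].
    apply (has_grad_comp (pdisc b) f fx fy (fun s => e1 * x - e2 * s) (fun s => e2 * x + e1 * s));
      [apply open2_pdisc|exact Hf|exact P'| |]; auto_derive; try easy; ring.
Qed.

(** The trace of the Hessian is invariant under rotation, so the Lipschitz condition on the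
    Laplacian keeps its constants. *)
Lemma rot_setting b u p q p1 p2 q1 q2 e1 e2 : e1 ^ 2 + e2 ^ 2 = 1 ->
  disc_setting b u p q p1 p2 q1 q2 ->
  moving_plane_setting b (rot e1 e2 u)
    (fun x y => e1 * rot e1 e2 p x y + e2 * rot e1 e2 q x y)
    (fun x y => - e2 * rot e1 e2 p x y + e1 * rot e1 e2 q x y)
    (fun x y => e1 * (e1 * rot e1 e2 p1 x y + e2 * rot e1 e2 p2 x y)
      + e2 * (e1 * rot e1 e2 q1 x y + e2 * rot e1 e2 q2 x y))
    (fun x y => - e2 * (- e2 * rot e1 e2 p1 x y + e1 * rot e1 e2 p2 x y)
      + e1 * (- e2 * rot e1 e2 q1 x y + e1 * rot e1 e2 q2 x y)).
Proof.
  intros He H.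
  assert (G := has_grad_rot b e1 e2 _ _ _ He (ds_grad H)).
  assert (Gp := has_grad_rot b e1 e2 _ _ _ He (ds_grad_p H)).
  assert (Gq := has_grad_rot b e1 e2 _ _ _ He (ds_grad_q H)).
  split.
  - exact (ds_b H).
  - exact G.
  - intros x y P. destruct (G x y P) as [G1 [G2 _]]. destruct (Gp x y P) as [A1 [A2 _]].
    destruct (Gq x y P) as [B1 [B2 _]].
    split; [exact G1|split; [|split; [exact G2|]]];
      apply derive_plus; now apply derive_scal.
  - intros x y P. apply (ds_pos H). now apply rot_pdisc.
  - intros e He'. destruct (ds_boundary H e He') as [r [Hr K]].
    exists r. split; [exact Hr|]. intros x y P L. apply K; [now apply rot_pdisc|now rewrite rot_sq].
  - intros x y P. destruct (ds_origin H _ _ (rot_pdisc b e1 e2 x y He P)) as [r [Hr K]].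
    exists r. split; [exact Hr|]. intros x' y' P' L. apply K; [now apply rot_pdisc|now rewrite rot_sq].
  - intros x y P. destruct (ds_lip H _ _ (rot_pdisc b e1 e2 x y He P)) as [eta [C [Heta [HC K]]]].
    exists eta, C. split; [exact Heta|]. split; [exact HC|].
    intros x1 y1 x2 y2 P1 P2 L1 L2.
    assert (Q := K _ _ _ _ (rot_pdisc b e1 e2 x1 y1 He P1) (rot_pdisc b e1 e2 x2 y2 He P2) L1 L2).
    assert (E : forall X Y, e1 * (e1 * rot e1 e2 p1 X Y + e2 * rot e1 e2 p2 X Y)
      + e2 * (e1 * rot e1 e2 q1 X Y + e2 * rot e1 e2 q2 X Y)
      + (- e2 * (- e2 * rot e1 e2 p1 X Y + e1 * rot e1 e2 p2 X Y)
      + e1 * (- e2 * rot e1 e2 q1 X Y + e1 * rot e1 e2 q2 X Y)) = rot e1 e2 p1 X Y + rot e1 e2 q2 X Y).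
    { intros. transitivity ((e1 ^ 2 + e2 ^ 2) * (rot e1 e2 p1 X Y + rot e1 e2 q2 X Y)); [ring|].
      rewrite He. ring. }
    rewrite !E. exact Q.
Qed.

(** Two distinct points of one circle are exchanged by the reflection whose axis passes through 0
    orthogonally to their difference. [moving_plane] in the frame directed by this difference gives
    one inequality; exchanging the points gives the other. *)
Theorem disc_setting_radial b u p q p1 p2 q1 q2 x y x' y' :
  disc_setting b u p q p1 p2 q1 q2 -> pdisc b x y -> x ^ 2 + y ^ 2 = x' ^ 2 + y' ^ 2 ->
  u x y = u x' y'.
Proof.
  intros H.
  assert (Half : forall x y x' y', pdisc b x y -> x ^ 2 + y ^ 2 = x' ^ 2 + y' ^ 2 -> u x y <= u x' y').
  { clear x y x' y'. intros x y x' y' P E.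
    set (D2 := (x - x') ^ 2 + (y - y') ^ 2).
    destruct (Req_dec D2 0) as [Z|N].
    { apply sq_sum_eq0 in Z. replace x' with x by lra. replace y' with y by lra. lra. }
    assert (Dp : 0 < D2).
    { unfold D2 in *. generalize (pow2_ge_0 (x - x')) (pow2_ge_0 (y - y')). lra. }
    set (s := sqrt D2). assert (s0 : 0 < s) by now apply sqrt_lt_R0.
    assert (s2 : s ^ 2 = D2) by (apply pow2_sqrt; lra).
    set (e1 := (x - x') / s). set (e2 := (y - y') / s).
    assert (He : e1 ^ 2 + e2 ^ 2 = 1).
    { unfold e1, e2. replace (((x - x') / s) ^ 2 + ((y - y') / s) ^ 2) with (D2 / s ^ 2)
        by (unfold D2; field; lra). rewrite s2. field. lra. }
    assert (Dx : D2 = 2 * (x * (x - x') + y * (y - y'))) by (unfold D2; lra).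
    set (a := e1 * x + e2 * y). set (c := - e2 * x + e1 * y).
    assert (a2 : 2 * a = s).
    { unfold a, e1, e2. replace (2 * ((x - x') / s * x + (y - y') / s * y)) with (D2 / s)
        by (rewrite Dx; field; lra). rewrite <- s2. field. lra. }
    assert (R1 : e1 * a - e2 * c = x).
    { unfold a, c. transitivity ((e1 ^ 2 + e2 ^ 2) * x); [ring|rewrite He; ring]. }
    assert (R2 : e2 * a + e1 * c = y).
    { unfold a, c. transitivity ((e1 ^ 2 + e2 ^ 2) * y); [ring|rewrite He; ring]. }
    assert (E1 : 2 * a * e1 = x - x') by (rewrite a2; unfold e1; field; lra).
    assert (E2 : 2 * a * e2 = y - y') by (rewrite a2; unfold e2; field; lra).
    assert (Pa : pdisc b a c).
    { unfold pdisc in *. rewrite <- (rot_sq e1 e2 a c He), R1, R2. exact P. }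
    assert (M := moving_plane b _ _ _ _ _ (rot_setting _ _ _ _ _ _ _ _ e1 e2 He H)).
    assert (M' : rot e1 e2 u a c <= rot e1 e2 u (- a) c).
    { apply M; [|exact Pa|lra]. intros X Y EXY X0.
      destruct (ds_slope H (e1 * X - e2 * Y) (e2 * X + e1 * Y) e1 e2) as [d [Hd K]].
      { now rewrite rot_sq. }
      { replace (e1 * (e1 * X - e2 * Y) + e2 * (e2 * X + e1 * Y)) with ((e1 ^ 2 + e2 ^ 2) * X) by ring.
        rewrite He. lra. }
      exists (d / 2). split; [lra|]. intros X' Y' P' A1 A2. unfold rot.
      assert (B1 : Rabs e1 <= 1) by (apply sq_le_abs; [lra|generalize (pow2_ge_0 e2); lra]).
      assert (B2 : Rabs e2 <= 1) by (apply sq_le_abs; [lra|generalize (pow2_ge_0 e1); lra]).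
      assert (T : forall g h z t, Rabs g <= 1 -> Rabs h <= 1 -> Rabs z < d / 2 -> Rabs t < d / 2 ->
        Rabs (g * z + h * t) < d).
      { intros g h z t G1 G2 Z1 Z2. eapply Rle_lt_trans; [apply Rabs_triang|]. rewrite !Rabs_mult.
        generalize (Rabs_pos g) (Rabs_pos h) (Rabs_pos z) (Rabs_pos t). nra. }
      apply K; [now apply rot_pdisc| |].
      - replace (e1 * X' - e2 * Y' - (e1 * X - e2 * Y)) with (e1 * (X' - X) + - e2 * (Y' - Y)) by ring.
        apply T; try assumption. now rewrite Rabs_Ropp.
      - replace (e2 * X' + e1 * Y' - (e2 * X + e1 * Y)) with (e2 * (X' - X) + e1 * (Y' - Y)) by ring.
        now apply T. }
    unfold rot in M'. rewrite R1, R2 in M'.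
    replace (e1 * - a - e2 * c) with x' in M' by lra.
    replace (e2 * - a + e1 * c) with y' in M' by lra. exact M'. }
  intros P E. apply Rle_antisym; apply Half; try assumption; [|now symmetry].
  unfold pdisc in *. now rewrite <- E.
Qed.

(** * Primitives of closed forms *)

Lemma open2_preimage (D : R -> R -> Prop) (g1 g2 : R -> R -> R) :
  open2 D -> (forall x y, continuity_2d_pt g1 x y) -> (forall x y, continuity_2d_pt g2 x y) ->
  open2 (fun x y => D (g1 x y) (g2 x y)).
Proof.
  intros oD H1 H2 x y Dxy. destruct (oD _ _ Dxy) as [d Hd].
  destruct (H1 x y d) as [d1 K1]. destruct (H2 x y d) as [d2 K2].
  assert (P : 0 < Rmin d1 d2) by (apply Rmin_pos; apply cond_pos).
  exists (mkposreal _ P). simpl. intros u v Hu Hv.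
  apply Hd; [apply K1|apply K2]; eapply Rlt_le_trans; try eassumption;
    first [apply Rmin_l | apply Rmin_r].
Qed.

Lemma continuity_pt_continuous (f : R -> R) x : continuity_pt f x -> continuous f x.
Proof. intros H. now apply continuity_pt_filterlim. Qed.

Lemma pdisc_scale b t x y l : 0 < l -> pdisc b x y -> pdisc b (l * x) (l * y) ->
  Rmin 1 l <= t <= Rmax 1 l -> 0 < t /\ pdisc b (t * x) (t * y).
Proof.
  intros Hl [P1 P2] [Q1 Q2] Ht.
  assert (t0 : 0 < t) by (assert (0 < Rmin 1 l) by (apply Rmin_pos; lra); lra).
  split; [exact t0|]. unfold pdisc.
  replace ((t * x) ^ 2 + (t * y) ^ 2) with (t ^ 2 * (x ^ 2 + y ^ 2)) by ring.
  replace ((l * x) ^ 2 + (l * y) ^ 2) with (l ^ 2 * (x ^ 2 + y ^ 2)) in Q2 by ring.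
  split; [apply Rmult_lt_0_compat; [nra|lra]|].
  destruct (Rle_lt_dec 1 l) as [L|L].
  - rewrite Rmin_left, Rmax_right in Ht by lra.
    assert (t ^ 2 * (x ^ 2 + y ^ 2) <= l ^ 2 * (x ^ 2 + y ^ 2)); [|lra].
    apply Rmult_le_compat_r; nra.
  - rewrite Rmin_right, Rmax_left in Ht by lra.
    assert (t ^ 2 * (x ^ 2 + y ^ 2) <= 1 * (x ^ 2 + y ^ 2)); [|lra].
    apply Rmult_le_compat_r; nra.
Qed.

Section RadialIntegral.

Variables (b : R) (a c a1 a2 c1 c2 : R -> R -> R).
Hypothesis Ga : has_grad (pdisc b) a a1 a2.
Hypothesis Gc : has_grad (pdisc b) c c1 c2.
Hypothesis closed : forall x y, pdisc b x y -> a2 x y = c1 x y.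

(** Line integral of a dx + c dy from (x, y) to l (x, y) along the ray. A punctured disc is not
    simply connected, so a primitive cannot be integrated from a centre; it is integrated radially
    from a circle instead, on paths that avoid the origin. *)
Definition radial_int (l x y : R) : R :=
  RInt (fun t => x * a (t * x) (t * y) + y * c (t * x) (t * y)) 1 l.

Let D (y l x : R) : Prop := 0 < l /\ (pdisc b x y /\ pdisc b (l * x) (l * y)).

Let oD y : open2 (D y).
Proof.
  apply open2_and; [|apply open2_and].
  - apply (open2_lt (fun _ _ => 0) (fun l _ => l)); intros;
      [apply continuity_2d_pt_const|apply continuity_2d_pt_id1].
  - apply (open2_preimage (pdisc b) (fun _ x => x) (fun _ _ => y)); [apply open2_pdisc|..]; intros;
      [apply continuity_2d_pt_id2|apply continuity_2d_pt_const].
  - apply (open2_preimage (pdisc b) (fun l x => l * x) (fun l x => l * y)); [apply open2_pdisc|..];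
      intros; apply continuity_2d_pt_mult;
      first [apply continuity_2d_pt_id1|apply continuity_2d_pt_id2|apply continuity_2d_pt_const].
Qed.

Let cont_scaled (f : R -> R -> R) (x y t : R) : continuity_2d_pt f (t * x) (t * y) ->
  continuity_2d_pt (fun x t => f (t * x) (t * y)) x t.
Proof.
  intros Hf. apply (continuity_2d_comp2 f (fun x t => t * x) (fun x t => t * y)); [exact Hf|..];
    apply continuity_2d_pt_mult;
    first [apply continuity_2d_pt_id1|apply continuity_2d_pt_id2|apply continuity_2d_pt_const].
Qed.

Let ca x y : pdisc b x y -> continuity_2d_pt a x y.
Proof. intros P. eapply has_grad_continuous; [apply open2_pdisc|exact Ga|exact P]. Qed.
Let cc x y : pdisc b x y -> continuity_2d_pt c x y.
Proof. intros P. eapply has_grad_continuous; [apply open2_pdisc|exact Gc|exact P]. Qed.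

Let integrand_cont x y t : pdisc b (t * x) (t * y) ->
  continuity_2d_pt (fun x t => x * a (t * x) (t * y) + y * c (t * x) (t * y)) x t.
Proof.
  intros P. apply continuity_2d_pt_plus; apply continuity_2d_pt_mult;
    first [apply continuity_2d_pt_id1|apply continuity_2d_pt_const|apply cont_scaled; auto].
Qed.

Let integrand_cont1 x y t : pdisc b (t * x) (t * y) ->
  continuous (fun t => x * a (t * x) (t * y) + y * c (t * x) (t * y)) t.
Proof.
  intros P. apply continuity_pt_continuous.
  apply (continuity_2d_comp (fun x t => x * a (t * x) (t * y) + y * c (t * x) (t * y)) (fun _ => x) (fun t => t)).
  - now apply integrand_cont.
  - apply continuity_pt_const. now intros ? ?.
  - apply derivable_continuous_pt, derivable_pt_id.
Qed.

Lemma radial_ex_RInt x y l l' : 0 < l -> 0 < l' -> pdisc b (l * x) (l * y) -> pdisc b (l' * x) (l' * y) ->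
  ex_RInt (fun t => x * a (t * x) (t * y) + y * c (t * x) (t * y)) l l'.
Proof.
  intros l0 l0' P P'. apply (ex_RInt_continuous (V := R_CompleteNormedModule)). intros t Ht.
  apply integrand_cont1.
  assert (E : pdisc b (t / l * (l * x)) (t / l * (l * y))).
  { apply (pdisc_scale b (t / l) (l * x) (l * y) (l' / l)).
    - now apply Rdiv_lt_0_compat.
    - exact P.
    - replace (l' / l * (l * x)) with (l' * x) by (field; lra).
      replace (l' / l * (l * y)) with (l' * y) by (field; lra). exact P'.
    - assert (il := Rinv_0_lt_compat l l0).
      destruct (Rle_lt_dec l l') as [L|L].
      + rewrite Rmin_left, Rmax_right in Ht by lra.
        assert (1 <= l' / l) by (apply Rle_div_r; lra).
        rewrite Rmin_left, Rmax_right by lra. split; [apply Rle_div_r; lra|].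
        apply Rmult_le_compat_r; lra.
      + rewrite Rmin_right, Rmax_left in Ht by lra.
        assert (l' / l <= 1) by (apply Rle_div_l; lra).
        rewrite Rmin_right, Rmax_left by lra. split; [apply Rmult_le_compat_r; lra|].
        apply Rle_div_l; lra. }
  replace (t / l * (l * x)) with (t * x) in E by (field; lra).
  replace (t / l * (l * y)) with (t * y) in E by (field; lra). exact E.
Qed.

Let dfx x y t : pdisc b (t * x) (t * y) ->
  is_derive (fun x => x * a (t * x) (t * y) + y * c (t * x) (t * y)) x
   (a (t * x) (t * y) + t * (x * a1 (t * x) (t * y) + y * a2 (t * x) (t * y))).
Proof.
  intros P. destruct (Ga _ _ P) as [A1 _]. destruct (Gc _ _ P) as [C1 _].
  apply is_derive_eq with ((1 * a (t * x) (t * y) + x * (t * a1 (t * x) (t * y))) + y * (t * c1 (t * x) (t * y))).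
  - apply derive_plus.
    + apply (derive_mult (fun z => z) (fun z => a (t * z) (t * y))); [auto_derive; [easy|ring]|].
      apply (derive_comp (fun z => a z (t * y)) (fun x => t * x)); [exact A1|auto_derive; [easy|ring]].
    + apply derive_scal.
      apply (derive_comp (fun z => c z (t * y)) (fun x => t * x)); [exact C1|auto_derive; [easy|ring]].
  - rewrite (closed _ _ P). ring.
Qed.

(** Closedness turns the x-derivative of the integrand into the t-derivative of t a (t x, t y), so
    the integral of that derivative is explicit. *)
Let radial_grad y : has_grad (D y) (fun l x => radial_int l x y)
  (fun l x => x * a (l * x) (l * y) + y * c (l * x) (l * y))
  (fun l x => l * a (l * x) (l * y) - a x y).
Proof.
  intros l x HD. assert (HD' := HD). destruct HD' as [l0 [P Q]].
  assert (Seg : forall t, Rmin 1 l <= t <= Rmax 1 l -> pdisc b (t * x) (t * y)).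
  { intros t Ht. now apply (pdisc_scale b t x y l). }
  assert (P1 : pdisc b (1 * x) (1 * y)) by now rewrite !Rmult_1_l.
  assert (swap : forall f, continuity_2d_pt f (l * x) (l * y) ->
    continuity_2d_pt (fun l x => f (l * x) (l * y)) l x).
  { intros f Hf. apply (continuity_2d_comp2 f (fun l x => l * x) (fun l x => l * y)); [exact Hf|..];
    apply continuity_2d_pt_mult;
    first [apply continuity_2d_pt_id1|apply continuity_2d_pt_id2|apply continuity_2d_pt_const]. }
  split; [|split; [|split]].
  - apply (is_derive_RInt (V := R_NormedModule) (fun t => x * a (t * x) (t * y) + y * c (t * x) (t * y)) _ 1).
    + destruct (oD y l x HD) as [d Hd]. exists d. intros l' Hl'.
      apply (RInt_correct (V := R_CompleteNormedModule)).
      destruct (Hd l' x) as [l0' [_ Q']].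
      { exact Hl'. }
      { rewrite Rminus_diag, Rabs_R0. apply cond_pos. }
      apply radial_ex_RInt; try assumption. lra.
    + now apply integrand_cont1.
  - destruct (oD y l x HD) as [d Hd].
    assert (near : forall x', Rabs (x' - x) < d -> D y l x').
    { intros x' Hx'. apply Hd; [rewrite Rminus_diag, Rabs_R0; apply cond_pos|exact Hx']. }
    apply is_derive_eq with
      (RInt (fun t => Derive (fun x => x * a (t * x) (t * y) + y * c (t * x) (t * y)) x) 1 l).
    + apply (is_derive_RInt_param (fun x t => x * a (t * x) (t * y) + y * c (t * x) (t * y))).
      * exists d. intros x' Hx' t Ht. destruct (near x' Hx') as [_ [P' Q']].
        eexists. apply dfx. now apply (pdisc_scale b t x' y l).
      * intros t Ht. assert (Pt := Seg t Ht).
        apply continuity_2d_pt_ext_loc with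
          (fun x t => a (t * x) (t * y) + t * (x * a1 (t * x) (t * y) + y * a2 (t * x) (t * y))).
        -- destruct (open2_preimage (pdisc b) (fun x t => t * x) (fun x t => t * y) (open2_pdisc b)) with (x := x) (y := t) as [e He].
           ++ intros. apply continuity_2d_pt_mult; [apply continuity_2d_pt_id2|apply continuity_2d_pt_id1].
           ++ intros. apply continuity_2d_pt_mult; [apply continuity_2d_pt_id2|apply continuity_2d_pt_const].
           ++ exact Pt.
           ++ exists e. intros x' t' Hx' Ht'. symmetry. apply is_derive_unique. apply dfx. now apply He.
        -- destruct (Ga _ _ Pt) as [_ [_ [C1 C2]]].
           apply continuity_2d_pt_plus; [apply cont_scaled; auto|].
           apply continuity_2d_pt_mult; [apply continuity_2d_pt_id2|].
           apply continuity_2d_pt_plus; apply continuity_2d_pt_mult;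
             first [apply continuity_2d_pt_id1|apply continuity_2d_pt_const|now apply cont_scaled].
      * exists d. intros x' Hx'. destruct (near x' Hx') as [_ [P' Q']].
        apply radial_ex_RInt; try assumption; [lra|now rewrite !Rmult_1_l].
    + rewrite (RInt_ext _ (fun t => a (t * x) (t * y) + t * (x * a1 (t * x) (t * y) + y * a2 (t * x) (t * y)))).
      * assert (E : is_RInt (fun t => a (t * x) (t * y) + t * (x * a1 (t * x) (t * y) + y * a2 (t * x) (t * y)))
          1 l (l * a (l * x) (l * y) - 1 * a (1 * x) (1 * y))).
        { apply (is_RInt_derive (V := R_CompleteNormedModule) (fun t => t * a (t * x) (t * y))).
          - intros t Ht. assert (Pt := Seg t Ht).
            apply is_derive_eq with (1 * a (t * x) (t * y) + t * (a1 (t * x) (t * y) * x + a2 (t * x) (t * y) * y)); [|ring].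
            apply (derive_mult (fun z => z) (fun z => a (z * x) (z * y))); [auto_derive; [easy|ring]|].
            apply (has_grad_comp (pdisc b) a a1 a2 (fun t => t * x) (fun t => t * y));
              [apply open2_pdisc|exact Ga|exact Pt| |]; auto_derive; try easy; ring.
          - intros t Ht. assert (Pt := Seg t Ht). destruct (Ga _ _ Pt) as [_ [_ [C1 C2]]].
            apply continuity_pt_continuous.
            apply (continuity_2d_comp (fun x t => a (t * x) (t * y) + t * (x * a1 (t * x) (t * y) + y * a2 (t * x) (t * y)))
              (fun _ => x) (fun t => t)).
            + apply continuity_2d_pt_plus; [apply cont_scaled; auto|].
              apply continuity_2d_pt_mult; [apply continuity_2d_pt_id2|].
              apply continuity_2d_pt_plus; apply continuity_2d_pt_mult;
                first [apply continuity_2d_pt_id1|apply continuity_2d_pt_const|now apply cont_scaled].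
            + apply continuity_pt_const. now intros ? ?.
            + apply derivable_continuous_pt, derivable_pt_id. }
        rewrite !Rmult_1_l in E. now apply (is_RInt_unique (V := R_CompleteNormedModule)).
      * intros t Ht. apply is_derive_unique. apply dfx. apply Seg. lra.
  - apply continuity_2d_pt_plus; apply continuity_2d_pt_mult;
      first [apply continuity_2d_pt_id2|apply continuity_2d_pt_const|apply swap; auto].
  - apply continuity_2d_pt_minus.
    + apply continuity_2d_pt_mult; [apply continuity_2d_pt_id1|apply swap; auto].
    + apply (continuity_2d_comp2 a (fun _ x => x) (fun _ _ => y)); [auto|..];
        first [apply continuity_2d_pt_id2|apply continuity_2d_pt_const].
Qed.

(* The correction term is the tangential component of the form on [C_s]. *)
Lemma radial_int_derive s x y : 0 < s < b -> pdisc b x y ->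
  let r := sqrt (x ^ 2 + y ^ 2) in
  is_derive (fun x => - radial_int (s / sqrt (x ^ 2 + y ^ 2)) x y) x
    (a x y + y / r ^ 2 * (- (s / r * y) * a (s / r * x) (s / r * y) + s / r * x * c (s / r * x) (s / r * y))).
Proof.
  intros Hs P r. assert (r2 : r ^ 2 = x ^ 2 + y ^ 2) by (apply pow2_sqrt; destruct P; lra).
  assert (r0 : 0 < r) by (apply sqrt_lt_R0; apply P).
  assert (HD : D y (s / r) x).
  { split; [apply Rdiv_lt_0_compat; lra|]. split; [exact P|].
    unfold pdisc. replace ((s / r * x) ^ 2 + (s / r * y) ^ 2) with (s ^ 2 / r ^ 2 * (x ^ 2 + y ^ 2)) by (field; lra).
    rewrite <- r2. replace (s ^ 2 / r ^ 2 * r ^ 2) with (s ^ 2) by (field; lra). split; nra. }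
  apply is_derive_eq with (- ((x * a (s / r * x) (s / r * y) + y * c (s / r * x) (s / r * y)) * (- s * x / r ^ 3)
    + (s / r * a (s / r * x) (s / r * y) - a x y) * 1)).
  - apply derive_opp.
    apply (has_grad_comp (D y) (fun l x => radial_int l x y)
      (fun l x => x * a (l * x) (l * y) + y * c (l * x) (l * y))
      (fun l x => l * a (l * x) (l * y) - a x y) (fun x => s / sqrt (x ^ 2 + y ^ 2)) (fun x => x)).
    + apply oD.
    + apply radial_grad.
    + exact HD.
    + auto_derive.
      * replace (x * (x * 1) + y * (y * 1)) with (x ^ 2 + y ^ 2) by ring.
        destruct P as [P _]. split; [exact P|]. split; [|easy]. apply Rgt_not_eq. exact r0.
      * replace (x * (x * 1) + y * (y * 1)) with (x ^ 2 + y ^ 2) by ring. fold r.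
        field. lra.
    + auto_derive; [easy|ring].
  - set (A := a (s / r * x) (s / r * y)). set (C := c (s / r * x) (s / r * y)).
    replace (- ((x * A + y * C) * (- s * x / r ^ 3) + (s / r * A - a x y) * 1)) with
      (a x y + s / r ^ 3 * ((x * A + y * C) * x - r ^ 2 * A)) by (field; lra).
    rewrite r2. rewrite <- r2. replace (y / r ^ 2 * (- (s / r * y) * A + s / r * x * C)) with
      (s / r ^ 3 * (- y * y * A + x * y * C)) by (field; lra). rewrite r2. ring.
Qed.

End RadialIntegral.

Lemma pdisc_swap b x y : pdisc b x y -> pdisc b y x.
Proof. unfold pdisc. lra. Qed.

Lemma continuity_2d_swap f x y : continuity_2d_pt f y x -> continuity_2d_pt (fun x y => f y x) x y.
Proof.
  intros Hf. apply (continuity_2d_comp2 f (fun _ y => y) (fun x _ => x)); [exact Hf|..];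
    first [apply continuity_2d_pt_id1|apply continuity_2d_pt_id2].
Qed.

Lemma has_grad_swap b f fx fy : has_grad (pdisc b) f fx fy ->
  has_grad (pdisc b) (fun x y => f y x) (fun x y => fy y x) (fun x y => fx y x).
Proof.
  intros H x y P. destruct (H y x (pdisc_swap b x y P)) as [A1 [A2 [A3 A4]]].
  split; [exact A2|split; [exact A1|]]. split; now apply continuity_2d_swap.
Qed.

(** Obtained from [radial_int_derive] by exchanging the coordinates, which preserves closedness. *)
Lemma radial_int_derive_2 b a c a1 a2 c1 c2 s x y :
  has_grad (pdisc b) a a1 a2 -> has_grad (pdisc b) c c1 c2 ->
  (forall x y, pdisc b x y -> a2 x y = c1 x y) ->
  0 < s < b -> pdisc b x y ->
  let r := sqrt (x ^ 2 + y ^ 2) in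
  is_derive (fun y => - radial_int a c (s / sqrt (x ^ 2 + y ^ 2)) x y) y
    (c x y - x / r ^ 2 * (- (s / r * y) * a (s / r * x) (s / r * y) + s / r * x * c (s / r * x) (s / r * y))).
Proof.
  intros Ga Gc Hc Hs P r.
  assert (Q := radial_int_derive b (fun x y => c y x) (fun x y => a y x) _ _ _ _
    (has_grad_swap _ _ _ _ Gc) (has_grad_swap _ _ _ _ Ga)
    (fun x y P => eq_sym (Hc y x (pdisc_swap b x y P))) s y x Hs (pdisc_swap b x y P)).
  cbv zeta beta in Q. rewrite (Rplus_comm (y ^ 2) (x ^ 2)) in Q. fold r in Q.
  apply (is_derive_ext (fun y' => - radial_int (fun x y => c y x) (fun x y => a y x) (s / sqrt (y' ^ 2 + x ^ 2)) y' x)).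
  - intros y'. rewrite (Rplus_comm (y' ^ 2) (x ^ 2)). f_equal.
    unfold radial_int. apply (RInt_ext (V := R_CompleteNormedModule)). intros t _. simpl. apply Rplus_comm.
  - eapply is_derive_eq; [exact Q|]. ring.
Qed.

Lemma abs_le_norm x y : Rabs x <= sqrt (x ^ 2 + y ^ 2) /\ Rabs y <= sqrt (x ^ 2 + y ^ 2).
Proof.
  assert (P := sqrt_pos (x ^ 2 + y ^ 2)).
  assert (Q : sqrt (x ^ 2 + y ^ 2) ^ 2 = x ^ 2 + y ^ 2).
  { apply pow2_sqrt. generalize (pow2_ge_0 x) (pow2_ge_0 y). lra. }
  split; (apply sq_le_abs; [exact P|]); rewrite Q;
    generalize (pow2_ge_0 x) (pow2_ge_0 y); lra.
Qed.

Section Primitive.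

Variables (b : R) (a c a1 a2 c1 c2 : R -> R -> R).
Hypothesis Ga : has_grad (pdisc b) a a1 a2.
Hypothesis Gc : has_grad (pdisc b) c c1 c2.
Hypothesis closed : forall x y, pdisc b x y -> a2 x y = c1 x y.
Variables (M r0 : R).
Hypothesis Hr0 : 0 < r0 < b.
Hypothesis bounded : forall x y, pdisc b x y -> r0 ^ 2 < x ^ 2 + y ^ 2 -> Rabs (a x y) <= M /\ Rabs (c x y) <= M.
Hypothesis tangential : forall e, 0 < e -> exists r, 0 < r < b /\ forall x y, pdisc b x y ->
  r ^ 2 < x ^ 2 + y ^ 2 -> Rabs (- y * a x y + x * c x y) < e.

Let nrm x y := sqrt (x ^ 2 + y ^ 2).

Let nrm_pos x y : pdisc b x y -> 0 < nrm x y.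
Proof. intros [P _]. now apply sqrt_lt_R0. Qed.

Let nrm_sq x y : nrm x y ^ 2 = x ^ 2 + y ^ 2.
Proof. apply pow2_sqrt. generalize (pow2_ge_0 x) (pow2_ge_0 y). lra. Qed.

Let nrm_lt x y : pdisc b x y -> nrm x y < b.
Proof. intros P. generalize (nrm_pos x y P) (nrm_sq x y). destruct P. intros. nra. Qed.

Let scaled s x y : 0 < s < b -> pdisc b x y ->
  0 < s / nrm x y /\ (s / nrm x y * x) ^ 2 + (s / nrm x y * y) ^ 2 = s ^ 2 /\
  pdisc b (s / nrm x y * x) (s / nrm x y * y).
Proof.
  intros Hs P. assert (r := nrm_pos x y P). assert (r2 := nrm_sq x y).
  assert (E : (s / nrm x y * x) ^ 2 + (s / nrm x y * y) ^ 2 = s ^ 2).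
  { replace ((s / nrm x y * x) ^ 2 + (s / nrm x y * y) ^ 2) with (s ^ 2 / nrm x y ^ 2 * (x ^ 2 + y ^ 2)) by (field; lra).
    rewrite <- r2. field. lra. }
  split; [apply Rdiv_lt_0_compat; lra|]. split; [exact E|]. unfold pdisc. rewrite E. split; nra.
Qed.

Let Mpos : 0 <= M.
Proof.
  set (x := (r0 + b) / 2).
  destruct (bounded x 0) as [B _]; [unfold pdisc, x; split; nra|unfold x; nra|].
  generalize (Rabs_pos (a x 0)). lra.
Qed.

Let f x y t := x * a (t * x) (t * y) + y * c (t * x) (t * y).

Let J x y l l' : R := RInt (f x y) l l'.

Let radial_diff s s' x y : r0 < s <= s' -> s' < b -> pdisc b x y ->
  Rabs (J x y (s / nrm x y) (s' / nrm x y)) <= 2 * M * (s' - s).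
Proof.
  intros Hs Hs' P. assert (r := nrm_pos x y P). assert (r2 := nrm_sq x y).
  destruct (scaled s x y ltac:(lra) P) as [A1 [_ A3]].
  destruct (scaled s' x y ltac:(lra) P) as [B1 [_ B3]].
  replace (2 * M * (s' - s)) with ((s' / nrm x y - s / nrm x y) * (2 * M * nrm x y)) by (field; lra).
  assert (ir : 0 < / nrm x y) by now apply Rinv_0_lt_compat.
  unfold J. apply abs_RInt_le_const.
  - apply Rmult_le_compat_r; lra.
  - now apply (radial_ex_RInt b a c a1 a2 c1 c2).
  - intros t Ht.
    assert (T : r0 < t * nrm x y < b).
    { destruct Ht as [T1 T2]. apply (Rmult_le_compat_r (nrm x y)) in T1; [|lra].
      apply (Rmult_le_compat_r (nrm x y)) in T2; [|lra].
      replace (s / nrm x y * nrm x y) with s in T1 by (field; lra).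
      replace (s' / nrm x y * nrm x y) with s' in T2 by (field; lra). lra. }
    assert (E : (t * x) ^ 2 + (t * y) ^ 2 = (t * nrm x y) ^ 2) by (rewrite (Rpow_mult_distr t (nrm x y)), r2; ring).
    destruct (bounded (t * x) (t * y)) as [Ba Bc].
    { unfold pdisc. rewrite E. nra. }
    { rewrite E. nra. }
    destruct (abs_le_norm x y) as [Nx Ny]. fold (nrm x y) in Nx, Ny.
    unfold f. eapply Rle_trans; [apply Rabs_triang|]. rewrite !Rabs_mult.
    assert (Rabs x * Rabs (a (t * x) (t * y)) <= nrm x y * M)
      by (apply Rmult_le_compat; try apply Rabs_pos; assumption).
    assert (Rabs y * Rabs (c (t * x) (t * y)) <= nrm x y * M)
      by (apply Rmult_le_compat; try apply Rabs_pos; assumption). lra.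
Qed.

Let radial_chasles s s' x y : 0 < s < b -> 0 < s' < b -> pdisc b x y ->
  radial_int a c (s' / nrm x y) x y = radial_int a c (s / nrm x y) x y
    + J x y (s / nrm x y) (s' / nrm x y).
Proof.
  intros Hs Hs' P.
  destruct (scaled s x y Hs P) as [A1 [_ A3]]. destruct (scaled s' x y Hs' P) as [B1 [_ B3]].
  symmetry. apply (RInt_Chasles (V := R_CompleteNormedModule)); apply (radial_ex_RInt b a c a1 a2 c1 c2);
    try assumption; try lra; now rewrite !Rmult_1_l.
Qed.

(** Radii increasing to b; the shift by two makes s 0 = b / 2 positive. *)
Let s n := b - b / INR (S (S n)).

Let s_spec n : 0 < s n < b.
Proof.
  unfold s. assert (1 < INR (S (S n))).
  { rewrite S_INR. generalize (lt_0_INR (S n) (Nat.lt_0_succ n)). lra. }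
  assert (0 < b / INR (S (S n))) by (apply Rdiv_lt_0_compat; lra).
  assert (b / INR (S (S n)) < b); [|lra].
  apply Rlt_div_l; nra.
Qed.

Let s_lim r : r < b -> exists N, forall n, (N <= n)%nat -> r < s n.
Proof.
  intros Hr. destruct (archimed_cor1 ((b - r) / b)) as [N [HN N0]]; [apply Rdiv_lt_0_compat; lra|].
  exists N. intros n Hn. unfold s.
  assert (/ INR (S (S n)) <= / INR N).
  { apply Rinv_le_contravar; [now apply lt_0_INR|apply le_INR; lia]. }
  assert (b * / INR (S (S n)) < b * ((b - r) / b)) by (apply Rmult_lt_compat_l; lra).
  replace (b * ((b - r) / b)) with (b - r) in H0 by (field; lra). unfold Rdiv at 1. lra.
Qed.

Let U n x y := - radial_int a c (s n / sqrt (x ^ 2 + y ^ 2)) x y.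

Let U_diff n m x y r : r0 < r -> pdisc b x y -> r < s n -> r < s m ->
  Rabs (U n x y - U m x y) <= 2 * M * (b - r).
Proof.
  intros Hr P Hn Hm. unfold U. fold (nrm x y).
  assert (S1 := s_spec n). assert (S2 := s_spec m).
  destruct (Rle_lt_dec (s n) (s m)) as [L|L].
  - rewrite (radial_chasles (s n) (s m) x y) by assumption.
    match goal with |- Rabs ?z <= _ => replace z with (J x y (s n / nrm x y) (s m / nrm x y)) by ring end.
    eapply Rle_trans; [apply radial_diff; lra || assumption|]. nra.
  - rewrite (radial_chasles (s m) (s n) x y) by assumption.
    match goal with |- Rabs ?z <= _ => replace z with (- J x y (s m / nrm x y) (s n / nrm x y)) by ring end.
    rewrite Rabs_Ropp.
    eapply Rle_trans; [apply radial_diff; lra || assumption|]. nra.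
Qed.

(** A total limit: it is meaningful in the punctured disc, by [u_lim], and has a default value
    elsewhere. *)
Let u x y := real (Lim_seq (fun n => U n x y)).

Let u_lim x y : pdisc b x y -> Un_cv (fun n => U n x y) (u x y).
Proof.
  intros P.
  assert (Ca : Cauchy_crit (fun n => U n x y)).
  (* With this r one has 2 M (b - r) < e; the first term of the maximum keeps r > r0, and 2 M + 1
     allows M = 0. *)
  { intros e He. set (r := Rmax ((r0 + b) / 2) (b - e / (2 * M + 1) / 2)).
    assert (M1 : 0 < e / (2 * M + 1)) by (apply Rdiv_lt_0_compat; lra).
    assert (Hr : r0 < r < b).
    { split; [eapply Rlt_le_trans; [|apply Rmax_l]; lra|apply Rmax_lub_lt; lra]. }
    destruct (s_lim r ltac:(lra)) as [N HN]. exists N. intros n m Hn Hm. unfold Rdist.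
    eapply Rle_lt_trans; [apply (U_diff n m x y r); try assumption; try lra; now apply HN|].
    assert (b - r <= e / (2 * M + 1) / 2) by (generalize (Rmax_r ((r0 + b) / 2) (b - e / (2 * M + 1) / 2)); unfold r; lra).
    assert (2 * M * (b - r) <= 2 * M * (e / (2 * M + 1))) by (apply Rmult_le_compat_l; lra).
    assert (Ee : e = (2 * M + 1) * (e / (2 * M + 1))) by (field; lra). lra. }
  destruct (Rcomplete.R_complete _ Ca) as [l Hl].
  assert (E : Lim_seq (fun n => U n x y) = l).
  { apply is_lim_seq_unique. now apply is_lim_seq_Reals. }
  unfold u. rewrite E. exact Hl.
Qed.

Let u_boundary e : 0 < e -> exists r, 0 < r < b /\ forall x y, pdisc b x y -> r ^ 2 < x ^ 2 + y ^ 2 ->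
  Rabs (u x y) < e.
Proof.
  intros He. set (r := Rmax ((r0 + b) / 2) (b - e / (2 * M + 1) / 2)).
  assert (M1 : 0 < e / (2 * M + 1)) by (apply Rdiv_lt_0_compat; lra).
  assert (Hr : r0 < r < b).
  { split; [eapply Rlt_le_trans; [|apply Rmax_l]; lra|apply Rmax_lub_lt; lra]. }
  exists r. split; [lra|]. intros x y P L.
  assert (rn := nrm_pos x y P). assert (r2 := nrm_sq x y). assert (nb := nrm_lt x y P).
  assert (Ln : r < nrm x y) by nra.
  destruct (s_lim (nrm x y) nb) as [N HN].
  assert (Bn : forall n, (N <= n)%nat -> Rabs (U n x y) <= 2 * M * (b - r)).
  { intros n Hn. specialize (HN n Hn). assert (Sn := s_spec n).
    assert (E : U n x y = - J x y (nrm x y / nrm x y) (s n / nrm x y)).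
    { unfold U, radial_int. fold (nrm x y). replace (nrm x y / nrm x y) with 1 by (field; lra). reflexivity. }
    rewrite E, Rabs_Ropp. eapply Rle_trans; [apply radial_diff; lra || assumption|]. nra. }
  assert (B : Rabs (u x y) <= 2 * M * (b - r)).
  { apply Rnot_lt_le. intros Lt.
    destruct (u_lim x y P (Rabs (u x y) - 2 * M * (b - r)) ltac:(lra)) as [N' HN'].
    specialize (HN' (max N N') ltac:(lia)). specialize (Bn (max N N') ltac:(lia)).
    unfold Rdist in HN'. rewrite Rabs_minus_sym in HN'.
    generalize (Rabs_triang_inv (u x y) (U (max N N') x y)). lra. }
  eapply Rle_lt_trans; [exact B|].
  assert (b - r <= e / (2 * M + 1) / 2) by (generalize (Rmax_r ((r0 + b) / 2) (b - e / (2 * M + 1) / 2)); unfold r; lra).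
  assert (2 * M * (b - r) <= 2 * M * (e / (2 * M + 1))) by (apply Rmult_le_compat_l; lra).
  assert (Ee : e = (2 * M + 1) * (e / (2 * M + 1))) by (field; lra). lra.
Qed.

Let T n x y := - (s n / nrm x y * y) * a (s n / nrm x y * x) (s n / nrm x y * y)
  + s n / nrm x y * x * c (s n / nrm x y * x) (s n / nrm x y * y).

(** The error terms of the gradient of U n tend to 0 uniformly away from the origin, as
    differentiation of a limit requires. *)
Let T_small rho e : 0 < rho -> 0 < e -> exists N, forall n x y z, (N <= n)%nat -> pdisc b x y ->
  rho < nrm x y -> Rabs z <= nrm x y -> Rabs (z / nrm x y ^ 2 * T n x y) < e.
Proof.
  intros Hrho He.
  destruct (tangential (e * rho)) as [r [Hr K]]; [now apply Rmult_lt_0_compat|].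
  destruct (s_lim r ltac:(lra)) as [N HN]. exists N. intros n x y z Hn P L Hz.
  destruct (scaled (s n) x y (s_spec n) P) as [_ [E Q]]. specialize (HN n Hn).
  assert (Kn := K _ _ Q ltac:(rewrite E; nra)). fold (T n x y) in Kn.
  rewrite Rabs_mult. assert (B : Rabs (z / nrm x y ^ 2) <= / rho).
  { unfold Rdiv. rewrite Rabs_mult, (Rabs_pos_eq (/ nrm x y ^ 2)) by (left; apply Rinv_0_lt_compat; nra).
    apply Rle_trans with (nrm x y * / nrm x y ^ 2).
    - apply Rmult_le_compat_r; [left; apply Rinv_0_lt_compat; nra|exact Hz].
    - replace (nrm x y * / nrm x y ^ 2) with (/ nrm x y) by (field; lra).
      apply Rinv_le_contravar; lra. }
  apply Rle_lt_trans with (/ rho * Rabs (T n x y)).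
  - apply Rmult_le_compat_r; [apply Rabs_pos|exact B].
  - apply Rmult_lt_reg_l with rho; [exact Hrho|].
    replace (rho * (/ rho * Rabs (T n x y))) with (Rabs (T n x y)) by (field; lra). lra.
Qed.

Let near x y : pdisc b x y -> exists d : posreal, exists rho, 0 < rho /\ forall x' y',
  Rabs (x' - x) < d -> Rabs (y' - y) < d -> pdisc b x' y' /\ rho < nrm x' y'.
Proof.
  intros P. destruct (open2_pdisc b x y P) as [d1 K1].
  assert (r := nrm_pos x y P). assert (r2 := nrm_sq x y).
  destruct (box_sq_ge (nrm x y / 2) x y) as [d2 [Hd2 K2]]; [lra|nra|].
  assert (dp : 0 < Rmin d1 d2) by (apply Rmin_pos; [apply cond_pos|exact Hd2]).
  exists (mkposreal _ dp), (nrm x y / 2). split; [lra|]. simpl.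
  assert (M1 := Rmin_l d1 d2). assert (M2 := Rmin_r d1 d2).
  intros x' y' Hx' Hy'. assert (P' : pdisc b x' y') by (apply K1; lra). split; [exact P'|].
  assert (Q := K2 x' y' ltac:(lra) ltac:(lra)). rewrite <- nrm_sq in Q.
  generalize (nrm_pos x' y' P'). nra.
Qed.

(** U n is the radial primitive that vanishes on the circle of radius s n. Its gradient differs from
    (a, c) only through the tangential component of the form on that circle, which tends to 0: so
    the limit is a genuine primitive. The vanishing tangential component at C_b is also what
    excludes a period around the hole. *)
Theorem closed_form_primitive : exists u, has_grad (pdisc b) u a c /\
  forall e, 0 < e -> exists r, 0 < r < b /\ forall x y, pdisc b x y -> r ^ 2 < x ^ 2 + y ^ 2 ->
    Rabs (u x y) < e.
Proof.
  exists u. split; [|exact u_boundary].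
  intros x y P. destruct (near x y P) as [d [rho [Hrho K]]].
  assert (Z : forall z : R, Rabs (z - z) < d) by (intros; rewrite Rminus_diag, Rabs_R0; apply cond_pos).
  assert (Cac : forall x y, pdisc b x y -> continuity_2d_pt a x y /\ continuity_2d_pt c x y).
  { intros x' y' P'. split; eapply has_grad_continuous; try apply open2_pdisc; eauto. }
  split; [|split; [|now apply Cac]]; apply is_derive_Reals.
  - apply (Ranalysis5.derivable_pt_lim_CVU (fun n x => U n x y) (fun n x => a x y + y / nrm x y ^ 2 * T n x y)
      (fun x => u x y) (fun x => a x y) x x d).
    + apply Z.
    + intros x' n Hx'. destruct (K x' y Hx' (Z y)) as [P' _]. apply is_derive_Reals.
      apply (radial_int_derive b a c a1 a2 c1 c2); try assumption. apply s_spec.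
    + intros x' Hx'. apply u_lim. apply K; [exact Hx'|apply Z].
    + intros e He. destruct (T_small rho e Hrho He) as [N HN]. exists N. intros n x' Hn Hx'.
      destruct (K x' y Hx' (Z y)) as [P' L'].
      match goal with |- Rabs ?w < _ => replace w with (- (y / nrm x' y ^ 2 * T n x' y)) by ring end.
      rewrite Rabs_Ropp. apply HN; try assumption. apply abs_le_norm.
    + intros x' Hx'. destruct (K x' y Hx' (Z y)) as [P' _].
      apply (continuity_2d_comp a (fun x => x) (fun _ => y)); [now apply Cac| |].
      * apply derivable_continuous_pt, derivable_pt_id.
      * apply continuity_pt_const. now intros ? ?.
  - apply (Ranalysis5.derivable_pt_lim_CVU (fun n y => U n x y) (fun n y => c x y - x / nrm x y ^ 2 * T n x y)
      (fun y => u x y) (fun y => c x y) y y d).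
    + apply Z.
    + intros y' n Hy'. destruct (K x y' (Z x) Hy') as [P' _]. apply is_derive_Reals.
      apply (radial_int_derive_2 b a c a1 a2 c1 c2); try assumption. apply s_spec.
    + intros y' Hy'. apply u_lim. apply K; [apply Z|exact Hy'].
    + intros e He. destruct (T_small rho e Hrho He) as [N HN]. exists N. intros n y' Hn Hy'.
      destruct (K x y' (Z x) Hy') as [P' L'].
      match goal with |- Rabs ?w < _ => replace w with (x / nrm x y' ^ 2 * T n x y') by ring end.
      apply HN; try assumption. apply abs_le_norm.
    + intros y' Hy'. destruct (K x y' (Z x) Hy') as [P' _].
      apply (continuity_2d_comp c (fun _ => x) (fun y => y)); [now apply Cac| |].
      * apply continuity_pt_const. now intros ? ?.
      * apply derivable_continuous_pt, derivable_pt_id.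
Qed.

End Primitive.

(** * The vorticity is a function of the stream function *)

Lemma has_grad_mult D f fx fy g gx gy : open2 D -> has_grad D f fx fy -> has_grad D g gx gy ->
  has_grad D (fun x y => f x y * g x y) (fun x y => fx x y * g x y + f x y * gx x y)
    (fun x y => fy x y * g x y + f x y * gy x y).
Proof.
  intros oD Hf Hg x y P. destruct (Hf x y P) as [F1 [F2 [F3 F4]]]. destruct (Hg x y P) as [G1 [G2 [G3 G4]]].
  assert (Cf := has_grad_continuous D f fx fy x y oD Hf P).
  assert (Cg := has_grad_continuous D g gx gy x y oD Hg P).
  split; [|split; [|split]].
  - now apply (derive_mult (fun t => f t y) (fun t => g t y)).
  - now apply (derive_mult (fun t => f x t) (fun t => g x t)).
  - apply continuity_2d_pt_plus; now apply continuity_2d_pt_mult.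
  - apply continuity_2d_pt_plus; now apply continuity_2d_pt_mult.
Qed.

Lemma has_grad_comp_l D f fx fy (phi dphi : R -> R) : open2 D -> has_grad D f fx fy ->
  (forall t, is_derive phi t (dphi t)) -> (forall t, continuity_pt dphi t) ->
  has_grad D (fun x y => phi (f x y)) (fun x y => dphi (f x y) * fx x y) (fun x y => dphi (f x y) * fy x y).
Proof.
  intros oD Hf Hp Hc x y P. destruct (Hf x y P) as [F1 [F2 [F3 F4]]].
  assert (Cf := has_grad_continuous D f fx fy x y oD Hf P).
  assert (K : continuity_2d_pt (fun x y => dphi (f x y)) x y) by (apply continuity_1d_2d_pt_comp; auto).
  split; [|split; [|split]].
  - eapply is_derive_eq; [apply (derive_comp phi (fun t => f t y)); [apply Hp|exact F1]|ring].
  - eapply is_derive_eq; [apply (derive_comp phi (fun t => f x t)); [apply Hp|exact F2]|ring].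
  - now apply continuity_2d_pt_mult.
  - now apply continuity_2d_pt_mult.
Qed.

(** * Bump functions and their primitives *)

Lemma derive_sq_pos_part z : is_derive (fun z => Rmax 0 z ^ 2) z (2 * Rmax 0 z).
Proof.
  destruct (Rtotal_order z 0) as [L|[->|G]].
  - apply (is_derive_ext_loc (fun _ => 0)).
    + exists (mkposreal (- z) ltac:(lra)). intros t Ht. apply Rabs_def2 in Ht. simpl in Ht.
      unfold minus, plus, opp in Ht; simpl in Ht. rewrite Rmax_left by lra. simpl. now rewrite Rmult_0_l.
    + rewrite Rmax_left by lra. apply is_derive_eq with 0; [exact (is_derive_const 0 z)|symmetry; apply Rmult_0_r].
  - rewrite Rmax_left, Rmult_0_r by lra. apply is_derive_Reals. intros e He.
    exists (mkposreal e He). intros h h0 Hh. simpl in Hh. rewrite Rplus_0_l, (Rmax_left 0 0) by lra.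
    replace (((Rmax 0 h ^ 2 - 0 ^ 2) / h) - 0) with (Rmax 0 h ^ 2 / h) by (field; exact h0).
    apply Rle_lt_trans with (Rabs h); [|exact Hh].
    destruct (Rle_lt_dec h 0).
    + rewrite Rmax_left by lra. replace (0 ^ 2 / h) with 0 by (field; exact h0). rewrite Rabs_R0. apply Rabs_pos.
    + rewrite Rmax_right by lra. replace (h ^ 2 / h) with h by (field; exact h0). lra.
  - apply (is_derive_ext_loc (fun t => t ^ 2)).
    + exists (mkposreal z G). intros t Ht. apply Rabs_def2 in Ht. simpl in Ht.
      unfold minus, plus, opp in Ht; simpl in Ht. rewrite Rmax_right by lra. reflexivity.
    + rewrite Rmax_right by lra. auto_derive; [easy|ring].
Qed.

(** A simple C^1 function supported in [s - d, s + d]. One derivative suffices, since bump (u) om du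
    only has to be a C^1 form. *)
Definition bump (s d t : R) : R := Rmax 0 (d ^ 2 - (t - s) ^ 2) ^ 2.
Definition dbump (s d t : R) : R := -2 * (t - s) * (2 * Rmax 0 (d ^ 2 - (t - s) ^ 2)).

Lemma derive_bump s d t : is_derive (bump s d) t (dbump s d t).
Proof.
  apply (derive_comp (fun z => Rmax 0 z ^ 2) (fun t => d ^ 2 - (t - s) ^ 2)).
  - apply derive_sq_pos_part.
  - auto_derive; [easy|ring].
Qed.

Lemma continuity_Rmax0 (f : R -> R) t : continuity_pt f t -> continuity_pt (fun t => Rmax 0 (f t)) t.
Proof.
  intros Hf. apply continuity_pt_ext with (fun t => (f t + Rabs (f t)) / 2).
  - intros z. unfold Rmax. destruct (Rle_dec 0 (f z)).
    + rewrite Rabs_pos_eq; lra.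
    + rewrite Rabs_left; lra.
  - apply continuity_pt_mult; [|apply continuity_pt_const; now intros ? ?].
    apply continuity_pt_plus; [exact Hf|]. apply (continuity_pt_comp f Rabs); [exact Hf|apply Rcontinuity_abs].
Qed.

Lemma continuity_dbump s d t : continuity_pt (dbump s d) t.
Proof.
  assert (E : forall k, continuity_pt (fun t => k * (t - s)) t).
  { intros k. apply (is_derive_continuity_pt _ _ k). auto_derive; [easy|ring]. }
  apply continuity_pt_mult; [apply E|].
  apply continuity_pt_mult; [apply continuity_pt_const; now intros ? ?|].
  apply (continuity_Rmax0 (fun t => d ^ 2 - (t - s) ^ 2)).
  apply (is_derive_continuity_pt _ _ (-2 * (t - s))). auto_derive; [easy|ring].
Qed.

Lemma bump_zero s d t : 0 < d -> d <= Rabs (t - s) -> bump s d t = 0.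
Proof.
  intros Hd H. unfold bump. rewrite Rmax_left; [ring|].
  assert (d ^ 2 <= Rabs (t - s) ^ 2) by (apply pow_incr; lra). rewrite pow2_abs in H0. lra.
Qed.

Lemma bump_nonneg s d t : 0 <= bump s d t.
Proof. apply pow2_ge_0. Qed.

Lemma bump_pos s d t : Rabs (t - s) < d -> 0 < bump s d t.
Proof.
  intros H. apply pow_lt. assert (P := Rabs_pos (t - s)). rewrite Rmax_right.
  - rewrite <- (pow2_abs (t - s)). nra.
  - rewrite <- (pow2_abs (t - s)). nra.
Qed.

(** Composed with u, a primitive of bump (u) du. Only its increments matter, so the base point s is
    a mere choice. *)
Definition bump_int (s d t : R) : R := RInt (bump s d) s t.

Lemma derive_bump_int s d t : is_derive (bump_int s d) t (bump s d t).
Proof.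
  assert (C : forall t, continuous (bump s d) t).
  { intros z. apply continuity_pt_continuous. eapply is_derive_continuity_pt, derive_bump. }
  apply (is_derive_RInt (V := R_NormedModule) (bump s d) _ s).
  - apply filter_forall. intros z. apply (RInt_correct (V := R_CompleteNormedModule)).
    apply (ex_RInt_continuous (V := R_CompleteNormedModule)). intros w _. apply C.
  - apply C.
Qed.

Lemma bump_int_total s d t t' : 0 < d -> s + d <= t -> t' <= s - d ->
  bump_int s d t - bump_int s d t' = bump_int s d (s + d) - bump_int s d (s - d).
Proof.
  intros Hd Ht Ht'.
  assert (E1 : bump_int s d t = bump_int s d (s + d)).
  { destruct Ht as [L|<-]; [|reflexivity].
    destruct (mvt_derive (bump_int s d) (bump s d) (s + d) t L) as [c [Hc E]].
    { intros z _. apply derive_bump_int. }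
    rewrite bump_zero in E; [lra|exact Hd|rewrite Rabs_pos_eq; lra]. }
  assert (E2 : bump_int s d t' = bump_int s d (s - d)).
  { destruct Ht' as [L| ->]; [|reflexivity].
    destruct (mvt_derive (bump_int s d) (bump s d) t' (s - d) L) as [c [Hc E]].
    { intros z _. apply derive_bump_int. }
    rewrite bump_zero in E; [lra|exact Hd|rewrite Rabs_left; lra]. }
  rewrite E1, E2. ring.
Qed.

Lemma bump_int_pos s d : 0 < d -> 0 < bump_int s d (s + d) - bump_int s d (s - d).
Proof.
  intros Hd. destruct (mvt_derive (bump_int s d) (bump s d) (s - d) (s + d)) as [c [Hc E]]; [lra| |].
  { intros z _. apply derive_bump_int. }
  rewrite E. apply Rmult_lt_0_compat; [|lra]. apply bump_pos. apply Rabs_def1; lra.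
Qed.

Lemma derive_le_increment (f df : R -> R) (a b : R) :
  a < b -> (forall t, a <= t <= b -> is_derive f t (df t)) ->
  (forall t, a <= t <= b -> 0 <= df t) -> f a <= f b.
Proof.
  intros ab Hd Hp. destruct (mvt_derive f df a b ab Hd) as [c [Hc E]].
  assert (P := Hp c ltac:(lra)). nra.
Qed.

(** [vs_transport] says that grad om is parallel to grad u. The second derivatives of u are kept
    behind an existential: they only serve to see that the forms f du are C^1 and closed. *)
Record vorticity_setting (b : R) (u p q om o1 o2 : R -> R -> R) : Prop := {
  vs_b : 0 < b;
  vs_grad : has_grad (pdisc b) u p q;
  vs_C1 : exists p1 p2 q1 q2, has_grad (pdisc b) p p1 p2 /\ has_grad (pdisc b) q q1 q2 /\
    forall x y, pdisc b x y -> p2 x y = q1 x y;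
  vs_grad_om : has_grad (pdisc b) om o1 o2;
  vs_transport : forall x y, pdisc b x y -> p x y * o2 x y = q x y * o1 x y;
  vs_nocrit : forall x y, pdisc b x y -> p x y <> 0 \/ q x y <> 0;
  vs_pos : forall x y, pdisc b x y -> 0 < u x y;
  vs_boundary : forall e, 0 < e -> exists r, 0 < r < b /\
    forall x y, pdisc b x y -> r ^ 2 < x ^ 2 + y ^ 2 -> u x y < e;
  vs_origin : forall x y, pdisc b x y -> exists r, 0 < r /\
    forall x' y', pdisc b x' y' -> x' ^ 2 + y' ^ 2 < r ^ 2 -> u x y < u x' y'
}.

Arguments vs_b {_ _ _ _ _ _ _}.
Arguments vs_grad {_ _ _ _ _ _ _}.
Arguments vs_C1 {_ _ _ _ _ _ _}.
Arguments vs_grad_om {_ _ _ _ _ _ _}.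
Arguments vs_transport {_ _ _ _ _ _ _}.
Arguments vs_nocrit {_ _ _ _ _ _ _}.
Arguments vs_pos {_ _ _ _ _ _ _}.
Arguments vs_boundary {_ _ _ _ _ _ _}.
Arguments vs_origin {_ _ _ _ _ _ _}.

Lemma no_local_min b f fx fy x y d : has_grad (pdisc b) f fx fy -> pdisc b x y ->
  fx x y <> 0 \/ fy x y <> 0 -> 0 < d ->
  (forall x' y', Rabs (x' - x) < d -> Rabs (y' - y) < d -> pdisc b x' y' -> f x y <= f x' y') -> False.
Proof.
  intros G P N Hd Hm. destruct (G x y P) as [G1 [G2 _]].
  destruct (open2_pdisc b x y P) as [e He].
  assert (M0 : 0 < Rmin d e) by (apply Rmin_pos; [exact Hd|apply cond_pos]).
  assert (M1 := Rmin_l d e). assert (M2 := Rmin_r d e).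
  assert (Z : forall z : R, Rabs (z - z) < Rmin d e) by (intros; rewrite Rminus_diag, Rabs_R0; exact M0).
  assert (Zx := Z x). assert (Zy := Z y).
  destruct N as [N|N]; apply N.
  - apply (local_min_derive (fun t => f t y) x _ (Rmin d e) M0); [|exact G1].
    intros t Ht. apply Hm; try lra. apply He; lra.
  - apply (local_min_derive (fun t => f x t) y _ (Rmin d e) M0); [|exact G2].
    intros t Ht. apply Hm; try lra. apply He; lra.
Qed.

Lemma has_grad_opp D f fx fy : has_grad D f fx fy ->
  has_grad D (fun x y => - f x y) (fun x y => - fx x y) (fun x y => - fy x y).
Proof.
  intros H x y P. destruct (H x y P) as [A1 [A2 [A3 A4]]].
  split; [now apply derive_opp|]. split; [now apply derive_opp|].
  split; now apply continuity_2d_pt_opp.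
Qed.

Lemma grad_zero_segment b h a c x y x' y' : has_grad (pdisc b) h a c ->
  (forall t, 0 <= t <= 1 -> let X := x + t * (x' - x) in let Y := y + t * (y' - y) in
     pdisc b X Y /\ a X Y = 0 /\ c X Y = 0) -> h x y = h x' y'.
Proof.
  intros G Hs.
  destruct (mvt_derive (fun t => h (x + t * (x' - x)) (y + t * (y' - y))) (fun _ => 0) 0 1) as [t [_ E]].
  - lra.
  - intros t Ht. destruct (Hs t Ht) as [P [E1 E2]].
    eapply is_derive_eq.
    + apply (has_grad_comp (pdisc b) h a c (fun t => x + t * (x' - x)) (fun t => y + t * (y' - y)) t (x' - x) (y' - y));
      [apply open2_pdisc|exact G|exact P| |]; auto_derive; try easy; ring.
    + cbv beta. rewrite E1, E2. ring.
  - cbv beta in E.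
    replace (x + 1 * (x' - x)) with x' in E by ring. replace (y + 1 * (y' - y)) with y' in E by ring.
    replace (x + 0 * (x' - x)) with x in E by ring. replace (y + 0 * (y' - y)) with y in E by ring. lra.
Qed.

(** The bounds r2 and r1 keep [S] away from the origin and from C_b, so closedness relative to the
    punctured disc provides the compactness. *)
Lemma min_attained_annulus (b r1 r2 : R) (S : R -> R -> Prop) (f : R -> R -> R) x0 y0 :
  0 < r1 < b -> 0 < r2 ->
  (forall x y, S x y -> pdisc b x y /\ r2 ^ 2 <= x ^ 2 + y ^ 2 <= r1 ^ 2) ->
  (forall x y, pdisc b x y -> ~ S x y -> exists d, 0 < d /\
     forall x' y', Rabs (x' - x) < d -> Rabs (y' - y) < d -> ~ S x' y') ->
  (forall x y, pdisc b x y -> continuity_2d_pt f x y) -> S x0 y0 ->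
  exists x y, S x y /\ forall x' y', S x' y' -> f x y <= f x' y'.
Proof.
  intros Hr1 Hr2 HS Hcl Hf S0. apply (min_attained S f b x0 y0 S0).
  { intros x y Sxy. destruct (HS x y Sxy) as [[_ P] _]. generalize (pow2_ge_0 x) (pow2_ge_0 y). intros.
    split; apply sq_le_abs; lra. }
  intros x y. destruct (classic (S x y)) as [Sxy|N].
  { left. split; [exact Sxy|]. apply Hf. now apply HS. }
  right. assert (K : exists d, 0 < d /\ forall x' y', Rabs (x' - x) < d -> Rabs (y' - y) < d -> ~ S x' y').
  { destruct (Rlt_le_dec (x ^ 2 + y ^ 2) (b ^ 2)) as [L|L].
    - destruct (Req_dec (x ^ 2 + y ^ 2) 0) as [Z|NZ].
      + apply sq_sum_eq0 in Z. destruct Z as [-> ->]. exists (r2 / 2). split; [lra|].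
        intros x' y' A1 A2 S'. rewrite Rminus_0_r in A1, A2. destruct (HS x' y' S') as [_ [B _]].
        generalize (small_box_sq r2 x' y' Hr2 A1 A2). lra.
      + apply Hcl; [|exact N]. split; [|exact L]. generalize (pow2_ge_0 x) (pow2_ge_0 y). lra.
    - destruct (box_sq_ge r1 x y ltac:(lra)) as [d [Hd K]]; [nra|].
      exists d. split; [exact Hd|]. intros x' y' A1 A2 S'. destruct (HS x' y' S') as [_ [_ B]].
      generalize (K x' y' A1 A2). lra. }
  destruct K as [d [Hd K]]. exists d. split; [exact Hd|]. intros x' y' S' A1 A2.
  now destruct (K x' y' A1 A2).
Qed.

Section Levels.

Variables (b : R) (u p q om o1 o2 : R -> R -> R).
Hypothesis H : vorticity_setting b u p q om o1 o2.

Let hb := vs_b H.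
Let Gu := vs_grad H.

Let cu x y : pdisc b x y -> continuity_2d_pt u x y.
Proof. intros P. eapply has_grad_continuous; [apply open2_pdisc|exact Gu|exact P]. Qed.

Lemma near_box (Q : R -> R -> Prop) x y : pdisc b x y -> open2 (fun x y => pdisc b x y /\ Q x y) ->
  Q x y -> exists d, 0 < d /\ forall x' y', Rabs (x' - x) < d -> Rabs (y' - y) < d -> pdisc b x' y' /\ Q x' y'.
Proof.
  intros P oQ HQ. destruct (oQ x y (conj P HQ)) as [d Hd]. exists d. split; [apply cond_pos|exact Hd].
Qed.

Lemma open2_level_gt s : open2 (fun x y => pdisc b x y /\ s < u x y).
Proof.
  intros x y [P L]. destruct (open2_pdisc b x y P) as [d1 K1].
  destruct (cont2_eps u x y (u x y - s) (cu x y P) ltac:(lra)) as [d2 [Hd2 K2]].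
  assert (M0 : 0 < Rmin d1 d2) by (apply Rmin_pos; [apply cond_pos|exact Hd2]).
  assert (M1 := Rmin_l d1 d2). assert (M2 := Rmin_r d1 d2).
  exists (mkposreal _ M0). simpl. intros x' y' Hx Hy. split; [apply K1; lra|].
  assert (T := K2 x' y' ltac:(lra) ltac:(lra)). apply Rabs_def2 in T. lra.
Qed.

Lemma open2_level_lt s : open2 (fun x y => pdisc b x y /\ u x y < s).
Proof.
  intros x y [P L]. destruct (open2_pdisc b x y P) as [d1 K1].
  destruct (cont2_eps u x y (s - u x y) (cu x y P) ltac:(lra)) as [d2 [Hd2 K2]].
  assert (M0 : 0 < Rmin d1 d2) by (apply Rmin_pos; [apply cond_pos|exact Hd2]).
  assert (M1 := Rmin_l d1 d2). assert (M2 := Rmin_r d1 d2).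
  exists (mkposreal _ M0). simpl. intros x' y' Hx Hy. split; [apply K1; lra|].
  assert (T := K2 x' y' ltac:(lra) ltac:(lra)). apply Rabs_def2 in T. lra.
Qed.

Lemma locally_constant (Q : R -> R -> Prop) h a c x y : has_grad (pdisc b) h a c ->
  (forall x y, pdisc b x y -> Q x y -> a x y = 0 /\ c x y = 0) ->
  pdisc b x y -> open2 (fun x y => pdisc b x y /\ Q x y) -> Q x y ->
  exists d, 0 < d /\ forall x' y', Rabs (x' - x) < d -> Rabs (y' - y) < d -> pdisc b x' y' /\ h x' y' = h x y.
Proof.
  intros G Hz P oQ HQ. destruct (near_box Q x y P oQ HQ) as [d [Hd K]].
  exists d. split; [exact Hd|]. intros x' y' Hx Hy. split; [now apply K|].
  symmetry. apply (grad_zero_segment b h a c); [exact G|]. intros t Ht X Y.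
  assert (T : forall z z', Rabs (z' - z) < d -> Rabs (z + t * (z' - z) - z) < d).
  { intros z z' Hzz. replace (z + t * (z' - z) - z) with (t * (z' - z)) by ring.
    rewrite Rabs_mult, (Rabs_pos_eq t) by lra. generalize (Rabs_pos (z' - z)). nra. }
  destruct (K X Y (T x x' Hx) (T y y' Hy)) as [P' Q']. destruct (Hz X Y P' Q'). now split.
Qed.


Lemma not_level_closed (h a c : R -> R -> R) k v x y : has_grad (pdisc b) h a c -> pdisc b x y ->
  ~ (pdisc b x y /\ u x y <= k /\ h x y = v) ->
  exists d, 0 < d /\ forall x' y', Rabs (x' - x) < d -> Rabs (y' - y) < d ->
    ~ (pdisc b x' y' /\ u x' y' <= k /\ h x' y' = v).
Proof.
  intros G P N.
  destruct (Rlt_le_dec k (u x y)) as [L|L].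
  - destruct (open2_level_gt k x y (conj P L)) as [d K]. exists d. split; [apply cond_pos|].
    intros x' y' A1 A2 [_ [B _]]. destruct (K x' y' A1 A2) as [_ C]. lra.
  - destruct (Req_dec (h x y) v) as [E|E]; [now destruct N|].
    assert (ch : continuity_2d_pt h x y).
    { eapply has_grad_continuous; [apply open2_pdisc|exact G|exact P]. }
    destruct (cont2_eps h x y (Rabs (h x y - v)) ch ltac:(apply Rabs_pos_lt; lra)) as [d [Hd K]].
    exists d. split; [exact Hd|]. intros x' y' A1 A2 [_ [_ B]]. specialize (K x' y' A1 A2).
    rewrite B, Rabs_minus_sym in K. lra.
Qed.

Lemma not_level_closed_ge (h a c : R -> R -> R) k v x y : has_grad (pdisc b) h a c -> pdisc b x y ->
  ~ (pdisc b x y /\ k <= u x y /\ h x y = v) ->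
  exists d, 0 < d /\ forall x' y', Rabs (x' - x) < d -> Rabs (y' - y) < d ->
    ~ (pdisc b x' y' /\ k <= u x' y' /\ h x' y' = v).
Proof.
  intros G P N.
  destruct (Rlt_le_dec (u x y) k) as [L|L].
  - destruct (open2_level_lt k x y (conj P L)) as [d K]. exists d. split; [apply cond_pos|].
    intros x' y' A1 A2 [_ [B _]]. destruct (K x' y' A1 A2) as [_ C]. lra.
  - destruct (Req_dec (h x y) v) as [E|E]; [now destruct N|].
    assert (ch : continuity_2d_pt h x y).
    { eapply has_grad_continuous; [apply open2_pdisc|exact G|exact P]. }
    destruct (cont2_eps h x y (Rabs (h x y - v)) ch ltac:(apply Rabs_pos_lt; lra)) as [d [Hd K]].
    exists d. split; [exact Hd|]. intros x' y' A1 A2 [_ [_ B]]. specialize (K x' y' A1 A2).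
    rewrite B, Rabs_minus_sym in K. lra.
Qed.

(* A function that is locally constant on a sublevel set of [u] and vanishes at
   [C_b] is zero there: otherwise [u] would have an interior local minimum. *)
Lemma sublevel_zero h a c k : has_grad (pdisc b) h a c ->
  (forall x y, pdisc b x y -> u x y < k -> a x y = 0 /\ c x y = 0) ->
  (forall e, 0 < e -> exists r, 0 < r < b /\ forall x y, pdisc b x y -> r ^ 2 < x ^ 2 + y ^ 2 -> Rabs (h x y) < e) ->
  forall x y, pdisc b x y -> u x y < k -> h x y = 0.
Proof.
  intros G Hz Hbd x0 y0 P0 L0. apply NNPP. intros N.
  destruct (Hbd (Rabs (h x0 y0)) (Rabs_pos_lt _ N)) as [r1 [Hr1 K1]].
  destruct (vs_origin H x0 y0 P0) as [r2 [Hr2 K2]].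
  (* Minimum of u among the points with u <= u x0 y0 and the same value of h. This set avoids a
     neighbourhood of C_b, where h tends to 0, and one of the origin, where u > u x0 y0. *)
  destruct (min_attained_annulus b r1 r2 (fun x y => pdisc b x y /\ u x y <= u x0 y0 /\ h x y = h x0 y0)
    u x0 y0 Hr1 Hr2) as [x [y [[P [L E]] Hm]]].
  { intros x y [P [L E]]. split; [exact P|]. split; apply Rnot_lt_le; intros Lt.
    - assert (T := K2 x y P Lt). lra.
    - assert (T := K1 x y P Lt). rewrite E in T. lra. }
  { intros x y P. now apply (not_level_closed h a c). }
  { exact cu. }
  { split; [exact P0|]. split; [lra|reflexivity]. }
  destruct (locally_constant (fun x y => u x y < k) h a c x y G Hz P (open2_level_lt k)) as [d [Hd K]]; [lra|].
  apply (no_local_min b u p q x y d Gu P); [now apply (vs_nocrit H)|exact Hd|].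
  intros x' y' A1 A2 P'. apply Rnot_lt_le. intros Lt.
  destruct (K x' y' A1 A2) as [_ E'].
  assert (u x y <= u x' y'); [|lra]. apply Hm. split; [exact P'|]. split; [lra|congruence].
Qed.

(** Mirror image of [sublevel_zero]: the value is prescribed near the origin, and another value of h
    would produce an interior local maximum of u. *)
Lemma superlevel_constant h a c k rho v : has_grad (pdisc b) h a c -> 0 < rho ->
  (forall x y, pdisc b x y -> k < u x y -> a x y = 0 /\ c x y = 0) ->
  (forall x y, pdisc b x y -> x ^ 2 + y ^ 2 < rho ^ 2 -> h x y = v) ->
  forall x y, pdisc b x y -> k < u x y -> h x y = v.
Proof.
  intros G Hrho Hz Ho x0 y0 P0 L0. apply NNPP. intros N.
  destruct (vs_boundary H (u x0 y0) ltac:(now apply (vs_pos H))) as [r1 [Hr1 K1]].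
  destruct (min_attained_annulus b r1 rho (fun x y => pdisc b x y /\ u x0 y0 <= u x y /\ h x y = h x0 y0)
    (fun x y => - u x y) x0 y0 Hr1 Hrho) as [x [y [[P [L E]] Hm]]].
  { intros x y [P [L E]]. split; [exact P|]. split; apply Rnot_lt_le; intros Lt.
    - assert (T := Ho x y P Lt). rewrite E in T. lra.
    - assert (T := K1 x y P Lt). lra. }
  { intros x y P. now apply (not_level_closed_ge h a c). }
  { intros. now apply continuity_2d_pt_opp, cu. }
  { split; [exact P0|]. split; [lra|reflexivity]. }
  destruct (locally_constant (fun x y => k < u x y) h a c x y G Hz P (open2_level_gt k)) as [d [Hd K]]; [lra|].
  apply (no_local_min b _ _ _ x y d (has_grad_opp _ _ _ _ Gu) P); [|exact Hd|].
  { destruct (vs_nocrit H x y P); [left|right]; lra. }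
  intros x' y' A1 A2 P'. apply Rnot_lt_le. intros Lt.
  destruct (K x' y' A1 A2) as [_ E'].
  assert (- u x y <= - u x' y'); [|lra]. apply Hm. split; [exact P'|]. split; [lra|congruence].
Qed.

(** A punctured disc is not convex: points of the negative axis, whose segment to (rho / 2, 0) meets
    the origin, are joined to it through (0, rho / 2). *)
Lemma constant_near_origin h a c rho : has_grad (pdisc b) h a c -> 0 < rho <= b ->
  (forall x y, pdisc b x y -> x ^ 2 + y ^ 2 < rho ^ 2 -> a x y = 0 /\ c x y = 0) ->
  forall x y, pdisc b x y -> x ^ 2 + y ^ 2 < rho ^ 2 -> h x y = h (rho / 2) 0.
Proof.
  intros G Hrho Hz.
  assert (Seg : forall x y x' y', 0 < x ^ 2 + y ^ 2 < rho ^ 2 -> 0 < x' ^ 2 + y' ^ 2 < rho ^ 2 ->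
    (forall t, 0 <= t <= 1 -> x + t * (x' - x) = 0 -> y + t * (y' - y) = 0 -> False) -> h x y = h x' y').
  { intros x y x' y' Q Q' N. apply (grad_zero_segment b h a c); [exact G|]. intros t Ht X Y.
    assert (L : X ^ 2 + Y ^ 2 < rho ^ 2).
    { assert (I1 : X ^ 2 <= (1 - t) * x ^ 2 + t * x' ^ 2).
      { assert (0 <= t * (1 - t) * (x' - x) ^ 2) by (apply Rmult_le_pos; [nra|apply pow2_ge_0]). unfold X. nra. }
      assert (I2 : Y ^ 2 <= (1 - t) * y ^ 2 + t * y' ^ 2).
      { assert (0 <= t * (1 - t) * (y' - y) ^ 2) by (apply Rmult_le_pos; [nra|apply pow2_ge_0]). unfold Y. nra. }
      destruct (Req_dec t 0) as [->|N0]; [lra|].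
      assert (t * (x' ^ 2 + y' ^ 2) < t * rho ^ 2) by (apply Rmult_lt_compat_l; lra).
      assert ((1 - t) * (x ^ 2 + y ^ 2) <= (1 - t) * rho ^ 2) by (apply Rmult_le_compat_l; lra). lra. }
    assert (P : pdisc b X Y).
    { split; [|nra]. destruct (Req_dec (X ^ 2 + Y ^ 2) 0) as [Z|NZ].
      - apply sq_sum_eq0 in Z. destruct Z. now destruct (N t Ht).
      - generalize (pow2_ge_0 X) (pow2_ge_0 Y). lra. }
    split; [exact P|now apply Hz]. }
  intros x y P L.
  destruct (Req_dec y 0) as [->|Ny].
  - destruct (Rlt_le_dec 0 x) as [x0|x0].
    + apply Seg; [destruct P; lra|split; nra|]. intros t Ht E _. nra.
    + assert (x <> 0). { intros ->. destruct P as [P _]. lra. }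
      transitivity (h 0 (rho / 2)).
      * apply Seg; [destruct P; lra|split; nra|]. intros t Ht E1 E2.
        assert (t = 0) by nra. subst. lra.
      * apply Seg; [split; nra|split; nra|]. intros t Ht E1 E2. assert (t = 0) by nra. subst. nra.
  - apply Seg; [destruct P; lra|split; nra|]. intros t Ht E1 E2.
    assert (E : t = 1). { apply Rmult_eq_reg_l with y; [lra|exact Ny]. } subst. lra.
Qed.

(* [h0] is the jump across the band [|u - s| < d] of a primitive of [bump (u) om du]:
   up to the factor [int bump] it measures [om] on the level [s]. *)
Lemma band_crossing (h : R -> R -> R) s d (h0 : R) (g1 g2 : R -> R) (l1 l2 t0 eta w : R) : 0 < d -> 0 < t0 ->
  has_grad (pdisc b) h (fun x y => bump s d (u x y) * om x y * p x y) (fun x y => bump s d (u x y) * om x y * q x y) ->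
  (forall x y, pdisc b x y -> u x y < s - d -> h x y = 0) ->
  (forall x y, pdisc b x y -> s + d < u x y -> h x y = h0) ->
  (forall t, is_derive g1 t l1 /\ is_derive g2 t l2) ->
  (forall t, - t0 <= t <= t0 -> pdisc b (g1 t) (g2 t) /\ 0 <= p (g1 t) (g2 t) * l1 + q (g1 t) (g2 t) * l2 /\
     Rabs (om (g1 t) (g2 t) - w) <= eta) ->
  u (g1 (- t0)) (g2 (- t0)) < s - d -> s + d < u (g1 t0) (g2 t0) ->
  Rabs (h0 - w * (bump_int s d (s + d) - bump_int s d (s - d)))
    <= eta * (bump_int s d (s + d) - bump_int s d (s - d)).
Proof.
  intros Hd Ht0 Gh Hlo Hhi Hg Hseg Elo Ehi.
  set (I := bump_int s d (s + d) - bump_int s d (s - d)).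
  set (U := fun t => u (g1 t) (g2 t)).
  assert (dU : forall t, - t0 <= t <= t0 -> is_derive U t (p (g1 t) (g2 t) * l1 + q (g1 t) (g2 t) * l2)).
  { intros t Ht. apply (has_grad_comp (pdisc b)); [apply open2_pdisc|exact Gu|now apply Hseg|apply Hg..]. }
  assert (dX : forall t, - t0 <= t <= t0 -> is_derive (fun t => bump_int s d (U t)) t
    ((p (g1 t) (g2 t) * l1 + q (g1 t) (g2 t) * l2) * bump s d (U t))).
  { intros t Ht. apply (derive_comp (bump_int s d) U); [apply derive_bump_int|now apply dU]. }
  assert (dh : forall t, - t0 <= t <= t0 -> is_derive (fun t => h (g1 t) (g2 t)) t
    (bump s d (U t) * om (g1 t) (g2 t) * p (g1 t) (g2 t) * l1 + bump s d (U t) * om (g1 t) (g2 t) * q (g1 t) (g2 t) * l2)).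
  { intros t Ht. apply (has_grad_comp (pdisc b) h _ _ g1 g2 t l1 l2 (open2_pdisc b) Gh); [now apply Hseg|apply Hg..]. }
  assert (Tot : bump_int s d (U t0) - bump_int s d (U (- t0)) = I).
  { apply bump_int_total; unfold U; lra. }
  assert (Hh : h (g1 t0) (g2 t0) - h (g1 (- t0)) (g2 (- t0)) = h0).
  { rewrite (Hhi (g1 t0) (g2 t0)), (Hlo (g1 (- t0)) (g2 (- t0))); [ring|..]; try assumption; apply Hseg; lra. }
  assert (B : forall t, - t0 <= t <= t0 -> 0 <= (p (g1 t) (g2 t) * l1 + q (g1 t) (g2 t) * l2) * bump s d (U t) /\
    - eta <= om (g1 t) (g2 t) - w <= eta).
  { intros t Ht. destruct (Hseg t Ht) as [_ [B1 B2]]. split; [apply Rmult_le_pos; [exact B1|apply bump_nonneg]|].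
    now apply Rabs_le_between. }
  (* Along the line, h - (w - eta) bump_int (u) and (w + eta) bump_int (u) - h are nondecreasing,
     because h has derivative om times that of bump_int (u). *)
  apply Rabs_le_between. split.
  - assert (Q := derive_le_increment (fun t => h (g1 t) (g2 t) - (w - eta) * bump_int s d (U t)) _ (- t0) t0 ltac:(lra)
      (fun t Ht => derive_minus _ _ t _ _ (dh t Ht) (derive_scal _ (w - eta) t _ (dX t Ht)))).
    cbv beta in Q. rewrite <- Tot. enough (T : forall t, - t0 <= t <= t0 -> 0 <= bump s d (U t) * om (g1 t) (g2 t) * p (g1 t) (g2 t) * l1 + bump s d (U t) * om (g1 t) (g2 t) * q (g1 t) (g2 t) * l2 - (w - eta) * ((p (g1 t) (g2 t) * l1 + q (g1 t) (g2 t) * l2) * bump s d (U t))) by (specialize (Q T); lra).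
    intros t Ht. destruct (B t Ht) as [B1 B2].
    match goal with |- 0 <= ?e => replace e with
      ((p (g1 t) (g2 t) * l1 + q (g1 t) (g2 t) * l2) * bump s d (U t) * (om (g1 t) (g2 t) - w + eta)) by ring end.
    apply Rmult_le_pos; lra.
  - assert (Q := derive_le_increment (fun t => (w + eta) * bump_int s d (U t) - h (g1 t) (g2 t)) _ (- t0) t0 ltac:(lra)
      (fun t Ht => derive_minus _ _ t _ _ (derive_scal _ (w + eta) t _ (dX t Ht)) (dh t Ht))).
    cbv beta in Q. rewrite <- Tot. enough (T : forall t, - t0 <= t <= t0 -> 0 <= (w + eta) * ((p (g1 t) (g2 t) * l1 + q (g1 t) (g2 t) * l2) * bump s d (U t)) - (bump s d (U t) * om (g1 t) (g2 t) * p (g1 t) (g2 t) * l1 + bump s d (U t) * om (g1 t) (g2 t) * q (g1 t) (g2 t) * l2)) by (specialize (Q T); lra).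
    intros t Ht. destruct (B t Ht) as [B1 B2].
    match goal with |- 0 <= ?e => replace e with
      ((p (g1 t) (g2 t) * l1 + q (g1 t) (g2 t) * l2) * bump s d (U t) * (w + eta - om (g1 t) (g2 t))) by ring end.
    apply Rmult_le_pos; lra.
Qed.

(* [bump (u) om du] is closed because [om] is transported by the flow. *)
Lemma band_primitive s d : 0 < d < s -> exists h,
  has_grad (pdisc b) h (fun x y => bump s d (u x y) * om x y * p x y) (fun x y => bump s d (u x y) * om x y * q x y) /\
  forall e, 0 < e -> exists r, 0 < r < b /\ forall x y, pdisc b x y -> r ^ 2 < x ^ 2 + y ^ 2 -> Rabs (h x y) < e.
Proof.
  intros Hd. destruct (vs_C1 H) as [p1 [p2 [q1 [q2 [Gp [Gq Epq]]]]]].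
  assert (Go := vs_grad_om H).
  assert (Gb := has_grad_comp_l _ _ _ _ _ _ (open2_pdisc b) Gu (derive_bump s d) (continuity_dbump s d)).
  assert (Gbo := has_grad_mult _ _ _ _ _ _ _ (open2_pdisc b) Gb Go).
  assert (Ga := has_grad_mult _ _ _ _ _ _ _ (open2_pdisc b) Gbo Gp).
  assert (Gc := has_grad_mult _ _ _ _ _ _ _ (open2_pdisc b) Gbo Gq).
  destruct (vs_boundary H (s - d) ltac:(lra)) as [r [Hr K]].
  assert (Z : forall x y, pdisc b x y -> r ^ 2 < x ^ 2 + y ^ 2 -> bump s d (u x y) = 0).
  { intros x y P L. apply bump_zero; [lra|]. assert (T := K x y P L). rewrite Rabs_left; lra. }
  (* Near C_b one has u < s - d, so the form vanishes there: the bound is 0 and the tangential part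
     is zero. *)
  apply (closed_form_primitive b _ _ _ _ _ _ Ga Gc) with (M := 0) (r0 := r).
  - intros x y P. cbv beta. rewrite (Epq x y P).
    generalize (vs_transport H x y P). intros T.
    match goal with |- ?l = ?m => enough (l - m = 0) by lra end.
    match goal with |- ?e = 0 => replace e with (bump s d (u x y) * (p x y * o2 x y - q x y * o1 x y)) by ring end.
    rewrite T. ring.
  - exact Hr.
  - intros x y P L. rewrite (Z x y P L), !Rmult_0_l, Rabs_R0. lra.
  - intros e He. exists r. split; [exact Hr|]. intros x y P L. rewrite (Z x y P L).
    replace (- y * (0 * om x y * p x y) + x * (0 * om x y * q x y)) with 0 by ring. now rewrite Rabs_R0.
Qed.

(** A transversal through (x, y): along the gradient direction u increases at rate at least half the
    squared norm of the gradient, while om and its derivative remain controlled. It serves both to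
    cross bands and to bound om in terms of u. *)
Lemma gradient_line x y eta : pdisc b x y -> 0 < eta -> exists t0 m L, 0 < t0 /\ 0 < m /\ 0 <= L /\
  forall t, - t0 <= t <= t0 -> let X := x + t * p x y in let Y := y + t * q x y in
    pdisc b X Y /\ m <= p X Y * p x y + q X Y * q x y /\ Rabs (om X Y - om x y) <= eta /\
    Rabs (o1 X Y * p x y + o2 X Y * q x y) <= L.
Proof.
  intros P He. destruct (Gu x y P) as [_ [_ [Cp Cq]]].
  destruct (vs_grad_om H x y P) as [_ [_ [C1 C2]]].
  assert (Co : continuity_2d_pt om x y).
  { eapply has_grad_continuous; [apply open2_pdisc|apply (vs_grad_om H)|exact P]. }
  set (P0 := p x y). set (Q0 := q x y).
  assert (N : 0 < P0 ^ 2 + Q0 ^ 2).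
  { destruct (vs_nocrit H x y P); [now apply sq_sum_pos_l|now apply sq_sum_pos_r]. }
  assert (C1' : continuity_2d_pt (fun X Y => p X Y * P0 + q X Y * Q0) x y).
  { apply continuity_2d_pt_plus; (apply continuity_2d_pt_mult; [assumption|apply continuity_2d_pt_const]). }
  assert (C2' : continuity_2d_pt (fun X Y => o1 X Y * P0 + o2 X Y * Q0) x y).
  { apply continuity_2d_pt_plus; (apply continuity_2d_pt_mult; [assumption|apply continuity_2d_pt_const]). }
  destruct (cont2_eps _ x y ((P0 ^ 2 + Q0 ^ 2) / 2) C1' ltac:(lra)) as [d1 [Hd1 K1]].
  destruct (cont2_eps _ x y 1 C2' ltac:(lra)) as [d2 [Hd2 K2]].
  destruct (cont2_eps _ x y eta Co He) as [d3 [Hd3 K3]].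
  destruct (open2_pdisc b x y P) as [d4 K4]. assert (Hd4 := cond_pos d4).
  set (d := Rmin (Rmin d1 d2) (Rmin d3 d4)).
  assert (Ld : d <= d1 /\ d <= d2 /\ d <= d3 /\ d <= d4).
  { unfold d. generalize (Rmin_l (Rmin d1 d2) (Rmin d3 d4)) (Rmin_r (Rmin d1 d2) (Rmin d3 d4))
      (Rmin_l d1 d2) (Rmin_r d1 d2) (Rmin_l d3 d4) (Rmin_r d3 d4). lra. }
  assert (d0 : 0 < d) by (unfold d; repeat apply Rmin_pos; lra).
  (* A exceeds both components of the gradient, so |t| <= d / A / 2 keeps the line within d of (x,
     y). *)
  set (A := Rabs P0 + Rabs Q0 + 1).
  assert (PA := Rabs_pos P0). assert (QA := Rabs_pos Q0).
  assert (T0 : 0 < d / A / 2). { assert (0 < d / A) by (apply Rdiv_lt_0_compat; unfold A; lra). lra. }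
  exists (d / A / 2), ((P0 ^ 2 + Q0 ^ 2) / 2), (Rabs (o1 x y * P0 + o2 x y * Q0) + 1).
  split; [exact T0|]. split; [lra|]. split; [generalize (Rabs_pos (o1 x y * P0 + o2 x y * Q0)); lra|].
  intros t Ht X Y.
  assert (Bt : Rabs t <= d / A / 2) by (apply Rabs_le; lra).
  assert (BX : forall z Z0, Rabs Z0 < A -> Rabs (z + t * Z0 - z) < d).
  { intros z Z0 HZ. replace (z + t * Z0 - z) with (t * Z0) by ring. rewrite Rabs_mult.
    apply Rle_lt_trans with (d / A / 2 * A).
    - apply Rmult_le_compat; try apply Rabs_pos; lra.
    - replace (d / A / 2 * A) with (d / 2) by (field; unfold A; lra). lra. }
  assert (BX1 : Rabs (X - x) < d) by (apply BX; unfold A; lra).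
  assert (BY1 : Rabs (Y - y) < d) by (apply BX; unfold A; lra).
  split; [apply K4; lra|]. split; [|split].
  - assert (T := K1 X Y ltac:(lra) ltac:(lra)). cbv beta in T. fold P0 Q0 in T. apply Rabs_def2 in T. nra.
  - left. apply K3; lra.
  - assert (T := K2 X Y ltac:(lra) ltac:(lra)). cbv beta in T.
    generalize (Rabs_triang_inv (o1 X Y * P0 + o2 X Y * Q0) (o1 x y * P0 + o2 x y * Q0)). lra.
Qed.

Lemma line_derive z k t : is_derive (fun t => z + t * k) t k.
Proof. auto_derive; [easy|ring]. Qed.

(** d0 = m t0: over the times [- t0, t0] the gradient line covers the levels from s - m t0 to s + m
    t0 at least, hence crosses any thinner band. *)
Lemma om_level_approx x y eta : pdisc b x y -> 0 < eta -> exists d0, 0 < d0 /\ forall d h h0,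
  0 < d < d0 -> let s := u x y in
  has_grad (pdisc b) h (fun x y => bump s d (u x y) * om x y * p x y) (fun x y => bump s d (u x y) * om x y * q x y) ->
  (forall x y, pdisc b x y -> u x y < s - d -> h x y = 0) ->
  (forall x y, pdisc b x y -> s + d < u x y -> h x y = h0) ->
  Rabs (h0 - om x y * (bump_int s d (s + d) - bump_int s d (s - d)))
    <= eta * (bump_int s d (s + d) - bump_int s d (s - d)).
Proof.
  intros P He. destruct (gradient_line x y eta P He) as [t0 [m [L [Ht0 [Hm [_ K]]]]]].
  exists (m * t0). split; [now apply Rmult_lt_0_compat|].
  intros d h h0 Hd s Gh Hlo Hhi.
  set (g := fun t => u (x + t * p x y) (y + t * q x y)).
  assert (dg : forall t, - t0 <= t <= t0 -> is_derive g t
    (p (x + t * p x y) (y + t * q x y) * p x y + q (x + t * p x y) (y + t * q x y) * q x y)).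
  { intros t Ht. apply (has_grad_comp (pdisc b) u p q (fun t => x + t * p x y) (fun t => y + t * q x y));
      [apply open2_pdisc|exact Gu|now apply K|apply line_derive..]. }
  assert (g0 : g 0 = s) by (unfold g; now rewrite !Rmult_0_l, !Rplus_0_r).
  apply (band_crossing h s d h0 (fun t => x + t * p x y) (fun t => y + t * q x y) (p x y) (q x y) t0); try assumption; try lra.
  - intros t. split; apply line_derive.
  - intros t Ht. destruct (K t Ht) as [A1 [A2 [A3 _]]]. split; [exact A1|]. split; [lra|exact A3].
  - fold (g (- t0)). destruct (mvt_derive g _ (- t0) 0 ltac:(lra) (fun t Ht => dg t ltac:(lra))) as [c [Hc E]].
    cbv beta in E. destruct (K c ltac:(lra)) as [_ [A2 _]]. nra.
  - fold (g t0). destruct (mvt_derive g _ 0 t0 ltac:(lra) (fun t Ht => dg t ltac:(lra))) as [c [Hc E]].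
    cbv beta in E. destruct (K c ltac:(lra)) as [_ [A2 _]]. nra.
Qed.

(** The jump of h belongs to the band and not to the point where the band is crossed. So om at the
    two points is within eta of one and the same quotient, and eta is a quarter of the supposed
    gap. *)
Theorem om_function_of_u x y x' y' : pdisc b x y -> pdisc b x' y' -> u x y = u x' y' -> om x y = om x' y'.
Proof.
  intros P P' E. apply NNPP. intros N.
  set (eta := Rabs (om x y - om x' y') / 4).
  assert (He : 0 < eta). { assert (0 < Rabs (om x y - om x' y')) by (apply Rabs_pos_lt; lra). unfold eta. lra. }
  destruct (om_level_approx x y eta P He) as [d1 [Hd1 K1]].
  destruct (om_level_approx x' y' eta P' He) as [d2 [Hd2 K2]].
  rewrite <- E in K2. set (s := u x y) in *.
  assert (s0 : 0 < s) by now apply (vs_pos H).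
  destruct (vs_origin H x y P) as [r [Hr Kr]]. fold s in Kr.
  (* A point with u > s: bands ending below u z 0 are surpassed near the origin, so the form
     vanishes there and h is constant. *)
  set (z := Rmin r b / 2). assert (0 < Rmin r b) by (apply Rmin_pos; lra).
  assert (Lr := Rmin_l r b). assert (Lb := Rmin_r r b).
  assert (Pz : pdisc b z 0) by (unfold z; split; nra).
  assert (Uz : s < u z 0) by (apply Kr; [exact Pz|unfold z; nra]).
  set (d := Rmin (Rmin d1 d2) (Rmin s (u z 0 - s)) / 2).
  assert (Hd : 0 < d < d1 /\ d < d2 /\ d < s /\ s + d < u z 0).
  { unfold d. assert (0 < Rmin (Rmin d1 d2) (Rmin s (u z 0 - s))) by (repeat apply Rmin_pos; lra).
    generalize (Rmin_l (Rmin d1 d2) (Rmin s (u z 0 - s))) (Rmin_r (Rmin d1 d2) (Rmin s (u z 0 - s)))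
      (Rmin_l d1 d2) (Rmin_r d1 d2) (Rmin_l s (u z 0 - s)) (Rmin_r s (u z 0 - s)). lra. }
  destruct (band_primitive s d ltac:(lra)) as [h [Gh Hh]].
  destruct (vs_origin H z 0 Pz) as [rho' [Hrho' Krho]].
  set (rho := Rmin rho' b). assert (rho0 : 0 < rho) by (apply Rmin_pos; lra).
  assert (R1 := Rmin_l rho' b). assert (R2 := Rmin_r rho' b). fold rho in R1, R2.
  assert (Zero : forall x y, d <= Rabs (u x y - s) -> bump s d (u x y) * om x y * p x y = 0 /\
    bump s d (u x y) * om x y * q x y = 0).
  { intros a c B. rewrite bump_zero by (lra || exact B). split; ring. }
  assert (Hlo : forall x y, pdisc b x y -> u x y < s - d -> h x y = 0).
  { apply (sublevel_zero h _ _ (s - d) Gh); [|exact Hh]. intros a c _ L. apply Zero. rewrite Rabs_left; lra. }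
  assert (Hhi : forall x y, pdisc b x y -> s + d < u x y -> h x y = h (rho / 2) 0).
  { apply (superlevel_constant h _ _ (s + d) rho (h (rho / 2) 0) Gh rho0).
    - intros a c _ L. apply Zero. rewrite Rabs_pos_eq; lra.
    - apply (constant_near_origin h _ _ rho Gh); [lra|]. intros a c Pa L. apply Zero.
      assert (u z 0 < u a c) by (apply Krho; [exact Pa|nra]). rewrite Rabs_pos_eq; lra. }
  assert (Q1 := K1 d h _ ltac:(lra) Gh Hlo Hhi). assert (Q2 := K2 d h _ ltac:(lra) Gh Hlo Hhi).
  cbv zeta in Q1. assert (Ip := bump_int_pos s d ltac:(lra)).
  set (I := bump_int s d (s + d) - bump_int s d (s - d)) in *.
  apply Rabs_le_between in Q1. apply Rabs_le_between in Q2.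
  assert (B : Rabs (om x y - om x' y') <= 2 * eta).
  { apply Rabs_le. split; apply Rmult_le_reg_r with I; nra. }
  unfold eta in B. assert (0 < Rabs (om x y - om x' y')) by (apply Rabs_pos_lt; lra). lra.
Qed.

(** Mean value theorem for om and for u on the same segment: the ratio of the two slopes is at most
    L / m. *)
Lemma om_lipschitz_on_line z1 z2 k1 k2 al be m L t t' : 0 < m -> 0 <= L ->
  (forall t, al < t < be -> let X := z1 + t * k1 in let Y := z2 + t * k2 in
    pdisc b X Y /\ m <= p X Y * k1 + q X Y * k2 /\ Rabs (o1 X Y * k1 + o2 X Y * k2) <= L) ->
  al < t < be -> al < t' < be ->
  Rabs (om (z1 + t * k1) (z2 + t * k2) - om (z1 + t' * k1) (z2 + t' * k2))
    <= L / m * Rabs (u (z1 + t * k1) (z2 + t * k2) - u (z1 + t' * k1) (z2 + t' * k2)).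
Proof.
  intros Hm HL K.
  assert (Gen : forall t t', al < t -> t < t' -> t' < be ->
    Rabs (om (z1 + t * k1) (z2 + t * k2) - om (z1 + t' * k1) (z2 + t' * k2))
    <= L / m * Rabs (u (z1 + t * k1) (z2 + t * k2) - u (z1 + t' * k1) (z2 + t' * k2))).
  { clear t t'. intros t t' H1 H2 H3.
    destruct (mvt_derive (fun t => om (z1 + t * k1) (z2 + t * k2))
      (fun t => o1 (z1 + t * k1) (z2 + t * k2) * k1 + o2 (z1 + t * k1) (z2 + t * k2) * k2) t t' H2) as [c [Hc E]].
    { intros a Ha. apply (has_grad_comp (pdisc b) om o1 o2 (fun t => z1 + t * k1) (fun t => z2 + t * k2));
      [apply open2_pdisc|apply (vs_grad_om H)|apply K; lra|apply line_derive..]. }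
    destruct (mvt_derive (fun t => u (z1 + t * k1) (z2 + t * k2))
      (fun t => p (z1 + t * k1) (z2 + t * k2) * k1 + q (z1 + t * k1) (z2 + t * k2) * k2) t t' H2) as [c' [Hc' E']].
    { intros a Ha. apply (has_grad_comp (pdisc b) u p q (fun t => z1 + t * k1) (fun t => z2 + t * k2));
      [apply open2_pdisc|exact Gu|apply K; lra|apply line_derive..]. }
    rewrite (Rabs_minus_sym (om _ _)), (Rabs_minus_sym (u _ _)). cbv beta in E, E'. rewrite E, E'.
    destruct (K c ltac:(lra)) as [_ [_ B]]. destruct (K c' ltac:(lra)) as [_ [B' _]].
    rewrite Rabs_mult, (Rabs_pos_eq (t' - t)) by lra.
    set (D := p (z1 + c' * k1) (z2 + c' * k2) * k1 + q (z1 + c' * k1) (z2 + c' * k2) * k2) in *.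
    rewrite (Rabs_pos_eq (D * (t' - t))) by (apply Rmult_le_pos; lra).
    apply Rle_trans with (L * (t' - t)); [apply Rmult_le_compat_r; lra|].
    replace (L / m * (D * (t' - t))) with (L * (D / m) * (t' - t)) by (field; lra).
    apply Rmult_le_compat_r; [lra|].
    assert (1 <= D / m) by (apply Rle_div_r; lra). nra. }
  intros Ht Ht'. destruct (Rtotal_order t t') as [Lt|[->|Gt]].
  - apply Gen; lra.
  - rewrite !Rminus_diag, Rabs_R0. lra.
  - rewrite (Rabs_minus_sym (om _ _)), (Rabs_minus_sym (u _ _)). apply Gen; lra.
Qed.

Lemma line_ivt z1 z2 k1 k2 t1 t2 s : t1 < t2 ->
  (forall t, t1 <= t <= t2 -> pdisc b (z1 + t * k1) (z2 + t * k2)) ->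
  u (z1 + t1 * k1) (z2 + t1 * k2) < s < u (z1 + t2 * k1) (z2 + t2 * k2) ->
  exists t, t1 < t < t2 /\ u (z1 + t * k1) (z2 + t * k2) = s.
Proof.
  intros Ht P Hs.
  destruct (Ranalysis5.IVT_interv (fun t => u (z1 + t * k1) (z2 + t * k2) - s) t1 t2) as [t [Hz E]].
  - intros t H1. apply continuity_pt_minus; [|apply continuity_pt_const; now intros ? ?].
    apply (continuity_2d_comp u (fun t => z1 + t * k1) (fun t => z2 + t * k2)); [now apply cu, P|..];
      eapply is_derive_continuity_pt, line_derive.
  - exact Ht.
  - lra.
  - lra.
  - exists t. split; [|lra].
    destruct (Req_dec t t1) as [->|N1]; [lra|]. destruct (Req_dec t t2) as [->|N2]; [lra|]. lra.
Qed.

(** The gradient line at (x, y) meets every level close to u x y. As om depends on the level only,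
    arbitrary points may be replaced by points of this line. *)
Theorem om_locally_lipschitz x y : pdisc b x y -> exists eta C, 0 < eta /\ 0 <= C /\
  forall x1 y1 x2 y2, pdisc b x1 y1 -> pdisc b x2 y2 ->
    Rabs (u x1 y1 - u x y) < eta -> Rabs (u x2 y2 - u x y) < eta ->
    Rabs (om x1 y1 - om x2 y2) <= C * Rabs (u x1 y1 - u x2 y2).
Proof.
  intros P. destruct (gradient_line x y 1 P ltac:(lra)) as [t0 [m [L [Ht0 [Hm [HL K]]]]]].
  exists (m * t0), (L / m). split; [now apply Rmult_lt_0_compat|].
  split; [apply Rmult_le_pos; [exact HL|left; now apply Rinv_0_lt_compat]|].
  assert (Inc : forall t1 t2, - t0 <= t1 -> t1 < t2 -> t2 <= t0 ->
    m * (t2 - t1) <= u (x + t2 * p x y) (y + t2 * q x y) - u (x + t1 * p x y) (y + t1 * q x y)).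
  { intros t1 t2 H1 H2 H3.
    destruct (mvt_derive (fun t => u (x + t * p x y) (y + t * q x y))
      (fun t => p (x + t * p x y) (y + t * q x y) * p x y + q (x + t * p x y) (y + t * q x y) * q x y) t1 t2 H2) as [c [Hc E]].
    { intros a Ha. apply (has_grad_comp (pdisc b) u p q (fun t => x + t * p x y) (fun t => y + t * q x y));
      [apply open2_pdisc|exact Gu|apply K; lra|apply line_derive..]. }
    cbv beta in E. rewrite E. destruct (K c ltac:(lra)) as [_ [B _]]. nra. }
  assert (Rep : forall x1 y1, pdisc b x1 y1 -> Rabs (u x1 y1 - u x y) < m * t0 -> exists t, - t0 < t < t0 /\
    u (x + t * p x y) (y + t * q x y) = u x1 y1).
  { intros x1 y1 P1 B. apply Rabs_def2 in B.
    assert (E1 := Inc (- t0) 0 ltac:(lra) ltac:(lra) ltac:(lra)).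
    assert (E2 := Inc 0 t0 ltac:(lra) ltac:(lra) ltac:(lra)).
    rewrite !Rmult_0_l, !Rplus_0_r in E1, E2.
    apply line_ivt; [lra|intros t Ht; now apply K|lra]. }
  intros x1 y1 x2 y2 P1 P2 B1 B2.
  destruct (Rep x1 y1 P1 B1) as [t1 [Ht1 E1]]. destruct (Rep x2 y2 P2 B2) as [t2 [Ht2 E2]].
  rewrite <- E1, <- E2.
  rewrite (om_function_of_u x1 y1 (x + t1 * p x y) (y + t1 * q x y)), (om_function_of_u x2 y2 (x + t2 * p x y) (y + t2 * q x y));
    try assumption; try (symmetry; assumption); try (apply K; lra).
  apply (om_lipschitz_on_line x y (p x y) (q x y) (- t0) t0 m L); try assumption.
  intros t Ht X Y. destruct (K t ltac:(lra)) as [A1 [A2 [_ A4]]]. now split.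
Qed.

(* Version at the boundary value [0], from a transversal ending at a boundary
   point where the gradient does not degenerate. *)
Theorem om_lipschitz_at_boundary B1 B2 m L d : B1 ^ 2 + B2 ^ 2 = b ^ 2 -> 0 < m -> 0 <= L -> 0 < d ->
  (forall x y, pdisc b x y -> Rabs (x - B1) < d -> Rabs (y - B2) < d ->
     m <= - (p x y * B1 + q x y * B2) /\ Rabs (o1 x y * B1 + o2 x y * B2) <= L) ->
  exists eta C, 0 < eta /\ 0 <= C /\ forall x1 y1 x2 y2, pdisc b x1 y1 -> pdisc b x2 y2 ->
    u x1 y1 < eta -> u x2 y2 < eta -> Rabs (om x1 y1 - om x2 y2) <= C * Rabs (u x1 y1 - u x2 y2).
Proof.
  intros HB Hm HL Hd K.
  set (t0 := Rmin (d / b) 1 / 2).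
  assert (db : 0 < d / b) by (apply Rdiv_lt_0_compat; lra).
  assert (Ht0 : 0 < t0 < d / b /\ t0 < 1).
  { unfold t0. assert (0 < Rmin (d / b) 1) by (apply Rmin_pos; lra).
    generalize (Rmin_l (d / b) 1) (Rmin_r (d / b) 1). lra. }
  assert (AB : Rabs B1 <= b /\ Rabs B2 <= b).
  { split; apply sq_le_abs; try lra; generalize (pow2_ge_0 B1) (pow2_ge_0 B2); lra. }
  assert (Seg : forall t, 0 < t <= t0 -> let X := B1 + t * - B1 in let Y := B2 + t * - B2 in
    pdisc b X Y /\ X ^ 2 + Y ^ 2 = (1 - t) ^ 2 * b ^ 2 /\ Rabs (X - B1) < d /\ Rabs (Y - B2) < d).
  { intros t Ht X Y. assert (E : X ^ 2 + Y ^ 2 = (1 - t) ^ 2 * b ^ 2) by (rewrite <- HB; unfold X, Y; ring).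
    assert (W : forall z, Rabs z <= b -> Rabs (z + t * - z - z) < d).
    { intros z Hz. replace (z + t * - z - z) with (t * - z) by ring. rewrite Rabs_mult, Rabs_Ropp, (Rabs_pos_eq t) by lra.
      apply Rle_lt_trans with (t * b); [apply Rmult_le_compat_l; lra|].
      apply Rlt_le_trans with (d / b * b); [apply Rmult_lt_compat_r; lra|]. right. field. lra. }
    split; [|split; [exact E|split; apply W; apply AB]].
    unfold pdisc. rewrite E. split; [apply Rmult_lt_0_compat; nra|].
    assert ((1 - t) ^ 2 < 1) by nra. assert (b2 : 0 < b ^ 2) by (apply pow_lt; exact hb).
    set (z := (1 - t) ^ 2) in *. clearbody z. nra. }
  assert (Line : forall t, 0 < t < t0 -> let X := B1 + t * - B1 in let Y := B2 + t * - B2 in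
    pdisc b X Y /\ m <= p X Y * - B1 + q X Y * - B2 /\ Rabs (o1 X Y * - B1 + o2 X Y * - B2) <= L).
  { intros t Ht X Y. destruct (Seg t ltac:(lra)) as [P [_ [A1 A2]]]. split; [exact P|].
    destruct (K X Y P A1 A2) as [C1 C2]. split; [lra|].
    replace (o1 X Y * - B1 + o2 X Y * - B2) with (- (o1 X Y * B1 + o2 X Y * B2)) by ring. now rewrite Rabs_Ropp. }
  (* The transversal runs from C_b, where u tends to 0, to a point of level e, so it meets every
     level in (0, e). *)
  set (e := u (B1 + t0 / 2 * - B1) (B2 + t0 / 2 * - B2)).
  assert (e0 : 0 < e) by (apply (vs_pos H), Line; lra).
  exists e, (L / m). split; [exact e0|].
  split; [apply Rmult_le_pos; [exact HL|left; now apply Rinv_0_lt_compat]|].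
  assert (Rep : forall x1 y1, pdisc b x1 y1 -> u x1 y1 < e -> exists t, 0 < t < t0 /\
    u (B1 + t * - B1) (B2 + t * - B2) = u x1 y1).
  { intros x1 y1 P1 L1. assert (U1 := vs_pos H x1 y1 P1).
    destruct (vs_boundary H (u x1 y1) U1) as [r [Hr Kr]].
    set (t1 := Rmin (t0 / 2) ((b - r) / b) / 2).
    assert (br : 0 < (b - r) / b) by (apply Rdiv_lt_0_compat; lra).
    assert (Ht1 : 0 < t1 < t0 / 2 /\ t1 < (b - r) / b).
    { unfold t1. assert (0 < Rmin (t0 / 2) ((b - r) / b)) by (apply Rmin_pos; lra).
      generalize (Rmin_l (t0 / 2) ((b - r) / b)) (Rmin_r (t0 / 2) ((b - r) / b)). lra. }
    assert (Lo : u (B1 + t1 * - B1) (B2 + t1 * - B2) < u x1 y1).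
    { destruct (Seg t1 ltac:(lra)) as [P [E _]]. apply Kr; [exact P|]. rewrite E.
      rewrite <- Rpow_mult_distr.
      assert (t1 * b < b - r).
      { apply Rlt_le_trans with ((b - r) / b * b); [apply Rmult_lt_compat_r; lra|]. right. field. lra. }
      assert (Lz : r < (1 - t1) * b) by lra. set (z := (1 - t1) * b) in *. clearbody z. nra. }
    destruct (line_ivt B1 B2 (- B1) (- B2) t1 (t0 / 2) (u x1 y1)) as [t [Ht E]]; [lra| |fold e; lra|].
    { intros t Ht. apply Line. lra. }
    exists t. split; [lra|exact E]. }
  intros x1 y1 x2 y2 P1 P2 L1 L2.
  destruct (Rep x1 y1 P1 L1) as [t1 [Ht1 E1]]. destruct (Rep x2 y2 P2 L2) as [t2 [Ht2 E2]].
  rewrite <- E1, <- E2.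
  rewrite (om_function_of_u x1 y1 (B1 + t1 * - B1) (B2 + t1 * - B2)), (om_function_of_u x2 y2 (B1 + t2 * - B1) (B2 + t2 * - B2));
    try assumption; try (symmetry; assumption); try (apply Line; lra).
  now apply (om_lipschitz_on_line B1 B2 (- B1) (- B2) 0 t0 m L).
Qed.

End Levels.

(** * Behaviour at the outer circle *)

(** Boundary values are limits from inside: the stream function and the derivatives of v are only
    controlled in the open punctured disc. *)
Definition bd_lim (b : R) (f : R -> R -> R) (x y l : R) : Prop :=
  forall e, 0 < e -> exists d, 0 < d /\ forall x' y', pdisc b x' y' ->
    Rabs (x' - x) < d -> Rabs (y' - y) < d -> Rabs (f x' y' - l) < e.

(* [(p, q)] is the gradient of the stream function, that is [v = (-q, p)]; [pi] and
   [qi] are the partial derivatives of [p] and [q], and [(o1, o2)] is the gradient of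
   the vorticity [p1 + q2]. *)
Record flow (b : R) (p q p1 p2 q1 q2 o1 o2 : R -> R -> R) : Prop := {
  fl_b : 0 < b;
  fl_grad_p : has_grad (pdisc b) p p1 p2;
  fl_grad_q : has_grad (pdisc b) q q1 q2;
  fl_curl : forall x y, pdisc b x y -> p2 x y = q1 x y;
  fl_grad_om : has_grad (pdisc b) (fun x y => p1 x y + q2 x y) o1 o2;
  fl_transport : forall x y, pdisc b x y -> p x y * o2 x y = q x y * o1 x y;
  fl_nocrit : forall x y, pdisc b x y -> p x y <> 0 \/ q x y <> 0;
  fl_lim : forall x y, x ^ 2 + y ^ 2 = b ^ 2 -> forall f, f = p \/ f = q \/ f = p1 \/ f = p2 \/
    f = q1 \/ f = q2 \/ f = o1 \/ f = o2 -> exists l, bd_lim b f x y l;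
  fl_tangent : forall x y lp lq, x ^ 2 + y ^ 2 = b ^ 2 -> bd_lim b p x y lp -> bd_lim b q x y lq ->
    - y * lp + x * lq = 0;
  fl_nonstag : exists x y lp lq, x ^ 2 + y ^ 2 = b ^ 2 /\ bd_lim b p x y lp /\ bd_lim b q x y lq /\
    (lp <> 0 \/ lq <> 0)
}.

Arguments fl_b {_ _ _ _ _ _ _ _ _}.
Arguments fl_grad_p {_ _ _ _ _ _ _ _ _}.
Arguments fl_grad_q {_ _ _ _ _ _ _ _ _}.
Arguments fl_curl {_ _ _ _ _ _ _ _ _}.
Arguments fl_grad_om {_ _ _ _ _ _ _ _ _}.
Arguments fl_transport {_ _ _ _ _ _ _ _ _}.
Arguments fl_nocrit {_ _ _ _ _ _ _ _ _}.
Arguments fl_lim {_ _ _ _ _ _ _ _ _}.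
Arguments fl_tangent {_ _ _ _ _ _ _ _ _}.
Arguments fl_nonstag {_ _ _ _ _ _ _ _ _}.

Lemma pdisc_shrink b x y s : 0 < b -> x ^ 2 + y ^ 2 = b ^ 2 -> 0 < s < 1 ->
  pdisc b ((1 - s) * x) ((1 - s) * y) /\ ((1 - s) * x) ^ 2 + ((1 - s) * y) ^ 2 = ((1 - s) * b) ^ 2.
Proof.
  intros hb E Hs. assert (Q : ((1 - s) * x) ^ 2 + ((1 - s) * y) ^ 2 = ((1 - s) * b) ^ 2).
  { rewrite !Rpow_mult_distr, <- E. ring. }
  split; [|exact Q]. unfold pdisc. rewrite Q.
  assert (0 < (1 - s) * b < b) by nra. set (z := (1 - s) * b) in *. clearbody z. nra.
Qed.

Lemma circle_abs b x y : 0 < b -> x ^ 2 + y ^ 2 = b ^ 2 -> Rabs x <= b /\ Rabs y <= b.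
Proof.
  intros hb E. split; apply sq_le_abs; try lra; generalize (pow2_ge_0 x) (pow2_ge_0 y); lra.
Qed.

Lemma shrink_near b x y s d : 0 < b -> x ^ 2 + y ^ 2 = b ^ 2 -> 0 < s < 1 -> s * b < d ->
  Rabs ((1 - s) * x - x) < d /\ Rabs ((1 - s) * y - y) < d.
Proof.
  intros hb E Hs Hd. destruct (circle_abs b x y hb E) as [A1 A2].
  assert (W : forall z, Rabs z <= b -> Rabs ((1 - s) * z - z) < d).
  { intros z Hz. replace ((1 - s) * z - z) with (- (s * z)) by ring.
    rewrite Rabs_Ropp, Rabs_mult, (Rabs_pos_eq s) by lra.
    apply Rle_lt_trans with (s * b); [apply Rmult_le_compat_l; lra|exact Hd]. }
  now split; apply W.
Qed.

Lemma bd_lim_approach b f x y l e : 0 < b -> x ^ 2 + y ^ 2 = b ^ 2 -> bd_lim b f x y l -> 0 < e ->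
  exists s0, 0 < s0 < 1 /\ forall s, 0 < s < s0 -> Rabs (f ((1 - s) * x) ((1 - s) * y) - l) < e.
Proof.
  intros hb E L He. destruct (L e He) as [d [Hd K]].
  assert (db : 0 < d / b) by (apply Rdiv_lt_0_compat; lra).
  assert (M0 : 0 < Rmin (d / b) 1) by (apply Rmin_pos; lra).
  assert (M1 := Rmin_l (d / b) 1). assert (M2 := Rmin_r (d / b) 1).
  exists (Rmin (d / b) 1 / 2). split; [lra|]. intros s Hs.
  assert (sb : s * b < d).
  { apply Rlt_le_trans with (d / b * b); [apply Rmult_lt_compat_r; lra|]. right. field. lra. }
  destruct (shrink_near b x y s d hb E ltac:(lra) sb) as [A1 A2].
  apply K; [|exact A1|exact A2]. apply pdisc_shrink; lra.
Qed.

Lemma bd_lim_unique b f x y l l' : 0 < b -> x ^ 2 + y ^ 2 = b ^ 2 ->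
  bd_lim b f x y l -> bd_lim b f x y l' -> l = l'.
Proof.
  intros hb E L L'. apply NNPP. intros N.
  assert (P : 0 < Rabs (l - l') / 2). { assert (0 < Rabs (l - l')) by (apply Rabs_pos_lt; lra). lra. }
  destruct (bd_lim_approach b f x y l _ hb E L P) as [s [Hs K]].
  destruct (bd_lim_approach b f x y l' _ hb E L' P) as [s' [Hs' K']].
  assert (M0 : 0 < Rmin s s') by (apply Rmin_pos; lra).
  assert (M1 := Rmin_l s s'). assert (M2 := Rmin_r s s').
  specialize (K (Rmin s s' / 2) ltac:(lra)). specialize (K' (Rmin s s' / 2) ltac:(lra)).
  set (z := f _ _) in *. rewrite Rabs_minus_sym in K.
  generalize (Rabs_triang (l - z) (z - l')). replace (l - z + (z - l')) with (l - l') by ring. lra.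
Qed.

Lemma bd_lim_linear b f g x y lf lg k1 k2 : bd_lim b f x y lf -> bd_lim b g x y lg ->
  bd_lim b (fun x y => k1 * f x y + k2 * g x y) x y (k1 * lf + k2 * lg).
Proof.
  intros Lf Lg e He. set (A := Rabs k1 + Rabs k2 + 1).
  assert (P1 := Rabs_pos k1). assert (P2 := Rabs_pos k2).
  assert (eA : 0 < e / A) by (apply Rdiv_lt_0_compat; unfold A; lra).
  destruct (Lf _ eA) as [d1 [Hd1 K1]]. destruct (Lg _ eA) as [d2 [Hd2 K2]].
  exists (Rmin d1 d2). split; [now apply Rmin_pos|].
  assert (M1 := Rmin_l d1 d2). assert (M2 := Rmin_r d1 d2). intros x' y' P Hx Hy.
  specialize (K1 x' y' P ltac:(lra) ltac:(lra)). specialize (K2 x' y' P ltac:(lra) ltac:(lra)).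
  replace (k1 * f x' y' + k2 * g x' y' - (k1 * lf + k2 * lg)) with
    (k1 * (f x' y' - lf) + k2 * (g x' y' - lg)) by ring.
  eapply Rle_lt_trans; [apply Rabs_triang|]. rewrite !Rabs_mult.
  apply Rle_lt_trans with (Rabs k1 * (e / A) + Rabs k2 * (e / A)).
  - apply Rplus_le_compat; apply Rmult_le_compat_l; lra.
  - replace e with (A * (e / A)) at 3 by (field; unfold A; lra). unfold A at 3. lra.
Qed.

(* By compactness of [C_b]; [n] stands for a bound that may depend on the boundary point. *)
Lemma collar b (Q : nat -> R -> R -> Prop) : 0 < b ->
  (forall x y, x ^ 2 + y ^ 2 = b ^ 2 -> exists d N, 0 < d /\ forall n x' y', (N <= n)%nat -> pdisc b x' y' ->
     Rabs (x' - x) < d -> Rabs (y' - y) < d -> Q n x' y') ->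
  exists r N, 0 < r < b /\ forall x y, pdisc b x y -> r ^ 2 < x ^ 2 + y ^ 2 -> Q N x y.
Proof.
  intros hb HQ. apply NNPP. intros NN.
  set (r := fun n : nat => b - b / INR (S (S n))).
  assert (Hr : forall n, 0 < r n < b).
  { intros n. unfold r. assert (1 < INR (S (S n))).
    { rewrite S_INR. generalize (lt_0_INR (S n) (Nat.lt_0_succ n)). lra. }
    assert (0 < b / INR (S (S n))) by (apply Rdiv_lt_0_compat; lra).
    assert (b / INR (S (S n)) < b); [|lra]. apply Rlt_div_l; nra. }
  assert (K : forall n, exists z : R * R, (pdisc b (fst z) (snd z) /\ (r n) ^ 2 < fst z ^ 2 + snd z ^ 2) /\ ~ Q n (fst z) (snd z)).
  { intros n. apply NNPP. intros NZ. apply NN. exists (r n), n. split; [apply Hr|].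
    intros x y P L. apply NNPP. intros NQ. apply NZ. exists (x, y). exact (conj (conj P L) NQ). }
  set (z := fun n => proj1_sig (constructive_indefinite_description _ (K n))).
  assert (Hz : forall n, (pdisc b (fst (z n)) (snd (z n)) /\ (r n) ^ 2 < fst (z n) ^ 2 + snd (z n) ^ 2) /\ ~ Q n (fst (z n)) (snd (z n))).
  { intros n. unfold z. apply (proj2_sig (constructive_indefinite_description _ (K n))). }
  assert (Ab : forall n, Rabs (fst (z n)) <= b /\ Rabs (snd (z n)) <= b).
  { intros n. destruct (Hz n) as [[[_ P] _] _]. generalize (pow2_ge_0 (fst (z n))) (pow2_ge_0 (snd (z n))). intros.
    split; apply sq_le_abs; lra. }
  destruct (cluster_point_2d (fun n => fst (z n)) (fun n => snd (z n)) b (fun n => proj1 (Ab n)) (fun n => proj2 (Ab n)))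
    as [X [Y HXY]].
  assert (E : X ^ 2 + Y ^ 2 = b ^ 2).
  { apply Rle_antisym.
    - apply Rnot_lt_le. intros L. destruct (box_sq_ge b X Y hb L) as [d [Hd Kd]].
      destruct (HXY d Hd 0%nat) as [n [_ [A1 A2]]]. destruct (Hz n) as [[[_ P] _] _].
      generalize (Kd _ _ A1 A2). lra.
    - apply Rnot_lt_le. intros L.
      set (k := sqrt (X ^ 2 + Y ^ 2)).
      assert (k2 : k ^ 2 = X ^ 2 + Y ^ 2) by (apply pow2_sqrt; generalize (pow2_ge_0 X) (pow2_ge_0 Y); lra).
      assert (k0 := sqrt_pos (X ^ 2 + Y ^ 2)). fold k in k0.
      assert (kb : k < b) by nra.
      assert (C : continuity_2d_pt (fun u v => (u - 0) ^ 2 + (v - 0) ^ 2) X Y) by apply continuity_2d_sqdist.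
      set (c := (k + b) / 2). assert (Hc : k < c < b) by (unfold c; lra).
      destruct (cont2_eps _ X Y (c ^ 2 - k ^ 2) C ltac:(nra)) as [d [Hd Kd]].
      assert (cb : 0 < (b - c) / b) by (apply Rdiv_lt_0_compat; lra).
      destruct (archimed_cor1 ((b - c) / b) cb) as [N [HN N0]].
      destruct (HXY d Hd N) as [n [Hn [A1 A2]]]. destruct (Hz n) as [[P L'] _].
      assert (T := Kd _ _ A1 A2). cbv beta in T. rewrite !Rminus_0_r, <- k2 in T. apply Rabs_def2 in T.
      assert (/ INR (S (S n)) <= / INR N).
      { apply Rinv_le_contravar; [now apply lt_0_INR|apply le_INR; lia]. }
      assert (b * / INR (S (S n)) < b * ((b - c) / b)) by (apply Rmult_lt_compat_l; lra).
      replace (b * ((b - c) / b)) with (b - c) in H0 by (field; lra).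
      assert (c < r n) by (unfold r, Rdiv at 1; lra).
      assert (c ^ 2 < r n ^ 2) by (generalize (Hr n); nra). lra. }
  destruct (HQ X Y E) as [d [N [Hd Kd]]].
  destruct (HXY d Hd N) as [n [Hn [A1 A2]]]. destruct (Hz n) as [[P _] NQ].
  apply NQ. now apply Kd.
Qed.

Section Slope.

Variables (b : R) (u p q p1 p2 q1 q2 o1 o2 : R -> R -> R).
Hypothesis F : flow b p q p1 p2 q1 q2 o1 o2.
Hypothesis Gu : has_grad (pdisc b) u p q.
Hypothesis Hpos : forall x y, pdisc b x y -> 0 < u x y.
Hypothesis Hbd : forall e, 0 < e -> exists r, 0 < r < b /\
    forall x y, pdisc b x y -> r ^ 2 < x ^ 2 + y ^ 2 -> u x y < e.
Hypothesis Horigin : forall x y, pdisc b x y -> exists r, 0 < r /\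
    forall x' y', pdisc b x' y' -> x' ^ 2 + y' ^ 2 < r ^ 2 -> u x y < u x' y'.

Let hb := fl_b F.

Let om x y := p1 x y + q2 x y.

Lemma flow_vorticity_setting : vorticity_setting b u p q om o1 o2.
Proof.
  split; try assumption.
  - exists p1, p2, q1, q2. split; [apply F|]. split; [apply F|]. exact (fl_curl F).
  - apply F.
  - apply F.
  - apply F.
Qed.

Lemma bd_lim_u x y : x ^ 2 + y ^ 2 = b ^ 2 -> bd_lim b u x y 0.
Proof.
  intros E e He. destruct (Hbd e He) as [r [Hr K]].
  destruct (box_sq_ge r x y) as [d [Hd K']]; [lra|nra|].
  exists d. split; [exact Hd|]. intros x' y' P Hx Hy. rewrite Rminus_0_r, Rabs_pos_eq.
  - apply K; [exact P|now apply K'].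
  - left. now apply Hpos.
Qed.

(** Since u is not defined on C_b by its gradient, the mean value theorem is applied between depths
    t < s, with t so small that u and t (x lp + y lq) are negligible compared to e s. *)
Lemma radial_taylor x y lp lq e : x ^ 2 + y ^ 2 = b ^ 2 -> bd_lim b p x y lp -> bd_lim b q x y lq -> 0 < e ->
  exists s0, 0 < s0 < 1 /\ forall s, 0 < s < s0 ->
    Rabs (u ((1 - s) * x) ((1 - s) * y) + s * (x * lp + y * lq)) <= e * s.
Proof.
  intros E Lp Lq He. set (k := x * lp + y * lq).
  destruct (bd_lim_approach b _ x y _ (e / 2) hb E (bd_lim_linear b p q x y lp lq x y Lp Lq) ltac:(lra)) as [s0 [Hs0 K]].
  exists s0. split; [exact Hs0|]. intros s Hs. fold k in K. cbv beta in K.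
  set (phi := fun s => u ((1 - s) * x) ((1 - s) * y)). fold (phi s).
  assert (dphi : forall t, 0 < t < s0 -> is_derive phi t
    (p ((1 - t) * x) ((1 - t) * y) * (- x) + q ((1 - t) * x) ((1 - t) * y) * (- y))).
  { intros t Ht. apply (has_grad_comp (pdisc b) u p q (fun t => (1 - t) * x) (fun t => (1 - t) * y));
      [apply open2_pdisc|exact Gu|apply pdisc_shrink; lra| |]; auto_derive; try easy; ring. }
  set (eta := e * s / 4). assert (eta0 : 0 < eta) by (unfold eta; nra).
  destruct (bd_lim_approach b u x y 0 eta hb E (bd_lim_u x y E) eta0) as [s1 [Hs1 K1]].
  set (t := Rmin (Rmin s s1) (eta / (Rabs k + 1)) / 2).
  assert (Pk := Rabs_pos k).
  assert (ek : 0 < eta / (Rabs k + 1)) by (apply Rdiv_lt_0_compat; lra).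
  assert (Ht : 0 < t < s /\ t < s1 /\ t < eta / (Rabs k + 1)).
  { unfold t. assert (0 < Rmin (Rmin s s1) (eta / (Rabs k + 1))) by (repeat apply Rmin_pos; lra).
    generalize (Rmin_l (Rmin s s1) (eta / (Rabs k + 1))) (Rmin_r (Rmin s s1) (eta / (Rabs k + 1)))
      (Rmin_l s s1) (Rmin_r s s1). lra. }
  assert (K1t := K1 t ltac:(lra)). rewrite Rminus_0_r in K1t. fold (phi t) in K1t.
  destruct (mvt_derive phi _ t s ltac:(lra) (fun z Hz => dphi z ltac:(lra))) as [c [Hc Ec]]. cbv beta in Ec.
  assert (Kc := K c ltac:(lra)). set (g := x * p ((1 - c) * x) ((1 - c) * y) + y * q ((1 - c) * x) ((1 - c) * y)) in *.
  assert (B1 : Rabs ((k - g) * (s - t)) <= e / 2 * s).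
  { rewrite Rabs_mult, (Rabs_pos_eq (s - t)), Rabs_minus_sym by lra.
    apply Rmult_le_compat; try lra. apply Rabs_pos. }
  assert (B2 : Rabs (t * k) <= eta).
  { rewrite Rabs_mult, (Rabs_pos_eq t) by lra.
    apply Rle_trans with (eta / (Rabs k + 1) * (Rabs k + 1)); [apply Rmult_le_compat; lra|right; field; lra]. }
  replace (phi s + s * k) with ((k - g) * (s - t) + (t * k + phi t)).
  - eapply Rle_trans; [apply Rabs_triang|]. generalize (Rabs_triang (t * k) (phi t)). unfold eta in *. nra.
  - unfold g. replace (phi s) with (phi t + (phi s - phi t)) by ring. rewrite Ec. ring.
Qed.

Lemma radial_slope_le x y lp lq : x ^ 2 + y ^ 2 = b ^ 2 -> bd_lim b p x y lp -> bd_lim b q x y lq ->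
  x * lp + y * lq <= 0.
Proof.
  intros E Lp Lq. apply Rnot_lt_le. intros L.
  destruct (radial_taylor x y lp lq ((x * lp + y * lq) / 2) E Lp Lq ltac:(lra)) as [s0 [Hs0 K]].
  specialize (K (s0 / 2) ltac:(lra)). apply Rabs_le_between in K.
  assert (P := Hpos _ _ (proj1 (pdisc_shrink b x y (s0 / 2) hb E ltac:(lra)))). nra.
Qed.

Lemma boundary_gradient x y lp lq : x ^ 2 + y ^ 2 = b ^ 2 -> bd_lim b p x y lp -> bd_lim b q x y lq ->
  let V := (x * lp + y * lq) / b ^ 2 in lp = V * x /\ lq = V * y /\ V <= 0.
Proof.
  intros E Lp Lq V. assert (T := fl_tangent F x y lp lq E Lp Lq).
  assert (b2 : 0 < b ^ 2) by (apply pow_lt, hb).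
  split; [|split].
  - apply Rmult_eq_reg_l with (b ^ 2); [|lra]. unfold V.
    replace (b ^ 2 * ((x * lp + y * lq) / b ^ 2 * x)) with (x ^ 2 * lp + y * (x * lq)) by (field; lra).
    rewrite <- E. replace (x * lq) with (y * lp) by lra. ring.
  - apply Rmult_eq_reg_l with (b ^ 2); [|lra]. unfold V.
    replace (b ^ 2 * ((x * lp + y * lq) / b ^ 2 * y)) with (x * (y * lp) + y ^ 2 * lq) by (field; lra).
    rewrite <- E. replace (y * lp) with (x * lq) by lra. ring.
  - assert (R := radial_slope_le x y lp lq E Lp Lq). unfold V.
    apply Rmult_le_reg_r with (b ^ 2); [lra|].
    replace ((x * lp + y * lq) / b ^ 2 * b ^ 2) with (x * lp + y * lq) by (field; lra). lra.
Qed.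

(** At a non-stagnation point the gradient is strictly inward, so the radius is a transversal
    reaching the level 0. As om depends on u alone, the estimate obtained there holds at all points
    of low level, including those near stagnation points; w is the vorticity of C_b. *)
Lemma boundary_vorticity : exists w eta C, 0 < eta /\ 0 <= C /\
  forall x y, pdisc b x y -> u x y < eta -> Rabs (om x y - w) <= C * u x y.
Proof.
  destruct (fl_nonstag F) as [B1 [B2 [lp [lq [E [Lp [Lq N]]]]]]].
  destruct (boundary_gradient B1 B2 lp lq E Lp Lq) as [E1 [E2 V0]].
  set (V := (B1 * lp + B2 * lq) / b ^ 2) in *.
  assert (b2 : 0 < b ^ 2) by (apply pow_lt, hb).
  assert (Vn : V < 0).
  { destruct V0 as [V0|V0]; [exact V0|]. rewrite V0 in E1, E2. rewrite E1, E2 in N. lra. }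
  assert (k : B1 * lp + B2 * lq = V * b ^ 2) by (rewrite <- E, E1, E2; ring).
  set (m := - V * b ^ 2 / 2). assert (m0 : 0 < m) by (unfold m; nra).
  destruct (fl_lim F B1 B2 E o1) as [l1 L1]; [tauto|].
  destruct (fl_lim F B1 B2 E o2) as [l2 L2]; [tauto|].
  destruct (bd_lim_linear b p q B1 B2 lp lq B1 B2 Lp Lq m m0) as [d1 [Hd1 K1]].
  destruct (bd_lim_linear b o1 o2 B1 B2 l1 l2 B1 B2 L1 L2 1 ltac:(lra)) as [d2 [Hd2 K2]].
  destruct (om_lipschitz_at_boundary b u p q om o1 o2 flow_vorticity_setting B1 B2 m
    (Rabs (B1 * l1 + B2 * l2) + 1) (Rmin d1 d2) E m0) as [eta [C [He [HC K]]]].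
  { generalize (Rabs_pos (B1 * l1 + B2 * l2)). lra. }
  { now apply Rmin_pos. }
  { assert (M1 := Rmin_l d1 d2). assert (M2 := Rmin_r d1 d2). intros x y P Hx Hy.
    specialize (K1 x y P ltac:(lra) ltac:(lra)). specialize (K2 x y P ltac:(lra) ltac:(lra)).
    cbv beta in K1, K2. split.
    - apply Rabs_def2 in K1. unfold m in *. lra.
    - generalize (Rabs_triang_inv (B1 * o1 x y + B2 * o2 x y) (B1 * l1 + B2 * l2)).
      replace (o1 x y * B1 + o2 x y * B2) with (B1 * o1 x y + B2 * o2 x y) by ring. lra. }
  destruct (fl_lim F B1 B2 E p1) as [w1 W1]; [tauto|].
  destruct (fl_lim F B1 B2 E q2) as [w2 W2]; [tauto|].
  exists (1 * w1 + 1 * w2), eta, C. split; [exact He|]. split; [exact HC|].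
  assert (W := bd_lim_linear b p1 q2 B1 B2 w1 w2 1 1 W1 W2). set (w := 1 * w1 + 1 * w2) in *.
  intros x y P Ux. apply Rnot_lt_le. intros L.
  (* The excess over the bound is shared out in C + 1 parts: g for the distance of om to w and C g
     for the value of u, at a point of the radius ending at the non-stagnation point. *)
  set (g := (Rabs (om x y - w) - C * u x y) / (C + 1)).
  assert (g0 : 0 < g) by (apply Rdiv_lt_0_compat; lra).
  set (g' := Rmin g eta). assert (g0' : 0 < g') by (apply Rmin_pos; lra).
  destruct (bd_lim_approach b _ B1 B2 w g hb E W g0) as [s1 [Hs1 J1]].
  destruct (bd_lim_approach b u B1 B2 0 g' hb E (bd_lim_u B1 B2 E) g0') as [s2 [Hs2 J2]].
  assert (M0 : 0 < Rmin s1 s2) by (apply Rmin_pos; lra).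
  assert (M1 := Rmin_l s1 s2). assert (M2 := Rmin_r s1 s2).
  set (s := Rmin s1 s2 / 2).
  specialize (J1 s ltac:(unfold s; lra)). specialize (J2 s ltac:(unfold s; lra)).
  assert (Ps := proj1 (pdisc_shrink b B1 B2 s hb E ltac:(unfold s; lra))).
  set (X := (1 - s) * B1) in *. set (Y := (1 - s) * B2) in *.
  rewrite !Rmult_1_l in J1. fold (om X Y) in J1. rewrite Rminus_0_r in J2.
  assert (UX := Hpos X Y Ps). rewrite Rabs_pos_eq in J2 by lra.
  assert (G1 := Rmin_l g eta). assert (G2 := Rmin_r g eta). fold g' in G1, G2.
  assert (Q := K x y X Y P Ps Ux ltac:(lra)).
  assert (T : Rabs (om x y - w) <= Rabs (om x y - om X Y) + Rabs (om X Y - w)).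
  { replace (om x y - w) with (om x y - om X Y + (om X Y - w)) by ring. apply Rabs_triang. }
  assert (D0 : Rabs (u x y - u X Y) <= u x y + u X Y).
  { assert (Upos := Hpos x y P). apply Rabs_le. lra. }
  assert (C * Rabs (u x y - u X Y) <= C * (u x y + g)) by (apply Rmult_le_compat_l; lra).
  assert (gE : g * (C + 1) = Rabs (om x y - w) - C * u x y) by (unfold g; field; lra).
  nra.
Qed.

(* Boundary version of Hopf's lemma: [u] is a supersolution near [C_b] when the
   vorticity of [C_b] is nonpositive. *)
Lemma slope_nonzero x y w eta C : x ^ 2 + y ^ 2 = b ^ 2 -> w <= 0 -> 0 < eta -> 0 <= C ->
  (forall x y, pdisc b x y -> u x y < eta -> Rabs (om x y - w) <= C * u x y) ->
  bd_lim b p x y 0 -> bd_lim b q x y 0 -> False.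
Proof.
  intros E Hw He HC K Lp Lq.
  destruct (Hbd eta He) as [r [Hr Kr]].
  (* The disc of radius rho touching C_b from inside at (x, y) lies in the collar |z| > r, where u <
     eta. The Laplacian of u is there at most w + C u <= C u. *)
  set (rho := (b - r) / 2). assert (Hrho : 0 < rho < b) by (unfold rho; lra).
  set (la := 1 - rho / b).
  assert (rb : 0 < rho / b < 1).
  { split; [apply Rdiv_lt_0_compat; lra|]. apply Rlt_div_l; lra. }
  assert (Sub : forall X Y, disc (la * x) (la * y) rho X Y -> pdisc b X Y /\ u X Y < eta).
  { intros X Y D0. unfold disc in D0.
    set (sc := (x * X + y * Y) / b).
    assert (CS : sc ^ 2 <= X ^ 2 + Y ^ 2).
    { unfold sc. replace (((x * X + y * Y) / b) ^ 2) with ((x * X + y * Y) ^ 2 / b ^ 2) by (field; lra).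
      apply Rle_div_l; [apply pow_lt, hb|]. rewrite <- E. 
      generalize (pow2_ge_0 (x * Y - y * X)). nra. }
    assert (Ex : (X - la * x) ^ 2 + (Y - la * y) ^ 2 = X ^ 2 + Y ^ 2 - 2 * (la * b) * sc + (la * b) ^ 2).
    { unfold sc. replace (X ^ 2 + Y ^ 2 - 2 * (la * b) * ((x * X + y * Y) / b) + (la * b) ^ 2) with
        (X ^ 2 + Y ^ 2 - 2 * la * (x * X + y * Y) + la ^ 2 * b ^ 2) by (field; lra). rewrite <- E. ring. }
    assert (lab : la * b = b - rho) by (unfold la; field; lra). rewrite lab in Ex.
    set (N := sqrt (X ^ 2 + Y ^ 2)).
    assert (N2 : N ^ 2 = X ^ 2 + Y ^ 2) by (apply pow2_sqrt; generalize (pow2_ge_0 X) (pow2_ge_0 Y); lra).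
    assert (N0 : 0 <= N) by apply sqrt_pos.
    assert (scN : sc <= N) by nra.
    assert (Dn : (N - (b - rho)) ^ 2 < rho ^ 2) by nra.
    assert (HN : b - 2 * rho < N < b) by nra.
    assert (PX : pdisc b X Y) by (unfold pdisc; rewrite <- N2; unfold rho in *; nra).
    split; [exact PX|]. apply Kr; [exact PX|]. rewrite <- N2. unfold rho in *. nra. }
  assert (HL : has_lap (disc (la * x) (la * y) rho) u p q p1 q2).
  { intros X Y D0. destruct (Sub X Y D0) as [P _].
    destruct (Gu X Y P) as [A1 [A2 _]]. destruct (fl_grad_p F X Y P) as [A3 _].
    destruct (fl_grad_q F X Y P) as [_ [A4 _]]. exact (conj A1 (conj A3 (conj A2 A4))). }
  destruct (hopf u p q p1 q2 (la * x) (la * y) rho C ltac:(lra) HC HL) as [k [k0 Hk]].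
  { intros X Y D0. destruct (Sub X Y D0) as [P U]. split; [now apply Hpos|]. split.
    - eapply has_grad_continuous; [apply open2_pdisc|exact Gu|exact P].
    - assert (T := K X Y P U). apply Rabs_le_between in T. unfold om in T. lra. }
  assert (n1 : (x / b) ^ 2 + (y / b) ^ 2 = 1).
  { replace ((x / b) ^ 2 + (y / b) ^ 2) with ((x ^ 2 + y ^ 2) / b ^ 2) by (field; lra). rewrite E. field. lra. }
  (* At the point (1 - s) (x, y) with s = t rho / b, Hopf's lemma gives u >= k t = 2 e s, whereas a
     vanishing gradient gives u <= e s. *)
  set (e := k * b / rho / 2).
  assert (e0 : 0 < e). { unfold e. assert (0 < k * b / rho) by (apply Rdiv_lt_0_compat; nra). lra. }
  destruct (radial_taylor x y 0 0 e E Lp Lq e0) as [s0 [Hs0 T]].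
  set (t := s0 / 2).
  assert (Ht : 0 < t < 1 /\ t * (rho / b) < s0) by (unfold t; nra).
  specialize (Hk (x / b) (y / b) t n1 ltac:(lra)).
  specialize (T (t * (rho / b)) ltac:(nra)).
  assert (EX : forall z, la * z + (1 - t) * rho * (z / b) = (1 - t * (rho / b)) * z) by (intros; unfold la; field; lra).
  rewrite !EX in Hk. rewrite !Rmult_0_r, Rplus_0_l, Rmult_0_r, Rplus_0_r in T.
  apply Rabs_le_between in T.
  assert (e * (t * (rho / b)) = k * t / 2) by (unfold e; field; lra). nra.
Qed.

Lemma convex_pdisc x y x' y' t : pdisc b x y -> pdisc b x' y' -> 0 <= t <= 1 ->
  (x + t * (x' - x)) ^ 2 + (y + t * (y' - y)) ^ 2 < b ^ 2.
Proof.
  intros [_ P] [_ P'] Ht.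
  assert (0 <= t * (1 - t) * (x' - x) ^ 2) by (apply Rmult_le_pos; [nra|apply pow2_ge_0]).
  assert (0 <= t * (1 - t) * (y' - y) ^ 2) by (apply Rmult_le_pos; [nra|apply pow2_ge_0]).
  assert (I : (x + t * (x' - x)) ^ 2 + (y + t * (y' - y)) ^ 2 <= (1 - t) * (x ^ 2 + y ^ 2) + t * (x' ^ 2 + y' ^ 2)) by nra.
  destruct (Req_dec t 0) as [->|N0]; [lra|].
  assert (t * (x' ^ 2 + y' ^ 2) < t * b ^ 2) by (apply Rmult_lt_compat_l; lra).
  assert ((1 - t) * (x ^ 2 + y ^ 2) <= (1 - t) * b ^ 2) by (apply Rmult_le_compat_l; lra). lra.
Qed.

(* First-order expansion along [C_b], by the mean value theorem on interior chords. *)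
Lemma chord_taylor f f1 f2 x y l l1 l2 e : has_grad (pdisc b) f f1 f2 -> x ^ 2 + y ^ 2 = b ^ 2 ->
  bd_lim b f x y l -> bd_lim b f1 x y l1 -> bd_lim b f2 x y l2 -> 0 < e ->
  exists d, 0 < d /\ forall x' y' l', x' ^ 2 + y' ^ 2 = b ^ 2 -> Rabs (x' - x) < d -> Rabs (y' - y) < d ->
    bd_lim b f x' y' l' -> Rabs (l' - l - (l1 * (x' - x) + l2 * (y' - y))) <= e * (Rabs (x' - x) + Rabs (y' - y)).
Proof.
  intros Gf E L L1 L2 He.
  destruct (L1 e He) as [d1 [Hd1 K1]]. destruct (L2 e He) as [d2 [Hd2 K2]].
  destruct (box_sq_ge (b / 2) x y) as [d3 [Hd3 K3]]; [lra|nra|].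
  set (d := Rmin (Rmin d1 d2) d3).
  assert (Ld : d <= d1 /\ d <= d2 /\ d <= d3).
  { unfold d. generalize (Rmin_l (Rmin d1 d2) d3) (Rmin_r (Rmin d1 d2) d3) (Rmin_l d1 d2) (Rmin_r d1 d2). lra. }
  assert (d0 : 0 < d) by (unfold d; repeat apply Rmin_pos; lra).
  exists (d / 2). split; [lra|]. intros x' y' l' E' Hx Hy L'.
  set (S0 := Rabs (x' - x) + Rabs (y' - y)).
  set (R0 := l' - l - (l1 * (x' - x) + l2 * (y' - y))).
  set (k := Rabs (l1 * (x' - x) + l2 * (y' - y))).
  apply Rnot_lt_le. intros Lt.
  set (g := (Rabs R0 - e * S0) / 4). assert (g0 : 0 < g) by (unfold g; lra).
  destruct (bd_lim_approach b f x y l g hb E L g0) as [s1 [Hs1 J1]].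
  destruct (bd_lim_approach b f x' y' l' g hb E' L' g0) as [s2 [Hs2 J2]].
  assert (Pk : 0 <= k) by apply Rabs_pos.
  assert (gk : 0 < g / (k + 1)) by (apply Rdiv_lt_0_compat; lra).
  assert (db : 0 < d / 2 / b) by (apply Rdiv_lt_0_compat; lra).
  set (M := Rmin (Rmin s1 s2) (Rmin (g / (k + 1)) (d / 2 / b))).
  assert (M0 : 0 < M) by (unfold M; repeat apply Rmin_pos; lra).
  assert (LM : M <= s1 /\ M <= s2 /\ M <= g / (k + 1) /\ M <= d / 2 / b).
  { unfold M. generalize (Rmin_l (Rmin s1 s2) (Rmin (g / (k + 1)) (d / 2 / b)))
      (Rmin_r (Rmin s1 s2) (Rmin (g / (k + 1)) (d / 2 / b))) (Rmin_l s1 s2) (Rmin_r s1 s2)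
      (Rmin_l (g / (k + 1)) (d / 2 / b)) (Rmin_r (g / (k + 1)) (d / 2 / b)). lra. }
  set (s := M / 2). assert (Hs : 0 < s < M) by (unfold s; lra).
  specialize (J1 s ltac:(lra)). specialize (J2 s ltac:(lra)).
  assert (sb : s * b < d / 2).
  { apply Rlt_le_trans with (d / 2 / b * b); [apply Rmult_lt_compat_r; lra|right; field; lra]. }
  destruct (shrink_near b x y s (d / 2) hb E ltac:(lra) sb) as [A1 A2].
  destruct (shrink_near b x' y' s (d / 2) hb E' ltac:(lra) sb) as [A1' A2'].
  destruct (pdisc_shrink b x y s hb E ltac:(lra)) as [P _].
  destruct (pdisc_shrink b x' y' s hb E' ltac:(lra)) as [P' _].
  set (X := (1 - s) * x) in *. set (Y := (1 - s) * y) in *.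
  set (X' := (1 - s) * x') in *. set (Y' := (1 - s) * y') in *.
  assert (Near : forall t, 0 <= t <= 1 -> pdisc b (X + t * (X' - X)) (Y + t * (Y' - Y)) /\
    Rabs (X + t * (X' - X) - x) < d /\ Rabs (Y + t * (Y' - Y) - y) < d).
  { intros t Ht.
    assert (W : forall z z' c c', Rabs (z - c) < d / 2 -> Rabs (z' - c') < d / 2 -> Rabs (c' - c) < d / 2 ->
      Rabs (z + t * (z' - z) - c) < d).
    { intros z z' c c' W1 W2 W3. apply Rabs_def2 in W1. apply Rabs_def2 in W2. apply Rabs_def2 in W3.
      replace (z + t * (z' - z) - c) with ((1 - t) * (z - c) + t * (z' - c)) by ring.
      apply Rabs_def1; nra. }
    assert (N1 := W X X' x x' A1 A1' Hx). assert (N2 := W Y Y' y y' A2 A2' Hy).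
    split; [|split; assumption]. split.
    - assert (Q := K3 _ _ (Rlt_le_trans _ _ _ N1 (proj2 (proj2 Ld))) (Rlt_le_trans _ _ _ N2 (proj2 (proj2 Ld)))). nra.
    - now apply convex_pdisc. }
  destruct (mvt_derive (fun t => f (X + t * (X' - X)) (Y + t * (Y' - Y)))
    (fun t => f1 (X + t * (X' - X)) (Y + t * (Y' - Y)) * (X' - X) + f2 (X + t * (X' - X)) (Y + t * (Y' - Y)) * (Y' - Y)) 0 1)
    as [t [Ht Et]]; [lra| |].
  { intros t Ht. apply (has_grad_comp (pdisc b) f f1 f2 (fun t => X + t * (X' - X)) (fun t => Y + t * (Y' - Y)));
      [apply open2_pdisc|exact Gf|now apply Near|apply line_derive..]. }
  cbv beta in Et. destruct (Near t ltac:(lra)) as [Pt [N1 N2]].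
  replace (X + 1 * (X' - X)) with X' in Et by ring. replace (Y + 1 * (Y' - Y)) with Y' in Et by ring.
  replace (X + 0 * (X' - X)) with X in Et by ring. replace (Y + 0 * (Y' - Y)) with Y in Et by ring.
  assert (B1 := K1 _ _ Pt ltac:(lra) ltac:(lra)). assert (B2 := K2 _ _ Pt ltac:(lra) ltac:(lra)).
  set (F1 := f1 _ _) in *. set (F2 := f2 _ _) in *.
  assert (EX : X' - X = (1 - s) * (x' - x)) by (unfold X, X'; ring).
  assert (EY : Y' - Y = (1 - s) * (y' - y)) by (unfold Y, Y'; ring).
  rewrite EX, EY in Et.
  assert (ER : R0 = (l' - f X' Y') + (f X Y - l) + (1 - s) * ((F1 - l1) * (x' - x) + (F2 - l2) * (y' - y))
    + (- s) * (l1 * (x' - x) + l2 * (y' - y))) by (unfold R0; lra).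
  assert (T3 : Rabs ((1 - s) * ((F1 - l1) * (x' - x) + (F2 - l2) * (y' - y))) <= e * S0).
  { rewrite Rabs_mult, (Rabs_pos_eq (1 - s)) by lra.
    assert (Q : Rabs ((F1 - l1) * (x' - x) + (F2 - l2) * (y' - y)) <= e * S0).
    { eapply Rle_trans; [apply Rabs_triang|]. rewrite !Rabs_mult. unfold S0.
      rewrite Rmult_plus_distr_l.
      apply Rplus_le_compat; apply Rmult_le_compat_r; try apply Rabs_pos; lra. }
    generalize (Rabs_pos ((F1 - l1) * (x' - x) + (F2 - l2) * (y' - y))). nra. }
  assert (T4 : Rabs (- s * (l1 * (x' - x) + l2 * (y' - y))) <= g).
  { rewrite Rabs_mult, Rabs_Ropp, (Rabs_pos_eq s) by lra. fold k.
    apply Rle_trans with (g / (k + 1) * (k + 1)); [apply Rmult_le_compat; lra|right; field; lra]. }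
  assert (TT : Rabs R0 <= g + g + e * S0 + g).
  { rewrite ER. eapply Rle_trans; [apply Rabs_triang|]. apply Rplus_le_compat; [|exact T4].
    eapply Rle_trans; [apply Rabs_triang|]. apply Rplus_le_compat; [|exact T3].
    eapply Rle_trans; [apply Rabs_triang|]. rewrite Rabs_minus_sym in J2. lra. }
  unfold g in *. lra.
Qed.


(* If the gradient vanishes at a boundary point, the Hessian there kills the
   tangent: the gradient stays radial and inward along [C_b]. *)
Lemma boundary_hessian x y h11 h12 h21 h22 : x ^ 2 + y ^ 2 = b ^ 2 ->
  bd_lim b p x y 0 -> bd_lim b q x y 0 -> bd_lim b p1 x y h11 -> bd_lim b p2 x y h12 ->
  bd_lim b q1 x y h21 -> bd_lim b q2 x y h22 ->
  - y * h11 + x * h12 = 0 /\ - y * h21 + x * h22 = 0.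
Proof.
  intros E Lp Lq L11 L12 L21 L22.
  destruct (circle_abs b x y hb E) as [Ax Ay].
  assert (b2 : 0 < b ^ 2) by (apply pow_lt, hb).
  set (a1 := - y * h11 + x * h12). set (a2 := - y * h21 + x * h22).
  set (g1 := x * h11 + y * h12). set (g2 := x * h21 + y * h22).
  (* A and B are the components, along (x, y) and (-y, x), of the Hessian applied to the tangent
     (-y, x). The terms k1 and k2 will come with the factor c - 1 = O(s^2). *)
  set (A := x * a1 + y * a2). set (B := - y * a1 + x * a2).
  set (k1 := x * g1 + y * g2). set (k2 := - y * g1 + x * g2).
  assert (Pk1 := Rabs_pos k1). assert (Pk2 := Rabs_pos k2).
  (* Expansion of the gradient at the point of angle [arcsin s] from [(x, y)]. *)
  assert (Exp : forall e, 0 < e -> exists s0, 0 < s0 /\ forall s, s <> 0 -> Rabs s < s0 ->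
    exists V c r1 r2, V <= 0 /\ 1 / 2 <= c <= 1 /\ 1 - c <= s ^ 2 /\ Rabs r1 <= e * Rabs s /\ Rabs r2 <= e * Rabs s /\
      V * b ^ 2 * c = (c - 1) * k1 + s * A + r1 /\ V * b ^ 2 * s = (c - 1) * k2 + s * B + r2).
  { intros e He. set (e' := e / (8 * b ^ 2)).
    assert (e'0 : 0 < e') by (apply Rdiv_lt_0_compat; lra).
    destruct (chord_taylor p p1 p2 x y 0 h11 h12 e' (fl_grad_p F) E Lp L11 L12 e'0) as [d1 [Hd1 K1]].
    destruct (chord_taylor q q1 q2 x y 0 h21 h22 e' (fl_grad_q F) E Lq L21 L22 e'0) as [d2 [Hd2 K2]].
    assert (D0 : 0 < Rmin d1 d2 / (2 * b)) by (apply Rdiv_lt_0_compat; [now apply Rmin_pos|lra]).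
    assert (M1 := Rmin_l d1 d2). assert (M2 := Rmin_r d1 d2).
    exists (Rmin (1 / 2) (Rmin d1 d2 / (2 * b))). split; [apply Rmin_pos; lra|].
    assert (M3 := Rmin_l (1 / 2) (Rmin d1 d2 / (2 * b))). assert (M4 := Rmin_r (1 / 2) (Rmin d1 d2 / (2 * b))).
    intros s Ns Hs. set (c := sqrt (1 - s ^ 2)).
    assert (s12 : s ^ 2 < 1 / 4).
    { rewrite <- (pow2_abs s). generalize (Rabs_pos s). nra. }
    assert (c2 : c ^ 2 = 1 - s ^ 2) by (apply pow2_sqrt; lra).
    assert (c0 : 0 <= c) by apply sqrt_pos.
    assert (s2 := pow2_ge_0 s).
    assert (Hc : 1 / 2 <= c <= 1) by nra.
    assert (c1 : 1 - c <= s ^ 2) by nra.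
    assert (c1' : 1 - c <= Rabs s).
    { rewrite <- (pow2_abs s) in c1. generalize (Rabs_pos s). nra. }
    set (x' := c * x - s * y). set (y' := s * x + c * y).
    assert (E' : x' ^ 2 + y' ^ 2 = b ^ 2).
    { unfold x', y'. replace ((c * x - s * y) ^ 2 + (s * x + c * y) ^ 2) with ((c ^ 2 + s ^ 2) * (x ^ 2 + y ^ 2)) by ring.
      rewrite c2, E. ring. }
    assert (W : forall z t, Rabs z <= b -> Rabs t <= b -> Rabs ((c - 1) * z + s * t) <= 2 * b * Rabs s).
    { intros z t Hz Ht. eapply Rle_trans; [apply Rabs_triang|]. rewrite !Rabs_mult.
      rewrite (Rabs_left1 (c - 1)) by lra.
      assert (- (c - 1) * Rabs z <= Rabs s * b) by (apply Rmult_le_compat; try apply Rabs_pos; lra).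
      assert (Rabs s * Rabs t <= Rabs s * b) by (apply Rmult_le_compat_l; [apply Rabs_pos|lra]). lra. }
    assert (Bx : Rabs (x' - x) <= 2 * b * Rabs s).
    { replace (x' - x) with ((c - 1) * x + s * (- y)) by (unfold x'; ring). apply W; [exact Ax|now rewrite Rabs_Ropp]. }
    assert (By : Rabs (y' - y) <= 2 * b * Rabs s).
    { replace (y' - y) with ((c - 1) * y + s * x) by (unfold y'; ring). now apply W. }
    assert (Sm : 2 * b * Rabs s < Rmin d1 d2).
    { apply Rlt_le_trans with (2 * b * (Rmin d1 d2 / (2 * b))); [apply Rmult_lt_compat_l; lra|right; field; lra]. }
    destruct (fl_lim F x' y' E' p) as [lp Lp']; [tauto|].
    destruct (fl_lim F x' y' E' q) as [lq Lq']; [tauto|].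
    destruct (boundary_gradient x' y' lp lq E' Lp' Lq') as [Ep [Eq V0]].
    set (V := (x' * lp + y' * lq) / b ^ 2) in *.
    assert (T1 := K1 x' y' lp E' ltac:(lra) ltac:(lra) Lp').
    assert (T2 := K2 x' y' lq E' ltac:(lra) ltac:(lra) Lq').
    set (r1 := lp - 0 - (h11 * (x' - x) + h12 * (y' - y))) in *.
    set (r2 := lq - 0 - (h21 * (x' - x) + h22 * (y' - y))) in *.
    assert (Sb : e' * (Rabs (x' - x) + Rabs (y' - y)) <= e' * (4 * b * Rabs s)) by (apply Rmult_le_compat_l; lra).
    assert (Comb : forall z t, Rabs z <= b -> Rabs t <= b -> Rabs (z * r1 + t * r2) <= e * Rabs s).
    { intros z t Hz Ht. eapply Rle_trans; [apply Rabs_triang|]. rewrite !Rabs_mult.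
      assert (Rabs z * Rabs r1 <= b * (e' * (4 * b * Rabs s))) by (apply Rmult_le_compat; try apply Rabs_pos; lra).
      assert (Rabs t * Rabs r2 <= b * (e' * (4 * b * Rabs s))) by (apply Rmult_le_compat; try apply Rabs_pos; lra).
      assert (b * (e' * (4 * b * Rabs s)) = e * Rabs s / 2) by (unfold e'; field; lra). lra. }
    exists V, c, (x * r1 + y * r2), (- y * r1 + x * r2).
    split; [exact V0|]. split; [exact Hc|]. split; [exact c1|].
    split; [now apply Comb|]. split; [apply Comb; [now rewrite Rabs_Ropp|exact Ax]|].
    unfold r1, r2. rewrite Ep, Eq. split.
    - transitivity (V * (x * x' + y * y')).
      + unfold x', y'. rewrite <- E. ring.
      + unfold k1, A, g1, g2, a1, a2, x', y'. ring.
    - transitivity (V * (- y * x' + x * y')).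
      + unfold x', y'. rewrite <- E. ring.
      + unfold k2, B, g1, g2, a1, a2, x', y'. ring. }
  (* With s of the sign of A, V b^2 c = s A + o(s) would be positive, against V <= 0. *)
  assert (A0 : A = 0).
  { apply NNPP. intros N. assert (PA : 0 < Rabs A) by now apply Rabs_pos_lt.
    destruct (Exp (Rabs A / 4) ltac:(lra)) as [s0 [Hs0 K]].
    set (t := Rmin s0 (Rabs A / 4 / (Rabs k1 + 1)) / 2).
    assert (kA : 0 < Rabs A / 4 / (Rabs k1 + 1)) by (apply Rdiv_lt_0_compat; lra).
    assert (Ht : 0 < t < s0 /\ t < Rabs A / 4 / (Rabs k1 + 1)).
    { unfold t. assert (0 < Rmin s0 (Rabs A / 4 / (Rabs k1 + 1))) by (apply Rmin_pos; lra).
      generalize (Rmin_l s0 (Rabs A / 4 / (Rabs k1 + 1))) (Rmin_r s0 (Rabs A / 4 / (Rabs k1 + 1))). lra. }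
    assert (tk : t * (Rabs k1 + 1) < Rabs A / 4).
    { apply Rlt_le_trans with (Rabs A / 4 / (Rabs k1 + 1) * (Rabs k1 + 1)); [apply Rmult_lt_compat_r; lra|right; field; lra]. }
    assert (Sg : exists s, Rabs s = t /\ s * A = t * Rabs A).
    { destruct (Rle_lt_dec 0 A).
      - exists t. split; [apply Rabs_pos_eq; lra|]. rewrite (Rabs_pos_eq A) by lra. ring.
      - exists (- t). split; [rewrite Rabs_Ropp; apply Rabs_pos_eq; lra|]. rewrite (Rabs_left A) by lra. ring. }
    destruct Sg as [s [Es EA]].
    destruct (K s) as [V [c [r1 [r2 [V0 [Hc [c1 [R1 [_ [E1 _]]]]]]]]]].
    { intros ->. rewrite Rabs_R0 in Es. lra. }
    { lra. }
    rewrite Es in R1. rewrite EA in E1. apply Rabs_le_between in R1.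
    rewrite <- (pow2_abs s), Es in c1.
    assert (Q : - (t ^ 2 * Rabs k1) <= (c - 1) * k1).
    { assert (Rabs ((c - 1) * k1) <= t ^ 2 * Rabs k1).
      { rewrite Rabs_mult, (Rabs_left1 (c - 1)) by lra. apply Rmult_le_compat_r; lra. }
      generalize (Rabs_le_between ((c - 1) * k1) (t ^ 2 * Rabs k1)). intros [I _]. specialize (I H). lra. }
    assert (V * b ^ 2 * c <= 0) by (assert (V * b ^ 2 <= 0) by nra; nra).
    assert (t * (t * Rabs k1) <= t * (Rabs A / 4)) by (apply Rmult_le_compat_l; lra).
    assert (0 < t * Rabs A) by (apply Rmult_lt_0_compat; lra). lra. }
  (* Once A = 0, the radial equation gives V b^2 = o(s); the tangential equation then reads s B =
     o(s). *)
  assert (B0 : B = 0).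
  { apply NNPP. intros N. assert (PB : 0 < Rabs B) by now apply Rabs_pos_lt.
    destruct (Exp (Rabs B / 4) ltac:(lra)) as [s0 [Hs0 K]].
    set (k := 2 * Rabs k1 + Rabs B + Rabs k2 + 1).
    assert (k0 : 0 < k) by (unfold k; lra).
    assert (kB : 0 < Rabs B / 4 / k) by (apply Rdiv_lt_0_compat; lra).
    set (t := Rmin (Rmin s0 (1 / 2)) (Rabs B / 4 / k) / 2).
    assert (Ht : 0 < t < s0 /\ t < 1 / 2 /\ t < Rabs B / 4 / k).
    { unfold t. assert (0 < Rmin (Rmin s0 (1 / 2)) (Rabs B / 4 / k)) by (repeat apply Rmin_pos; lra).
      generalize (Rmin_l (Rmin s0 (1 / 2)) (Rabs B / 4 / k)) (Rmin_r (Rmin s0 (1 / 2)) (Rabs B / 4 / k))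
        (Rmin_l s0 (1 / 2)) (Rmin_r s0 (1 / 2)). lra. }
    assert (tk : t * k < Rabs B / 4).
    { apply Rlt_le_trans with (Rabs B / 4 / k * k); [apply Rmult_lt_compat_r; lra|right; field; lra]. }
    destruct (K t) as [V [c [r1 [r2 [V0 [Hc [c1 [R1 [R2 [E1 E2]]]]]]]]]]; [lra|rewrite Rabs_pos_eq; lra|].
    rewrite A0, Rmult_0_r, Rplus_0_r in E1. rewrite (Rabs_pos_eq t) in R1, R2 by lra.
    assert (Qc : forall k, Rabs ((c - 1) * k) <= t ^ 2 * Rabs k).
    { intros k'. rewrite Rabs_mult, (Rabs_left1 (c - 1)) by lra. apply Rmult_le_compat_r; [apply Rabs_pos|lra]. }
    assert (VB : Rabs (V * b ^ 2 * c) <= t ^ 2 * Rabs k1 + Rabs B / 4 * t).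
    { rewrite E1. eapply Rle_trans; [apply Rabs_triang|]. generalize (Qc k1). lra. }
    rewrite Rabs_mult, (Rabs_pos_eq c) in VB by lra.
    assert (PV := Rabs_pos (V * b ^ 2)).
    assert (VB' : Rabs (V * b ^ 2) <= 2 * (t ^ 2 * Rabs k1 + Rabs B / 4 * t)) by nra.
    assert (EB : t * B = V * b ^ 2 * t - (c - 1) * k2 - r2) by lra.
    assert (TB : t * Rabs B <= Rabs (V * b ^ 2) * t + t ^ 2 * Rabs k2 + Rabs B / 4 * t).
    { rewrite <- (Rabs_pos_eq t) at 1 by lra. rewrite <- Rabs_mult, EB.
      unfold Rminus at 1. eapply Rle_trans; [apply Rabs_triang|]. rewrite Rabs_Ropp.
      apply Rplus_le_compat; [|exact R2].
      unfold Rminus at 1. eapply Rle_trans; [apply Rabs_triang|]. rewrite Rabs_Ropp.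
      apply Rplus_le_compat; [rewrite Rabs_mult, (Rabs_pos_eq t) by lra; lra|apply Qc]. }
    assert (T1 : Rabs (V * b ^ 2) <= t * (2 * Rabs k1 + Rabs B)).
    { assert (t2 : t ^ 2 <= t) by (clear - Ht; nra).
      assert (t ^ 2 * Rabs k1 <= t * Rabs k1) by (apply Rmult_le_compat_r; lra).
      assert (0 < t * Rabs B) by (apply Rmult_lt_0_compat; lra). lra. }
    assert (T2 : Rabs B <= Rabs (V * b ^ 2) + t * Rabs k2 + Rabs B / 4).
    { apply Rmult_le_reg_l with t; [lra|]. lra. }
    unfold k in tk. lra. }
  assert (R1 : b ^ 2 * a1 = x * A - y * B) by (rewrite <- E; unfold A, B; ring).
  assert (R2 : b ^ 2 * a2 = y * A + x * B) by (rewrite <- E; unfold A, B; ring).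
  rewrite A0, B0 in R1, R2.
  split; [change (a1 = 0)|change (a2 = 0)]; apply Rmult_eq_reg_l with (b ^ 2); lra.
Qed.

(** At a non-stagnation point this is continuity of the gradient. At a stagnation point, w > 0 by
    [slope_nonzero], and the Hessian, which kills the tangent and has trace w, is w times the
    projection on (x, y). Hence e . grad u increases strictly in the direction e = (e1, e2); it is
    nonpositive where this line leaves the disc, so it is negative before. *)
Lemma boundary_slope x y e1 e2 : x ^ 2 + y ^ 2 = b ^ 2 -> 0 < e1 * x + e2 * y -> exists d, 0 < d /\
    forall x' y', pdisc b x' y' -> Rabs (x' - x) < d -> Rabs (y' - y) < d ->
      e1 * p x' y' + e2 * q x' y' < 0.
Proof.
  intros E He. assert (b2 : 0 < b ^ 2) by (apply pow_lt, hb).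
  destruct (fl_lim F x y E p) as [lp Lp]; [tauto|].
  destruct (fl_lim F x y E q) as [lq Lq]; [tauto|].
  destruct (boundary_gradient x y lp lq E Lp Lq) as [Ep [Eq V0]].
  set (V := (x * lp + y * lq) / b ^ 2) in *. clearbody V.
  destruct V0 as [Vn|V0].
  { assert (Ln := bd_lim_linear b p q x y lp lq e1 e2 Lp Lq).
    assert (Neg : e1 * lp + e2 * lq < 0).
    { rewrite Ep, Eq. replace (e1 * (V * x) + e2 * (V * y)) with (V * (e1 * x + e2 * y)) by ring. nra. }
    destruct (Ln (- (e1 * lp + e2 * lq)) ltac:(lra)) as [d [Hd K]]. exists d. split; [exact Hd|].
    intros x' y' P Hx Hy. specialize (K x' y' P Hx Hy). apply Rabs_def2 in K. lra. }
  rewrite V0, Rmult_0_l in Ep, Eq. subst lp lq. clear V V0.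
  destruct boundary_vorticity as [w [eta [C [Heta [HC Kw]]]]].
  destruct (Rle_lt_dec w 0) as [W|W].
  { destruct (slope_nonzero x y w eta C E W Heta HC Kw Lp Lq). }
  destruct (fl_lim F x y E p1) as [h11 L11]; [tauto|].
  destruct (fl_lim F x y E p2) as [h12 L12]; [tauto|].
  destruct (fl_lim F x y E q1) as [h21 L21]; [tauto|].
  destruct (fl_lim F x y E q2) as [h22 L22]; [tauto|].
  destruct (boundary_hessian x y h11 h12 h21 h22 E Lp Lq L11 L12 L21 L22) as [Z1 Z2].
  assert (Sym : h12 = h21).
  { apply (bd_lim_unique b p2 x y h12 h21 hb E L12). intros e He'. destruct (L21 e He') as [d [Hd K]].
    exists d. split; [exact Hd|]. intros x' y' P Hx Hy. rewrite (fl_curl F x' y' P). now apply K. }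
  assert (Tr : h11 + h22 = w).
  { assert (Lo := bd_lim_linear b p1 q2 x y h11 h22 1 1 L11 L22). rewrite !Rmult_1_l in Lo.
    apply (bd_lim_unique b _ x y _ w hb E Lo). intros e He'.
    assert (eC : 0 < Rmin eta (e / (C + 1))) by (apply Rmin_pos; [exact Heta|apply Rdiv_lt_0_compat; lra]).
    destruct (bd_lim_u x y E _ eC) as [d [Hd K]]. exists d. split; [exact Hd|].
    intros x' y' P Hx Hy. rewrite !Rmult_1_l. fold (om x' y').
    assert (Ku := K x' y' P Hx Hy). assert (U := Hpos x' y' P). rewrite Rminus_0_r, Rabs_pos_eq in Ku by lra.
    assert (M1 := Rmin_l eta (e / (C + 1))). assert (M2 := Rmin_r eta (e / (C + 1))).
    eapply Rle_lt_trans; [apply Kw; [exact P|lra]|].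
    apply Rle_lt_trans with ((C + 1) * u x' y'); [nra|].
    apply Rlt_le_trans with ((C + 1) * (e / (C + 1))); [apply Rmult_lt_compat_l; lra|right; field; lra]. }
  rewrite <- Sym in *. clear Sym.
  assert (H11 : b ^ 2 * h11 = w * x ^ 2).
  { rewrite <- E, <- Tr. assert (x * (x * h22) = y * (y * h11)).
    { replace (x * h22) with (y * h12) by lra. replace (y * h11) with (x * h12) by lra. ring. } lra. }
  assert (H22 : b ^ 2 * h22 = w * y ^ 2).
  { rewrite <- E, <- Tr. assert (x * (x * h22) = y * (y * h11)).
    { replace (x * h22) with (y * h12) by lra. replace (y * h11) with (x * h12) by lra. ring. } lra. }
  assert (H12 : b ^ 2 * h12 = w * (x * y)).
  { rewrite <- E, <- Tr. assert (x * h12 = y * h11) by lra. assert (y * h12 = x * h22) by lra.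
    replace ((x ^ 2 + y ^ 2) * h12) with (x * (x * h12) + y * (y * h12)) by ring. rewrite H, H0. ring. }
  set (L := e1 * (e1 * h11 + e2 * h12) + e2 * (e1 * h12 + e2 * h22)).
  assert (LE : b ^ 2 * L = w * (e1 * x + e2 * y) ^ 2).
  { unfold L. replace (b ^ 2 * (e1 * (e1 * h11 + e2 * h12) + e2 * (e1 * h12 + e2 * h22))) with
      (e1 ^ 2 * (b ^ 2 * h11) + 2 * e1 * e2 * (b ^ 2 * h12) + e2 ^ 2 * (b ^ 2 * h22)) by ring.
    rewrite H11, H12, H22. ring. }
  assert (L0 : 0 < L).
  { apply Rmult_lt_reg_l with (b ^ 2); [exact b2|]. rewrite LE, Rmult_0_r.
    apply Rmult_lt_0_compat; [exact W|now apply pow_lt]. }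
  assert (Lim := bd_lim_linear b _ _ x y _ _ e1 e2 (bd_lim_linear b p1 p2 x y h11 h12 e1 e2 L11 L12)
    (bd_lim_linear b q1 q2 x y h12 h22 e1 e2 L21 L22)). fold L in Lim.
  destruct (Lim (L / 2) ltac:(lra)) as [d1 [Hd1 K1]].
  destruct (box_sq_ge (b / 2) x y) as [d2 [Hd2 K2]]; [lra|nra|].
  set (d := Rmin d1 d2). assert (d0 : 0 < d) by now apply Rmin_pos.
  assert (M1 : d <= d1) by apply Rmin_l. assert (M2 : d <= d2) by apply Rmin_r.
  set (k := Rabs e1 + Rabs e2 + 1).
  assert (PE1 := Rabs_pos e1). assert (PE2 := Rabs_pos e2).
  assert (k0 : 0 < k) by (unfold k; lra).
  (* For times up to t1 the line of direction (e1, e2) stays within d of (x, y); d4 is then chosen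
     so that the line leaves the disc before t1. *)
  set (t1 := d / 2 / k). assert (t10 : 0 < t1) by (apply Rdiv_lt_0_compat; lra).
  assert (tk : t1 * k = d / 2) by (unfold t1; field; lra).
  set (c0 := e1 * x + e2 * y) in *.
  assert (Ce : continuity_2d_pt (fun X Y => e1 * X + e2 * Y) x y) by apply continuity_2d_linear.
  destruct (cont2_eps _ x y (c0 / 2) Ce ltac:(lra)) as [d3 [Hd3 K3]].
  destruct (cont2_eps _ x y (c0 * t1) (continuity_2d_sqdist 0 0 x y) ltac:(now apply Rmult_lt_0_compat)) as [d4 [Hd4 K4]].
  exists (Rmin (d / 2) (Rmin d3 d4)). split; [repeat apply Rmin_pos; lra|].
  intros X Y P HX HY.
  assert (N1 := Rmin_l (d / 2) (Rmin d3 d4)). assert (N2 := Rmin_r (d / 2) (Rmin d3 d4)).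
  assert (N3 := Rmin_l d3 d4). assert (N4 := Rmin_r d3 d4).
  specialize (K3 X Y ltac:(lra) ltac:(lra)). cbv beta in K3. fold c0 in K3. apply Rabs_def2 in K3.
  specialize (K4 X Y ltac:(lra) ltac:(lra)). cbv beta in K4. rewrite !Rminus_0_r, E in K4. apply Rabs_def2 in K4.
  apply Rnot_le_lt. intros G0.
  set (c := e1 * X + e2 * Y) in *. set (n := e1 ^ 2 + e2 ^ 2).
  assert (n0 : 0 <= n) by (unfold n; generalize (pow2_ge_0 e1) (pow2_ge_0 e2); lra).
  set (N := fun t => (X + t * e1) ^ 2 + (Y + t * e2) ^ 2).
  assert (NE : forall t, N t = X ^ 2 + Y ^ 2 + t * (2 * c + t * n)) by (intros; unfold N, c, n; ring).
  destruct (Ranalysis5.IVT_interv (fun t => N t - b ^ 2) 0 t1) as [T [HT ET]].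
  { intros t _. apply derivable_continuous_pt. unfold N. auto_derive_fun (fun t : R => (X + t * e1) ^ 2 + (Y + t * e2) ^ 2 - b ^ 2).
    intros K0. eexists. apply is_derive_Reals. now apply K0. }
  { exact t10. }
  { rewrite NE. destruct P. lra. }
  { rewrite NE. assert (t1 * (2 * c + t1 * n) >= t1 * c0); [|nra]. apply Rle_ge, Rmult_le_compat_l; nra. }
  assert (T0 : 0 < T).
  { destruct (Req_dec T 0) as [Z|]; [|lra]. rewrite Z, NE in ET. destruct P. lra. }
  assert (Near : forall t, 0 <= t <= T -> Rabs (X + t * e1 - x) < d /\ Rabs (Y + t * e2 - y) < d).
  { assert (Wn : forall Z z e t, 0 <= t <= T -> Rabs (Z - z) < d / 2 -> Rabs e <= k - 1 -> Rabs (Z + t * e - z) < d).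
    { intros Z z e t Ht HZ Hek. replace (Z + t * e - z) with (Z - z + t * e) by ring.
      eapply Rle_lt_trans; [apply Rabs_triang|]. rewrite Rabs_mult, (Rabs_pos_eq t) by lra.
      assert (t * Rabs e <= t1 * k).
      { apply Rmult_le_compat; try lra. apply Rabs_pos. } lra. }
    intros t Ht. split; apply Wn; try assumption; try lra; unfold k; lra. }
  assert (In : forall t, 0 <= t < T -> pdisc b (X + t * e1) (Y + t * e2)).
  { intros t Ht. destruct (Near t ltac:(lra)) as [A1 A2].
    assert (Q := K2 _ _ (Rlt_le_trans _ _ _ A1 M2) (Rlt_le_trans _ _ _ A2 M2)). split; [nra|].
    fold (N t). assert (N t < N T); [|lra]. rewrite !NE.
    assert (t * (2 * c + t * n) < T * (2 * c + T * n)); [|lra].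
    assert (t * (2 * c) < T * (2 * c)) by (apply Rmult_lt_compat_r; lra).
    assert (t * t * n <= T * T * n) by (apply Rmult_le_compat_r; nra). lra. }
  set (g := fun t => e1 * p (X + t * e1) (Y + t * e2) + e2 * q (X + t * e1) (Y + t * e2)).
  (* From g 0 >= 0, the negation of the claim, g grows at rate at least L / 2 until the exit time
     T. *)
  assert (Inc : forall t, 0 < t < T -> t * (L / 2) <= g t).
  { intros t Ht. destruct (mvt_derive g
      (fun t => e1 * (p1 (X + t * e1) (Y + t * e2) * e1 + p2 (X + t * e1) (Y + t * e2) * e2)
        + e2 * (q1 (X + t * e1) (Y + t * e2) * e1 + q2 (X + t * e1) (Y + t * e2) * e2)) 0 t) as [z [Hz Ez]]; [lra| |].
    { intros s Hs. apply derive_plus; apply derive_scal.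
      - apply (has_grad_comp (pdisc b) p p1 p2 (fun t => X + t * e1) (fun t => Y + t * e2));
          [apply open2_pdisc|apply F|apply In; lra|apply line_derive..].
      - apply (has_grad_comp (pdisc b) q q1 q2 (fun t => X + t * e1) (fun t => Y + t * e2));
          [apply open2_pdisc|apply F|apply In; lra|apply line_derive..]. }
    assert (g00 : 0 <= g 0) by (unfold g; rewrite !Rmult_0_l, !Rplus_0_r; exact G0).
    destruct (Near z ltac:(lra)) as [A1 A2].
    assert (Q := K1 _ _ (In z ltac:(lra)) (Rlt_le_trans _ _ _ A1 M1) (Rlt_le_trans _ _ _ A2 M1)).
    cbv beta in Q. apply Rabs_def2 in Q.
    set (D := e1 * (p1 (X + z * e1) (Y + z * e2) * e1 + p2 (X + z * e1) (Y + z * e2) * e2)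
        + e2 * (q1 (X + z * e1) (Y + z * e2) * e1 + q2 (X + z * e1) (Y + z * e2) * e2)) in *.
    assert (L / 2 <= D) by (unfold D; lra). nra. }
  assert (EC : (X + T * e1) ^ 2 + (Y + T * e2) ^ 2 = b ^ 2) by (fold (N T); lra).
  destruct (fl_lim F _ _ EC p) as [lp Lp']; [tauto|].
  destruct (fl_lim F _ _ EC q) as [lq Lq']; [tauto|].
  destruct (boundary_gradient _ _ lp lq EC Lp' Lq') as [Ep [Eq V0]].
  set (V := ((X + T * e1) * lp + (Y + T * e2) * lq) / b ^ 2) in *. clearbody V.
  assert (Neg : e1 * lp + e2 * lq <= 0).
  { rewrite Ep, Eq. replace (e1 * (V * (X + T * e1)) + e2 * (V * (Y + T * e2))) with (V * (c + T * n)) by (unfold c, n; ring).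
    assert (0 <= c + T * n) by nra. nra. }
  (* Only a limit is available at the exit point. At time T - h >= T / 2 one has g >= T L / 4, but
     closeness to a nonpositive limit gives g < T L / 4. *)
  destruct (bd_lim_linear b p q _ _ lp lq e1 e2 Lp' Lq' (T * L / 4) ltac:(nra)) as [d5 [Hd5 K5]].
  set (h := Rmin (T / 2) (d5 / k)).
  assert (dk : 0 < d5 / k) by (apply Rdiv_lt_0_compat; lra).
  assert (Hh : 0 < h <= T / 2 /\ h <= d5 / k).
  { unfold h. generalize (Rmin_l (T / 2) (d5 / k)) (Rmin_r (T / 2) (d5 / k)).
    assert (0 < Rmin (T / 2) (d5 / k)) by (apply Rmin_pos; lra). lra. }
  assert (Wd : forall Z e, Rabs e <= k - 1 -> Rabs (Z + (T - h) * e - (Z + T * e)) < d5).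
  { intros Z e Hek. replace (Z + (T - h) * e - (Z + T * e)) with (- (h * e)) by ring.
    rewrite Rabs_Ropp, Rabs_mult, (Rabs_pos_eq h) by lra.
    apply Rle_lt_trans with (h * (k - 1)); [apply Rmult_le_compat_l; lra|].
    apply Rlt_le_trans with (d5 / k * k); [|right; field; lra].
    assert (h * (k - 1) < h * k) by (apply Rmult_lt_compat_l; lra).
    assert (h * k <= d5 / k * k) by (apply Rmult_le_compat_r; lra). lra. }
  assert (Q := K5 _ _ (In (T - h) ltac:(lra)) (Wd X e1 ltac:(unfold k; lra)) (Wd Y e2 ltac:(unfold k; lra))).
  cbv beta in Q. fold (g (T - h)) in Q. apply Rabs_def2 in Q.
  assert (I := Inc (T - h) ltac:(lra)).
  assert (T / 2 * (L / 2) <= (T - h) * (L / 2)) by (apply Rmult_le_compat_r; lra). lra.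
Qed.

Theorem flow_disc_setting : disc_setting b u p q p1 p2 q1 q2.
Proof.
  split; try assumption.
  - apply F.
  - apply F.
  - exact (om_locally_lipschitz b u p q om o1 o2 flow_vorticity_setting).
  - exact boundary_slope.
Qed.

End Slope.

(** * Behaviour at the origin *)

Lemma polar_coordinates x y r : 0 < r -> x ^ 2 + y ^ 2 = r ^ 2 ->
  exists t, 0 <= t <= 2 * PI /\ x = r * cos t /\ y = r * sin t.
Proof.
  intros Hr E. destruct (circle_abs r x y Hr E) as [Ax _]. apply Rabs_le_between in Ax.
  assert (B : -1 <= x / r <= 1) by (split; [apply Rle_div_r; lra|apply Rle_div_l; lra]).
  assert (S : r * sqrt (1 - Rsqr (x / r)) = Rabs y).
  { rewrite <- (sqrt_Rsqr_abs y), <- (sqrt_Rsqr r) at 1 by lra.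
    rewrite <- sqrt_mult_alt by apply Rle_0_sqr. f_equal. unfold Rsqr.
    replace (r * r * (1 - x / r * (x / r))) with (r ^ 2 - x ^ 2) by (field; lra). lra. }
  assert (AB := acos_bound (x / r)). assert (P := PI_RGT_0).
  destruct (Rle_lt_dec 0 y) as [L|L].
  - exists (acos (x / r)). split; [lra|]. rewrite cos_acos, sin_acos by exact B.
    split; [field; lra|]. rewrite S, Rabs_pos_eq; lra.
  - exists (- acos (x / r) + 2 * PI). split; [lra|].
    rewrite cos_plus, sin_plus, cos_2PI, sin_2PI, cos_neg, sin_neg, cos_acos, sin_acos by exact B.
    split; [field; lra|]. rewrite Rabs_left in S by lra. lra.
Qed.

(** The integrand is the absolute angular derivative of u; for the stream function of v it equals r
    |v . e_r|, so the oscillation is bounded by the flux integral. *)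
Lemma circle_oscillation b u p q r x y x' y' : has_grad (pdisc b) u p q -> 0 < r < b ->
  x ^ 2 + y ^ 2 = r ^ 2 -> x' ^ 2 + y' ^ 2 = r ^ 2 ->
  Rabs (u x y - u x' y') <= RInt (fun t => Rabs (r * cos t * q (r * cos t) (r * sin t)
    - r * sin t * p (r * cos t) (r * sin t))) 0 (2 * PI).
Proof.
  intros Gu Hr E E'.
  set (w := fun t => r * cos t * q (r * cos t) (r * sin t) - r * sin t * p (r * cos t) (r * sin t)).
  set (g := fun t => u (r * cos t) (r * sin t)).
  assert (P : forall t, pdisc b (r * cos t) (r * sin t)).
  { intros t. unfold pdisc. replace ((r * cos t) ^ 2 + (r * sin t) ^ 2) with (r ^ 2 * (Rsqr (sin t) + Rsqr (cos t)))
      by (unfold Rsqr; ring). rewrite sin2_cos2. nra. }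
  assert (dc : forall t, is_derive (fun t => r * cos t) t (- (r * sin t))).
  { intros t. auto_derive; [easy|ring]. }
  assert (ds : forall t, is_derive (fun t => r * sin t) t (r * cos t)).
  { intros t. auto_derive; [easy|ring]. }
  assert (dg : forall t, is_derive g t (w t)).
  { intros t. eapply is_derive_eq.
    - apply (has_grad_comp (pdisc b) u p q (fun t => r * cos t) (fun t => r * sin t));
        [apply open2_pdisc|exact Gu|apply P|apply dc|apply ds].
    - unfold w. ring. }
  assert (Cw : forall t, continuous (fun t => Rabs (w t)) t).
  { intros t. apply continuity_pt_continuous. apply (continuity_pt_comp w Rabs); [|apply Rcontinuity_abs].
    destruct (Gu _ _ (P t)) as [_ [_ [Cp Cq]]].
    assert (Cc := is_derive_continuity_pt _ _ _ (dc t)). assert (Cs := is_derive_continuity_pt _ _ _ (ds t)).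
    apply continuity_pt_minus; (apply continuity_pt_mult; [assumption|]).
    - now apply (continuity_2d_comp q (fun t => r * cos t) (fun t => r * sin t)).
    - now apply (continuity_2d_comp p (fun t => r * cos t) (fun t => r * sin t)). }
  assert (Ex : forall a c, ex_RInt (fun t => Rabs (w t)) a c).
  { intros a c. apply (ex_RInt_continuous (V := R_CompleteNormedModule)). intros t _. apply Cw. }
  set (I := fun t => RInt (fun t => Rabs (w t)) 0 t).
  assert (dI : forall t, is_derive I t (Rabs (w t))).
  { intros t. apply (is_derive_RInt (V := R_NormedModule) (fun t => Rabs (w t)) I 0); [|apply Cw].
    apply filter_forall. intros z. apply (RInt_correct (V := R_CompleteNormedModule)). apply Ex. }
  assert (Mono : forall a c, a <= c -> I a <= I c).
  { intros a c [L|<-]; [|lra]. apply (derive_le_increment I (fun t => Rabs (w t)) a c L); intros t _;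
      [apply dI|apply Rabs_pos]. }
  assert (Lip : forall a c, 0 <= a -> a <= c -> c <= 2 * PI -> Rabs (g a - g c) <= I (2 * PI)).
  { intros a c H1 [L|<-] H3.
    - assert (Q1 := derive_le_increment (fun t => I t - g t) _ a c L
        (fun t _ => derive_minus _ _ t _ _ (dI t) (dg t))).
      assert (Q2 := derive_le_increment (fun t => I t + g t) _ a c L
        (fun t _ => derive_plus _ _ t _ _ (dI t) (dg t))).
      cbv beta in Q1, Q2.
      assert (A1 : I a - g a <= I c - g c) by (apply Q1; intros t _; generalize (Rle_abs (w t)); lra).
      assert (A2 : I a + g a <= I c + g c).
      { apply Q2. intros t _. generalize (Rle_abs (- w t)). rewrite Rabs_Ropp. lra. }
      assert (Z : I 0 = 0) by apply (RInt_point (V := R_CompleteNormedModule)).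
      assert (M1 := Mono 0 a H1). assert (M2 := Mono c (2 * PI) H3).
      apply Rabs_le. lra.
    - rewrite Rminus_diag, Rabs_R0. assert (Z : I 0 = 0) by apply (RInt_point (V := R_CompleteNormedModule)).
      rewrite <- Z. apply Mono. lra. }
  destruct (polar_coordinates x y r ltac:(lra) E) as [t [Ht [-> ->]]].
  destruct (polar_coordinates x' y' r ltac:(lra) E') as [t' [Ht' [-> ->]]].
  change (Rabs (g t - g t') <= I (2 * PI)).
  destruct (Rle_lt_dec t t').
  - apply Lip; lra.
  - rewrite Rabs_minus_sym. apply Lip; lra.
Qed.

Section Origin.

Variables (b : R) (u p q : R -> R -> R).
Hypothesis Gu : has_grad (pdisc b) u p q.
Hypothesis nocrit : forall x y, pdisc b x y -> p x y <> 0 \/ q x y <> 0.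
Hypothesis Hbd : forall e, 0 < e -> exists r, 0 < r < b /\
  forall x y, pdisc b x y -> r ^ 2 < x ^ 2 + y ^ 2 -> Rabs (u x y) < e.
Hypothesis Hosc : forall e, 0 < e -> exists rho, 0 < rho /\ forall x y x' y', pdisc b x y ->
  x ^ 2 + y ^ 2 < rho ^ 2 -> x ^ 2 + y ^ 2 = x' ^ 2 + y' ^ 2 -> Rabs (u x y - u x' y') <= e.

Let cu x y : pdisc b x y -> continuity_2d_pt u x y.
Proof. intros P. eapply has_grad_continuous; [apply open2_pdisc|exact Gu|exact P]. Qed.

Lemma exists_larger x y : pdisc b x y -> exists x' y', pdisc b x' y' /\ u x y < u x' y'.
Proof.
  intros P. apply NNPP. intros N.
  apply (no_local_min b _ _ _ x y 1 (has_grad_opp _ _ _ _ Gu) P); [|lra|].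
  - destruct (nocrit x y P); [left|right]; lra.
  - intros x' y' _ _ P'. apply Ropp_le_contravar. apply Rnot_lt_le. intros L. apply N. now exists x', y'.
Qed.

Lemma exists_smaller x y : pdisc b x y -> exists x' y', pdisc b x' y' /\ u x' y' < u x y.
Proof.
  intros P. apply NNPP. intros N.
  apply (no_local_min b _ _ _ x y 1 Gu P); [now apply nocrit|lra|].
  intros x' y' _ _ P'. apply Rnot_lt_le. intros L. apply N. now exists x', y'.
Qed.

(* By the maximum principle outside [C_r]. *)
Lemma circle_reaches x y r : pdisc b x y -> 0 < u x y -> 0 < r -> r ^ 2 < x ^ 2 + y ^ 2 ->
  exists x' y', x' ^ 2 + y' ^ 2 = r ^ 2 /\ u x y <= u x' y'.
Proof.
  intros P U Hr L. apply NNPP. intros N.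
  assert (N' : forall x' y', x' ^ 2 + y' ^ 2 = r ^ 2 -> u x' y' < u x y).
  { intros x' y' E. apply Rnot_le_lt. intros L'. apply N. now exists x', y'. }
  destruct (Hbd _ U) as [r1 [Hr1 K1]].
  destruct (min_attained_annulus b r1 r
    (fun X Y => pdisc b X Y /\ r ^ 2 <= X ^ 2 + Y ^ 2 /\ u x y <= u X Y) (fun X Y => - u X Y) x y Hr1 Hr)
    as [X [Y [[PX [LX UX]] Hm]]].
  { intros X Y [PX [LX UX]]. split; [exact PX|]. split; [exact LX|]. apply Rnot_lt_le. intros Lt.
    generalize (K1 X Y PX Lt) (Rle_abs (u X Y)). lra. }
  { intros X Y PX NS. destruct (Rlt_le_dec (X ^ 2 + Y ^ 2) (r ^ 2)) as [L1|L1].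
    - destruct (open2_lt (fun X Y => (X - 0) ^ 2 + (Y - 0) ^ 2) (fun _ _ => r ^ 2)
        (continuity_2d_sqdist 0 0) (fun x y => continuity_2d_pt_const x y _) X Y) as [d Hd].
      { now rewrite !Rminus_0_r. }
      exists d. split; [apply cond_pos|]. intros X' Y' A1 A2 [_ [B _]]. specialize (Hd X' Y' A1 A2).
      rewrite !Rminus_0_r in Hd. lra.
    - destruct (Rlt_le_dec (u X Y) (u x y)) as [L2|L2]; [|now destruct NS].
      destruct (cont2_eps u X Y (u x y - u X Y) (cu X Y PX) ltac:(lra)) as [d [Hd K]].
      exists d. split; [exact Hd|]. intros X' Y' A1 A2 [_ [_ B]]. specialize (K X' Y' A1 A2).
      apply Rabs_def2 in K. lra. }
  { intros. now apply continuity_2d_pt_opp, cu. }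
  { split; [exact P|]. split; lra. }
  assert (Lr : r ^ 2 < X ^ 2 + Y ^ 2).
  { destruct LX as [LX|LX]; [exact LX|]. generalize (N' X Y (eq_sym LX)). lra. }
  destruct (box_sq_ge r X Y Hr Lr) as [d [Hd K]].
  apply (no_local_min b _ _ _ X Y d (has_grad_opp _ _ _ _ Gu) PX); [|exact Hd|].
  - destruct (nocrit X Y PX); [left|right]; lra.
  - intros X' Y' A1 A2 P'. apply Rnot_lt_le. intros Lt.
    assert (- u X Y <= - u X' Y'); [|lra]. apply Hm. split; [exact P'|]. split; [left; now apply K|lra].
Qed.

(** Without critical points, u takes a larger value at some (X, Y). Each smaller circle has a point
    where u is at least that value, and for small radii its oscillation is at most half the gap, so
    the whole circle is above u x y. *)
Lemma origin_of_positive x y : pdisc b x y -> 0 < u x y -> exists r, 0 < r /\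
  forall x' y', pdisc b x' y' -> x' ^ 2 + y' ^ 2 < r ^ 2 -> u x y < u x' y'.
Proof.
  intros P U. destruct (exists_larger x y P) as [X [Y [PX UX]]].
  destruct (Hosc ((u X Y - u x y) / 2) ltac:(lra)) as [rho [Hrho K]].
  set (N := sqrt (X ^ 2 + Y ^ 2)).
  assert (N0 : 0 < N) by (apply sqrt_lt_R0, PX).
  assert (N2 : N ^ 2 = X ^ 2 + Y ^ 2) by (apply pow2_sqrt; destruct PX; lra).
  exists (Rmin rho N). split; [apply Rmin_pos; lra|]. intros x' y' P' L.
  assert (M1 := Rmin_l rho N). assert (M2 := Rmin_r rho N).
  assert (M0 : 0 < Rmin rho N) by (apply Rmin_pos; lra).
  set (r := sqrt (x' ^ 2 + y' ^ 2)).
  assert (r0 : 0 < r) by (apply sqrt_lt_R0, P').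
  assert (r2 : r ^ 2 = x' ^ 2 + y' ^ 2) by (apply pow2_sqrt; destruct P'; lra).
  destruct (circle_reaches X Y r PX ltac:(lra) r0) as [x1 [y1 [E1 U1]]]; [rewrite r2, <- N2; nra|].
  assert (Q := K x' y' x1 y1 P' ltac:(nra) ltac:(lra)). apply Rabs_le_between in Q. lra.
Qed.

(** One positive value makes u positive near 0. A negative value would then yield an interior
    minimum, since u tends to 0 at C_b; a zero would itself be an interior minimum. Both are
    excluded by the absence of critical points. *)
Theorem origin_and_sign x0 y0 : pdisc b x0 y0 -> 0 < u x0 y0 ->
  (forall x y, pdisc b x y -> 0 < u x y) /\
  (forall x y, pdisc b x y -> exists r, 0 < r /\
     forall x' y', pdisc b x' y' -> x' ^ 2 + y' ^ 2 < r ^ 2 -> u x y < u x' y').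
Proof.
  intros P0 U0.
  assert (Or : forall x y, pdisc b x y -> exists r, 0 < r /\
     forall x' y', pdisc b x' y' -> x' ^ 2 + y' ^ 2 < r ^ 2 -> u x y < u x' y').
  { intros x y P. destruct (Rlt_le_dec 0 (u x y)) as [L|L]; [now apply origin_of_positive|].
    destruct (origin_of_positive x0 y0 P0 U0) as [r [Hr K]]. exists r. split; [exact Hr|].
    intros x' y' P' L'. specialize (K x' y' P' L'). lra. }
  split; [|exact Or].
  assert (NN : forall x y, pdisc b x y -> 0 <= u x y).
  { intros x y P. apply Rnot_lt_le. intros L.
    destruct (Hbd (- u x y) ltac:(lra)) as [r1 [Hr1 K1]]. destruct (Or x y P) as [r [Hr K]].
    destruct (min_attained_annulus b r1 r (fun X Y => pdisc b X Y /\ u X Y <= u x y) u x y Hr1 Hr)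
      as [X [Y [[PX UX] Hm]]].
    { intros X Y [PX UX]. split; [exact PX|]. split; apply Rnot_lt_le; intros Lt.
      - generalize (K X Y PX Lt). lra.
      - generalize (K1 X Y PX Lt). rewrite Rabs_left; lra. }
    { intros X Y PX NS. destruct (Rle_lt_dec (u X Y) (u x y)) as [L2|L2]; [now destruct NS|].
      destruct (cont2_eps u X Y (u X Y - u x y) (cu X Y PX) ltac:(lra)) as [d [Hd K2]].
      exists d. split; [exact Hd|]. intros X' Y' A1 A2 [_ B]. specialize (K2 X' Y' A1 A2).
      apply Rabs_def2 in K2. lra. }
    { exact cu. }
    { split; [exact P|lra]. }
    destruct (exists_smaller X Y PX) as [X' [Y' [P' L']]].
    assert (u X Y <= u X' Y'); [|lra]. apply Hm. split; [exact P'|lra]. }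
  intros x y P. destruct (NN x y P) as [L|L]; [exact L|].
  destruct (exists_smaller x y P) as [x' [y' [P' L']]]. generalize (NN x' y' P'). lra.
Qed.

End Origin.

(** * Normalization of the sign of the stream function *)

Lemma has_grad_ext D f f' fx fy fx' fy' : open2 D -> has_grad D f fx fy ->
  (forall x y, D x y -> f x y = f' x y) -> (forall x y, D x y -> fx x y = fx' x y) ->
  (forall x y, D x y -> fy x y = fy' x y) -> has_grad D f' fx' fy'.
Proof.
  intros oD G E Ex Ey x y P. destruct (G x y P) as [A1 [A2 [A3 A4]]]. destruct (oD x y P) as [d Hd].
  assert (Z : forall z : R, Rabs (z - z) < d) by (intros; rewrite Rminus_diag, Rabs_R0; apply cond_pos).
  rewrite <- Ex, <- Ey by exact P.
  split; [|split; [|split]].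
  - apply (is_derive_ext_loc (fun t => f t y)); [|exact A1]. exists d. intros t Ht. apply E, Hd; [exact Ht|apply Z].
  - apply (is_derive_ext_loc (fun t => f x t)); [|exact A2]. exists d. intros t Ht. apply E, Hd; [apply Z|exact Ht].
  - apply (continuity_2d_pt_ext_loc fx); [|exact A3]. exists d. intros a c Ha Hc. apply Ex, Hd; assumption.
  - apply (continuity_2d_pt_ext_loc fy); [|exact A4]. exists d. intros a c Ha Hc. apply Ey, Hd; assumption.
Qed.

Lemma bd_lim_ext b f g x y l : (forall x y, pdisc b x y -> f x y = g x y) -> bd_lim b f x y l -> bd_lim b g x y l.
Proof.
  intros E L e He. destruct (L e He) as [d [Hd K]]. exists d. split; [exact Hd|].
  intros x' y' P Hx Hy. rewrite <- E by exact P. now apply K.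
Qed.

Lemma bd_lim_opp b f x y l : bd_lim b f x y l -> bd_lim b (fun x y => - f x y) x y (- l).
Proof.
  intros L e He. destruct (L e He) as [d [Hd K]]. exists d. split; [exact Hd|].
  intros x' y' P Hx Hy. replace (- f x' y' - - l) with (- (f x' y' - l)) by ring.
  rewrite Rabs_Ropp. now apply K.
Qed.

Lemma bd_lim_opp_inv b f x y l : bd_lim b (fun x y => - f x y) x y l -> bd_lim b f x y (- l).
Proof.
  intros L. apply (bd_lim_ext b (fun x y => - - f x y)); [intros; ring|].
  exact (bd_lim_opp b (fun x y => - f x y) x y l L).
Qed.

Lemma flow_opp b p q p1 p2 q1 q2 o1 o2 : flow b p q p1 p2 q1 q2 o1 o2 ->
  flow b (fun x y => - p x y) (fun x y => - q x y) (fun x y => - p1 x y) (fun x y => - p2 x y)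
    (fun x y => - q1 x y) (fun x y => - q2 x y) (fun x y => - o1 x y) (fun x y => - o2 x y).
Proof.
  intros F. split.
  - apply F.
  - apply has_grad_opp, F.
  - apply has_grad_opp, F.
  - intros x y P. now rewrite (fl_curl F x y P).
  - apply (has_grad_ext _ _ _ _ _ _ _ (open2_pdisc b) (has_grad_opp _ _ _ _ (fl_grad_om F)));
      intros; ring.
  - intros x y P. assert (T := fl_transport F x y P). lra.
  - intros x y P. destruct (fl_nocrit F x y P); [left|right]; lra.
  - intros x y E f Hf. assert (L := fl_lim F x y E).
    assert (K : forall g, (exists l, bd_lim b g x y l) -> exists l, bd_lim b (fun x y => - g x y) x y l).
    { intros g [l Hl]. exists (- l). now apply bd_lim_opp. }
    destruct Hf as [->|[->|[->|[->|[->|[->|[->| ->]]]]]]]; apply K, L; tauto.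
  - intros x y lp lq E Lp Lq.
    assert (T := fl_tangent F x y (- lp) (- lq) E (bd_lim_opp_inv _ _ _ _ _ Lp) (bd_lim_opp_inv _ _ _ _ _ Lq)).
    lra.
  - destruct (fl_nonstag F) as [x [y [lp [lq [E [Lp [Lq N]]]]]]].
    exists x, y, (- lp), (- lq). split; [exact E|]. split; [now apply bd_lim_opp|]. split; [now apply bd_lim_opp|].
    destruct N; [left|right]; lra.
Qed.

(** The setting is invariant under a change of sign. If u is nowhere positive, it is negative
    somewhere because it has no local minimum, and - u is used. *)
Theorem flow_radial b u p q p1 p2 q1 q2 o1 o2 : flow b p q p1 p2 q1 q2 o1 o2 ->
  has_grad (pdisc b) u p q ->
  (forall e, 0 < e -> exists r, 0 < r < b /\
    forall x y, pdisc b x y -> r ^ 2 < x ^ 2 + y ^ 2 -> Rabs (u x y) < e) ->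
  (forall e, 0 < e -> exists rho, 0 < rho /\ forall x y x' y', pdisc b x y ->
    x ^ 2 + y ^ 2 < rho ^ 2 -> x ^ 2 + y ^ 2 = x' ^ 2 + y' ^ 2 -> Rabs (u x y - u x' y') <= e) ->
  forall x y x' y', pdisc b x y -> x ^ 2 + y ^ 2 = x' ^ 2 + y' ^ 2 -> u x y = u x' y'.
Proof.
  intros F Gu Hbd Hosc x y x' y' P E.
  assert (Main : forall u p q p1 p2 q1 q2 o1 o2, flow b p q p1 p2 q1 q2 o1 o2 -> has_grad (pdisc b) u p q ->
    (forall e, 0 < e -> exists r, 0 < r < b /\
      forall x y, pdisc b x y -> r ^ 2 < x ^ 2 + y ^ 2 -> Rabs (u x y) < e) ->
    (forall e, 0 < e -> exists rho, 0 < rho /\ forall x y x' y', pdisc b x y ->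
      x ^ 2 + y ^ 2 < rho ^ 2 -> x ^ 2 + y ^ 2 = x' ^ 2 + y' ^ 2 -> Rabs (u x y - u x' y') <= e) ->
    (exists x0 y0, pdisc b x0 y0 /\ 0 < u x0 y0) -> u x y = u x' y').
  { clear u p q p1 p2 q1 q2 o1 o2 F Gu Hbd Hosc. intros u p q p1 p2 q1 q2 o1 o2 F Gu Hbd Hosc [x0 [y0 [P0 U0]]].
    destruct (origin_and_sign b u p q Gu (fl_nocrit F) Hbd Hosc x0 y0 P0 U0) as [Hpos Hor].
    apply (disc_setting_radial b u p q p1 p2 q1 q2); [|exact P|exact E].
    apply (flow_disc_setting b u p q p1 p2 q1 q2 o1 o2 F Gu Hpos); [|exact Hor].
    intros e He. destruct (Hbd e He) as [r [Hr K]]. exists r. split; [exact Hr|]. intros X Y PX L.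
    eapply Rle_lt_trans; [apply Rle_abs|now apply K]. }
  destruct (classic (exists x0 y0, pdisc b x0 y0 /\ 0 < u x0 y0)) as [Pos|NPos].
  - now apply (Main u p q p1 p2 q1 q2 o1 o2).
  - enough (- u x y = - u x' y') by lra.
    apply (Main (fun x y => - u x y) _ _ _ _ _ _ _ _ (flow_opp _ _ _ _ _ _ _ _ _ F) (has_grad_opp _ _ _ _ Gu)).
    + intros e He. destruct (Hbd e He) as [r [Hr K]]. exists r. split; [exact Hr|]. intros X Y PX L.
      rewrite Rabs_Ropp. now apply K.
    + intros e He. destruct (Hosc e He) as [r [Hr K]]. exists r. split; [exact Hr|]. intros X Y X' Y' PX L E'.
      replace (- u X Y - - u X' Y') with (- (u X Y - u X' Y')) by ring. rewrite Rabs_Ropp. now apply K.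
    + destruct (exists_smaller b u p q Gu (fl_nocrit F) x y P) as [X [Y [PX L]]].
      exists X, Y. split; [exact PX|].
      assert (u x y <= 0) by (apply Rnot_lt_le; intros L'; apply NPos; now exists x, y). lra.
Qed.

(** * From the Euler equations to the stream function *)

Lemma mixed_partials D f fx fy fxx fxy fyx fyy x y : open2 D -> has_grad D f fx fy ->
  has_grad D fx fxx fxy -> has_grad D fy fyx fyy -> D x y -> fxy x y = fyx x y.
Proof.
  intros oD G Gx Gy P. destruct (oD x y P) as [d Hd].
  assert (Z : forall z : R, Rabs (z - z) < d) by (intros; rewrite Rminus_diag, Rabs_R0; apply cond_pos).
  assert (Ex : forall a c, D a c -> is_derive (fun z => Derive (fun t => f t z) a) c (fxy a c)).
  { intros a c Pa. destruct (oD a c Pa) as [e He]. apply (is_derive_ext_loc (fun z => fx a z)); [|apply Gx, Pa].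
    exists e. intros z Hz. symmetry. apply is_derive_unique. apply G, He; [|exact Hz].
    rewrite Rminus_diag, Rabs_R0; apply cond_pos. }
  assert (Ey : forall a c, D a c -> is_derive (fun z => Derive (fun t => f z t) c) a (fyx a c)).
  { intros a c Pa. destruct (oD a c Pa) as [e He]. apply (is_derive_ext_loc (fun z => fy z c)); [|apply Gy, Pa].
    exists e. intros z Hz. symmetry. apply is_derive_unique. apply G, He; [exact Hz|].
    rewrite Rminus_diag, Rabs_R0; apply cond_pos. }
  symmetry. refine (eq_trans (eq_sym (is_derive_unique _ _ _ (Ey x y P)))
    (eq_trans (Schwarz f x y _ _ _) (is_derive_unique _ _ _ (Ex x y P)))).
  - exists d. intros a c Ha Hc. assert (Pa := Hd a c Ha Hc). destruct (G a c Pa) as [A1 [A2 _]].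
    split; [now exists (fx a c)|]. split; [now exists (fy a c)|].
    split; [exists (fyx a c); now apply Ey|exists (fxy a c); now apply Ex].
  - apply (continuity_2d_pt_ext_loc fyx); [|apply Gy, P]. exists d. intros a c Ha Hc.
    symmetry. apply is_derive_unique, Ey, Hd; assumption.
  - apply (continuity_2d_pt_ext_loc fxy); [|apply Gx, P]. exists d. intros a c Ha Hc.
    symmetry. apply is_derive_unique, Ex, Hd; assumption.
Qed.

Lemma has_grad_plus D f fx fy g gx gy : has_grad D f fx fy -> has_grad D g gx gy ->
  has_grad D (fun x y => f x y + g x y) (fun x y => fx x y + gx x y) (fun x y => fy x y + gy x y).
Proof.
  intros Hf Hg x y P. destruct (Hf x y P) as [A1 [A2 [A3 A4]]]. destruct (Hg x y P) as [B1 [B2 [B3 B4]]].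
  split; [now apply derive_plus|]. split; [now apply derive_plus|].
  split; now apply continuity_2d_pt_plus.
Qed.

(* The curl of the momentum equation, the pressure being of class C^2 a posteriori. *)
Lemma vorticity_transport D V1 V2 a11 a12 a21 a22 a111 a112 a121 a122 a211 a212 a221 a222 P P1 P2 x y :
  open2 D -> has_grad D V1 a11 a12 -> has_grad D V2 a21 a22 ->
  has_grad D a11 a111 a112 -> has_grad D a12 a121 a122 ->
  has_grad D a21 a211 a212 -> has_grad D a22 a221 a222 -> has_grad D P P1 P2 ->
  (forall x y, D x y -> V1 x y * a11 x y + V2 x y * a12 x y + P1 x y = 0 /\
     V1 x y * a21 x y + V2 x y * a22 x y + P2 x y = 0 /\ a11 x y + a22 x y = 0) ->
  D x y -> V1 x y * (a211 x y - a121 x y) + V2 x y * (a212 x y - a122 x y) = 0.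
Proof.
  intros oD G1 G2 G11 G12 G21 G22 GP Eq Dxy.
  assert (K1 := has_grad_opp _ _ _ _ (has_grad_plus _ _ _ _ _ _ _ (has_grad_mult _ _ _ _ _ _ _ oD G1 G11)
    (has_grad_mult _ _ _ _ _ _ _ oD G2 G12))).
  assert (K2 := has_grad_opp _ _ _ _ (has_grad_plus _ _ _ _ _ _ _ (has_grad_mult _ _ _ _ _ _ _ oD G1 G21)
    (has_grad_mult _ _ _ _ _ _ _ oD G2 G22))).
  eapply (has_grad_ext D _ P1) in K1; [|exact oD|intros a c Pa; cbv beta; generalize (Eq a c Pa); lra|reflexivity..].
  eapply (has_grad_ext D _ P2) in K2; [|exact oD|intros a c Pa; cbv beta; generalize (Eq a c Pa); lra|reflexivity..].
  assert (S := mixed_partials _ _ _ _ _ _ _ _ x y oD GP K1 K2 Dxy). cbv beta in S.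
  assert (S1 := mixed_partials _ _ _ _ _ _ _ _ x y oD G1 G11 G12 Dxy).
  assert (S2 := mixed_partials _ _ _ _ _ _ _ _ x y oD G2 G21 G22 Dxy).
  (* In the curl of v . grad v, incompressibility cancels the term om div v. *)
  destruct (Eq x y Dxy) as [_ [_ Dv]]. replace (a22 x y) with (- a11 x y) in S by lra.
  rewrite <- S1, <- S2 in *. lra.
Qed.

Lemma punctured_disc_iff b x y : 0 < b -> punctured_disc b (x, y) <-> pdisc b x y.
Proof.
  intros hb. unfold punctured_disc, enorm, pdisc. simpl fst. simpl snd.
  assert (P := sqrt_pos (x ^ 2 + y ^ 2)).
  assert (Q : 0 <= x ^ 2 + y ^ 2) by (generalize (pow2_ge_0 x) (pow2_ge_0 y); lra).
  assert (S := pow2_sqrt _ Q). set (r := sqrt (x ^ 2 + y ^ 2)) in *. rewrite <- S. clearbody r. clear S Q.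
  split; intros [H1 H2]; split; nra.
Qed.

Lemma closed_punctured_disc_iff b x y : 0 < b -> closed_punctured_disc b (x, y) <-> 0 < x ^ 2 + y ^ 2 <= b ^ 2.
Proof.
  intros hb. unfold closed_punctured_disc, enorm. simpl fst. simpl snd.
  assert (P := sqrt_pos (x ^ 2 + y ^ 2)).
  assert (Q : 0 <= x ^ 2 + y ^ 2) by (generalize (pow2_ge_0 x) (pow2_ge_0 y); lra).
  assert (S := pow2_sqrt _ Q). set (r := sqrt (x ^ 2 + y ^ 2)) in *. rewrite <- S. clearbody r. clear S Q.
  split; intros [H1 H2]; split; nra.
Qed.

Lemma circle_iff b x y : 0 < b -> circle b (x, y) <-> x ^ 2 + y ^ 2 = b ^ 2.
Proof.
  intros hb. unfold circle, enorm. simpl fst. simpl snd.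
  assert (P := sqrt_pos (x ^ 2 + y ^ 2)).
  assert (Q : 0 <= x ^ 2 + y ^ 2) by (generalize (pow2_ge_0 x) (pow2_ge_0 y); lra).
  assert (S := pow2_sqrt _ Q). set (r := sqrt (x ^ 2 + y ^ 2)) in *. rewrite <- S. clearbody r. clear S Q.
  split; intros E; [now rewrite E|nra].
Qed.

Lemma enorm_zero a c : enorm (a, c) = 0 <-> a = 0 /\ c = 0.
Proof.
  unfold enorm. simpl fst. simpl snd. split.
  - intros E. apply sq_sum_eq0. apply sqrt_eq_0; [|exact E]. generalize (pow2_ge_0 a) (pow2_ge_0 c). lra.
  - intros [-> ->]. replace (0 ^ 2 + 0 ^ 2) with 0 by ring. apply sqrt_0.
Qed.

Lemma enorm_circle b x y : 0 < b -> x ^ 2 + y ^ 2 = b ^ 2 -> enorm (x, y) = b.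
Proof. intros hb E. now apply circle_iff. Qed.

Lemma C1_on_has_grad b f : 0 < b -> C1_on (punctured_disc b) f ->
  has_grad (pdisc b) (fun x y => f (x, y)) (fun x y => Defs.d1 f (x, y)) (fun x y => Defs.d2 f (x, y)).
Proof.
  intros hb Hf x y P. destruct (Hf (x, y) (proj2 (punctured_disc_iff b x y hb) P)) as [A1 [A2 [A3 A4]]].
  assert (C : forall g : R * R -> R, continuous g (x, y) -> continuity_2d_pt (fun x y => g (x, y)) x y).
  { intros g Hg. apply continuity_2d_pt_filterlim. apply (filterlim_ext g); [now intros []|exact Hg]. }
  split; [exact (Derive_correct _ _ A1)|]. split; [exact (Derive_correct _ _ A2)|]. split; now apply C.
Qed.

Lemma bd_lim_continuous_on b (f g : R * R -> R) x y : 0 < b ->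
  (forall z, punctured_disc b z -> g z = f z) -> continuous_on (closed_punctured_disc b) g ->
  x ^ 2 + y ^ 2 = b ^ 2 -> bd_lim b (fun x y => f (x, y)) x y (g (x, y)).
Proof.
  intros hb Efg Cg E e He.
  assert (Pc : closed_punctured_disc b (x, y)) by (apply closed_punctured_disc_iff; nra).
  destruct (Cg (x, y) Pc (fun z => Rabs (z - g (x, y)) < e)) as [d Hd].
  { now exists (mkposreal e He). }
  exists d. split; [apply cond_pos|]. intros x' y' P Hx Hy.
  assert (P' := proj2 (punctured_disc_iff b x' y' hb) P). rewrite <- Efg by exact P'.
  apply Hd; [now split|]. destruct P' as [P1 P2]. split; [exact P1|now left].
Qed.

Lemma extends_bd_lim b f x y : 0 < b -> extends_continuously (punctured_disc b) (closed_punctured_disc b) f ->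
  x ^ 2 + y ^ 2 = b ^ 2 -> exists l, bd_lim b (fun x y => f (x, y)) x y l.
Proof. intros hb [g [Eg Cg]] E. exists (g (x, y)). now apply bd_lim_continuous_on. Qed.

Lemma nat_above (z : R) : exists N : nat, forall n, (N <= n)%nat -> z < INR n.
Proof.
  destruct (archimed_cor1 (/ (Rabs z + 1))) as [N [HN N0]].
  { apply Rinv_0_lt_compat. generalize (Rabs_pos z). lra. }
  exists N. intros n Hn. apply Rinv_lt_cancel in HN; [|now apply lt_0_INR].
  apply le_INR in Hn. generalize (Rle_abs z). lra.
Qed.

(** Boundedness and vanishing tangential component are known near each point of C_b; [collar] makes
    them uniform, as [closed_form_primitive] requires. *)
Lemma flow_stream b p q p1 p2 q1 q2 o1 o2 : flow b p q p1 p2 q1 q2 o1 o2 ->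
  exists u, has_grad (pdisc b) u p q /\ forall e, 0 < e -> exists r, 0 < r < b /\
    forall x y, pdisc b x y -> r ^ 2 < x ^ 2 + y ^ 2 -> Rabs (u x y) < e.
Proof.
  intros F. assert (hb := fl_b F).
  destruct (collar b (fun n x y => Rabs (p x y) <= INR n /\ Rabs (q x y) <= INR n) hb) as [r0 [N [Hr0 KN]]].
  { intros x y E. destruct (fl_lim F x y E p) as [lp Lp]; [tauto|].
    destruct (fl_lim F x y E q) as [lq Lq]; [tauto|].
    destruct (Lp 1 ltac:(lra)) as [d1 [Hd1 K1]]. destruct (Lq 1 ltac:(lra)) as [d2 [Hd2 K2]].
    destruct (nat_above (Rabs lp + Rabs lq + 1)) as [N HN].
    exists (Rmin d1 d2), N. split; [now apply Rmin_pos|]. intros n x' y' Hn P Hx Hy.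
    assert (M1 := Rmin_l d1 d2). assert (M2 := Rmin_r d1 d2).
    specialize (HN n Hn). specialize (K1 x' y' P ltac:(lra) ltac:(lra)). specialize (K2 x' y' P ltac:(lra) ltac:(lra)).
    generalize (Rabs_triang_inv (p x' y') lp) (Rabs_triang_inv (q x' y') lq) (Rabs_pos lp) (Rabs_pos lq). lra. }
  apply (closed_form_primitive b p q p1 p2 q1 q2 (fl_grad_p F) (fl_grad_q F)
    (fl_curl F) (INR N) r0 Hr0 KN).
  intros e He.
  destruct (collar b (fun _ x y => Rabs (- y * p x y + x * q x y) < e) hb) as [r [_ [Hr K]]]; [|now exists r].
  intros x y E. destruct (fl_lim F x y E p) as [lp Lp]; [tauto|].
  destruct (fl_lim F x y E q) as [lq Lq]; [tauto|].
  assert (T := fl_tangent F x y lp lq E Lp Lq).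
  (* Sum of the coefficients of the four error terms: |x'| and |y'| are at most b, and the limits
     multiply the displacement of the point. *)
  set (A := 2 * b + Rabs lp + Rabs lq + 1). assert (A1 := Rabs_pos lp). assert (A2 := Rabs_pos lq).
  assert (eA : 0 < e / A) by (apply Rdiv_lt_0_compat; unfold A; lra).
  destruct (Lp _ eA) as [d1 [Hd1 K1]]. destruct (Lq _ eA) as [d2 [Hd2 K2]].
  exists (Rmin (e / A) (Rmin d1 d2)), 0%nat. split; [repeat apply Rmin_pos; lra|]. intros _ x' y' _ P Hx Hy.
  assert (M1 := Rmin_l (e / A) (Rmin d1 d2)). assert (M2 := Rmin_r (e / A) (Rmin d1 d2)).
  assert (M3 := Rmin_l d1 d2). assert (M4 := Rmin_r d1 d2).
  specialize (K1 x' y' P ltac:(lra) ltac:(lra)). specialize (K2 x' y' P ltac:(lra) ltac:(lra)).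
  destruct P as [_ P]. assert (Bx : Rabs x' <= b /\ Rabs y' <= b).
  { generalize (pow2_ge_0 x') (pow2_ge_0 y'). intros. split; apply sq_le_abs; lra. }
  replace (- y' * p x' y' + x' * q x' y') with
    (- y' * (p x' y' - lp) + x' * (q x' y' - lq) + (- (y' - y) * lp + (x' - x) * lq)) by lra.
  assert (S : forall a c k, Rabs a <= k -> Rabs c < e / A -> Rabs (a * c) <= k * (e / A)).
  { intros a c k Ha Hc. rewrite Rabs_mult. apply Rmult_le_compat; try apply Rabs_pos; lra. }
  assert (T1 : Rabs (- y' * (p x' y' - lp)) <= b * (e / A)) by (apply S; [now rewrite Rabs_Ropp|exact K1]).
  assert (T2 : Rabs (x' * (q x' y' - lq)) <= b * (e / A)) by (apply S; [apply Bx|exact K2]).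
  assert (T3 : Rabs (- (y' - y) * lp) <= Rabs lp * (e / A)).
  { rewrite Rmult_comm. apply S; [lra|rewrite Rabs_Ropp; lra]. }
  assert (T4 : Rabs ((x' - x) * lq) <= Rabs lq * (e / A)) by (rewrite Rmult_comm; apply S; lra).
  set (X1 := - y' * (p x' y' - lp)) in *. set (X2 := x' * (q x' y' - lq)) in *.
  set (X3 := - (y' - y) * lp) in *. set (X4 := (x' - x) * lq) in *.
  assert (T5 := Rabs_triang (X1 + X2) (X3 + X4)). assert (T6 := Rabs_triang X1 X2). assert (T7 := Rabs_triang X3 X4).
  assert (eE : e = A * (e / A)) by (field; unfold A; lra).
  set (z := e / A) in *. rewrite eE. unfold A. nra.
Qed.

(** With p = v_2 and q = - v_1, div v = 0 is the closedness of p dx + q dy, and p1 + q2 is the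
    vorticity. The inclusion in [strict_subset] excludes critical points inside; its strictness
    provides a non-stagnation point of C_b. *)
Lemma euler_flow b v : 0 < b ->
  C2_up_to (punctured_disc b) (closed_punctured_disc b) (comp1 v) ->
  C2_up_to (punctured_disc b) (closed_punctured_disc b) (comp2 v) ->
  (exists p : R * R -> R, steady_Euler (punctured_disc b) v p) ->
  (forall x, circle b x -> dot (v x) (e_r x) = 0) ->
  strict_subset (fun x => closed_punctured_disc b x /\ enorm (v x) = 0) (circle b) ->
  flow b (fun x y => comp2 v (x, y)) (fun x y => - comp1 v (x, y))
    (fun x y => Defs.d1 (comp2 v) (x, y)) (fun x y => Defs.d2 (comp2 v) (x, y))
    (fun x y => - Defs.d1 (comp1 v) (x, y)) (fun x y => - Defs.d2 (comp1 v) (x, y))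
    (fun x y => Defs.d1 (Defs.d1 (comp2 v)) (x, y) + - Defs.d1 (Defs.d2 (comp1 v)) (x, y))
    (fun x y => Defs.d2 (Defs.d1 (comp2 v)) (x, y) + - Defs.d2 (Defs.d2 (comp1 v)) (x, y)).
Proof.
  intros hb [[C1 [C11 C12]] [K1 [E11 [E12 [E111 [E121 [E112 E122]]]]]]]
    [[C2 [C21 C22]] [K2 [E21 [E22 [E211 [E221 [E212 E222]]]]]]] [P [_ [_ [CP Eq]]]] Hbd [Hs1 Hs2].
  assert (G1 := C1_on_has_grad b _ hb C1). assert (G2 := C1_on_has_grad b _ hb C2).
  assert (G11 := C1_on_has_grad b _ hb C11). assert (G12 := C1_on_has_grad b _ hb C12).
  assert (G21 := C1_on_has_grad b _ hb C21). assert (G22 := C1_on_has_grad b _ hb C22).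
  assert (GP := C1_on_has_grad b _ hb CP).
  assert (Eq' := fun x y Px => Eq (x, y) (proj2 (punctured_disc_iff b x y hb) Px)).
  cbv beta in Eq'.
  assert (B1 : forall x y, x ^ 2 + y ^ 2 = b ^ 2 -> bd_lim b (fun x y => comp1 v (x, y)) x y (comp1 v (x, y))).
  { intros x y E. now apply bd_lim_continuous_on. }
  assert (B2 : forall x y, x ^ 2 + y ^ 2 = b ^ 2 -> bd_lim b (fun x y => comp2 v (x, y)) x y (comp2 v (x, y))).
  { intros x y E. now apply bd_lim_continuous_on. }
  split.
  - exact hb.
  - exact G2.
  - exact (has_grad_opp _ _ _ _ G1).
  - intros x y Px. destruct (Eq' x y Px) as [_ [_ Dv]]. lra.
  - exact (has_grad_plus _ _ _ _ _ _ _ G21 (has_grad_opp _ _ _ _ G12)).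
  - intros x y Px.
    assert (T := vorticity_transport (pdisc b) _ _ _ _ _ _ _ _ _ _ _ _ _ _ _ _ _ x y (open2_pdisc b) G1 G2 G11 G12 G21 G22 GP Eq' Px).
    cbv beta in T. lra.
  - intros x y Px. apply NNPP. intros N. apply not_or_and in N. destruct N as [N1 N2].
    apply NNPP in N1. apply NNPP in N2. assert (N3 : comp1 v (x, y) = 0) by lra.
    assert (Pp := proj2 (punctured_disc_iff b x y hb) Px).
    assert (Cb : circle b (x, y)).
    { apply Hs1. split; [destruct Pp; split; lra|].
      unfold comp1, comp2 in N1, N3. destruct (v (x, y)) as [w1 w2]. simpl in N1, N3. now apply enorm_zero. }
    apply circle_iff in Cb; [|exact hb]. destruct Px. lra.
  - intros x y E f Hf.
    assert (Ex : forall g, extends_continuously (punctured_disc b) (closed_punctured_disc b) g ->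
      exists l, bd_lim b (fun x y => g (x, y)) x y l) by (intros; now apply extends_bd_lim).
    assert (Op : forall g : R -> R -> R, (exists l, bd_lim b g x y l) -> exists l, bd_lim b (fun x y => - g x y) x y l).
    { intros g [l Hl]. exists (- l). now apply bd_lim_opp. }
    assert (Df : forall g h : R * R -> R, (exists l, bd_lim b (fun x y => g (x, y)) x y l) ->
      (exists l, bd_lim b (fun x y => h (x, y)) x y l) -> exists l, bd_lim b (fun x y => g (x, y) + - h (x, y)) x y l).
    { intros g h [l Hl] [m Hm]. exists (1 * l + -1 * m).
      apply (bd_lim_ext b (fun x y => 1 * g (x, y) + -1 * h (x, y))); [intros; ring|].
      now apply (bd_lim_linear b (fun x y => g (x, y)) (fun x y => h (x, y))). }
    destruct Hf as [->|[->|[->|[->|[->|[->|[->| ->]]]]]]].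
    + eexists. now apply B2.
    + apply Op. eexists. now apply B1.
    + now apply Ex.
    + now apply Ex.
    + apply Op. now apply Ex.
    + apply Op. now apply Ex.
    + apply Df; now apply Ex.
    + apply Df; now apply Ex.
  - intros x y lp lq E Lp Lq.
    rewrite (bd_lim_unique b _ x y _ _ hb E Lp (B2 x y E)).
    rewrite (bd_lim_unique b _ x y _ _ hb E Lq (bd_lim_opp b _ x y _ (B1 x y E))).
    assert (D0 := Hbd (x, y) (proj2 (circle_iff b x y hb) E)). unfold dot, e_r in D0.
    rewrite (enorm_circle b x y hb E) in D0. cbn [fst snd] in D0. fold (comp1 v (x, y)) (comp2 v (x, y)) in D0.
    assert (Q : x * comp1 v (x, y) + y * comp2 v (x, y) = 0); [|lra].
    apply Rmult_eq_reg_r with (/ b); [|apply Rinv_neq_0_compat; lra]. rewrite Rmult_0_l, <- D0. field. lra.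
  - apply NNPP. intros N. apply Hs2. intros [x y]. split; [apply Hs1|]. intros Cb.
    assert (E := proj1 (circle_iff b x y hb) Cb). split; [apply closed_punctured_disc_iff; nra|].
    apply NNPP. intros NZ. apply N. exists x, y, (comp2 v (x, y)), (- comp1 v (x, y)).
    split; [exact E|]. split; [now apply B2|]. split; [now apply bd_lim_opp, B1|].
    apply NNPP. intros M. apply not_or_and in M. destruct M as [M1 M2]. apply NNPP in M1. apply NNPP in M2.
    apply NZ. assert (M3 : comp1 v (x, y) = 0) by lra. unfold comp1, comp2 in M1, M3.
    destruct (v (x, y)) as [w1 w2]. simpl in M1, M3. now apply enorm_zero.
Qed.

(** Differentiation along rotations removes the tangential derivative; differentiation along
    dilations of (x, y) and of (r, 0) identifies the radial derivatives. *)
Lemma radial_gradient b u p q x y : 0 < b -> has_grad (pdisc b) u p q ->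
  (forall x y x' y', pdisc b x y -> x ^ 2 + y ^ 2 = x' ^ 2 + y' ^ 2 -> u x y = u x' y') ->
  pdisc b x y -> let r := sqrt (x ^ 2 + y ^ 2) in p x y = p r 0 * (x / r) /\ q x y = p r 0 * (y / r).
Proof.
  intros hb Gu Hrad P r.
  assert (r2 : r ^ 2 = x ^ 2 + y ^ 2) by (apply pow2_sqrt; destruct P; lra).
  assert (r0 : 0 < r) by (apply sqrt_lt_R0, P).
  assert (Pr : pdisc b r 0) by (destruct P; split; nra).
  assert (T : - y * p x y + x * q x y = 0).
  (* u is constant along the rotation, so every time is a minimum and the derivative vanishes. *)
  { apply (local_min_derive (fun t => u (x * cos t - y * sin t) (x * sin t + y * cos t)) 0 _ 1); [lra| |].
    - intros t _. rewrite cos_0, sin_0. right. apply Hrad; [|].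
      + now replace (x * 1 - y * 0) with x by ring; replace (x * 0 + y * 1) with y by ring.
      + replace ((x * cos t - y * sin t) ^ 2 + (x * sin t + y * cos t) ^ 2) with
          ((x ^ 2 + y ^ 2) * (Rsqr (sin t) + Rsqr (cos t))) by (unfold Rsqr; ring).
        rewrite sin2_cos2. ring.
    - assert (E1 : x * cos 0 - y * sin 0 = x) by (rewrite cos_0, sin_0; ring).
      assert (E2 : x * sin 0 + y * cos 0 = y) by (rewrite cos_0, sin_0; ring).
      eapply is_derive_eq.
      + apply (has_grad_comp (pdisc b) u p q (fun t => x * cos t - y * sin t) (fun t => x * sin t + y * cos t) 0 (- y) x);
          [apply open2_pdisc|exact Gu|now rewrite E1, E2| |].
        * auto_derive; [easy|]. rewrite cos_0, sin_0. ring.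
        * auto_derive; [easy|]. rewrite cos_0, sin_0. ring.
      + cbv beta. rewrite E1, E2. ring. }
  assert (S : x * p x y + y * q x y - r * p r 0 = 0).
  { assert (rb : 0 < Rmin 1 (b / r - 1)).
    { apply Rmin_pos; [lra|]. assert (r < b).
      { destruct Pr. nra. }
      assert (1 < b / r); [|lra]. apply Rlt_div_r; lra. }
    apply (local_min_derive (fun s => u (s * x) (s * y) - u (s * r) (s * 0)) 1 _ (Rmin 1 (b / r - 1)) rb).
    - assert (E : forall s, 0 < s -> s * r < b -> u (s * x) (s * y) - u (s * r) (s * 0) = 0).
      { intros s s0 sr. assert (Q : (s * x) ^ 2 + (s * y) ^ 2 = (s * r) ^ 2) by (rewrite (Rpow_mult_distr s r), r2; ring).
        rewrite (Hrad (s * x) (s * y) (s * r) (s * 0)); [ring| |rewrite Q; ring].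
        unfold pdisc. rewrite Q. assert (0 < s * r) by now apply Rmult_lt_0_compat. nra. }
      intros s Hs. assert (M1 := Rmin_l 1 (b / r - 1)). assert (M2 := Rmin_r 1 (b / r - 1)).
      apply Rabs_def2 in Hs.
      assert (br : b / r * r = b) by (field; lra).
      rewrite (E 1), (E s); nra.
    - eapply is_derive_eq.
      + apply derive_minus.
        * apply (has_grad_comp (pdisc b) u p q (fun s => s * x) (fun s => s * y) 1 x y);
            [apply open2_pdisc|exact Gu|now rewrite !Rmult_1_l|auto_derive; [easy|ring]..].
        * apply (has_grad_comp (pdisc b) u p q (fun s => s * r) (fun s => s * 0) 1 r 0);
            [apply open2_pdisc|exact Gu|now rewrite !Rmult_1_l|auto_derive; [easy|ring]..].
      + cbv beta. rewrite !Rmult_1_l. ring. }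
  split; apply Rmult_eq_reg_l with (r ^ 2); try nra.
  - replace (r ^ 2 * (p r 0 * (x / r))) with (x * (r * p r 0)) by (field; lra). rewrite r2.
    replace (r * p r 0) with (x * p x y + y * q x y) by lra. replace (x * (x * p x y + y * q x y)) with
      (x ^ 2 * p x y + y * (x * q x y)) by ring. replace (x * q x y) with (y * p x y) by lra. ring.
  - replace (r ^ 2 * (p r 0 * (y / r))) with (y * (r * p r 0)) by (field; lra). rewrite r2.
    replace (r * p r 0) with (x * p x y + y * q x y) by lra. replace (y * (x * p x y + y * q x y)) with
      (x * (y * p x y) + y ^ 2 * q x y) by ring. replace (y * p x y) with (x * q x y) by lra. ring.
Qed.

Lemma flux_oscillation b v u : 0 < b ->
  has_grad (pdisc b) u (fun x y => comp2 v (x, y)) (fun x y => - comp1 v (x, y)) ->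
  filterlim (circle_integral (fun x => Rabs (dot (v x) (e_r x)))) (at_right 0) (locally 0) ->
  forall e, 0 < e -> exists rho, 0 < rho /\ forall x y x' y', pdisc b x y ->
    x ^ 2 + y ^ 2 < rho ^ 2 -> x ^ 2 + y ^ 2 = x' ^ 2 + y' ^ 2 -> Rabs (u x y - u x' y') <= e.
Proof.
  intros hb Gu Hf e He.
  destruct (Hf (fun z => Rabs (z - 0) < e)) as [d Hd]; [now exists (mkposreal e He)|].
  exists (Rmin d b). split; [apply Rmin_pos; [apply cond_pos|exact hb]|].
  intros x y x' y' P L E. set (r := sqrt (x ^ 2 + y ^ 2)).
  assert (r2 : r ^ 2 = x ^ 2 + y ^ 2) by (apply pow2_sqrt; destruct P; lra).
  assert (r0 : 0 < r) by (apply sqrt_lt_R0, P).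
  assert (M1 := Rmin_l d b). assert (M2 := Rmin_r d b).
  assert (M0 : 0 < Rmin d b) by (apply Rmin_pos; [apply cond_pos|exact hb]).
  assert (rm : r < Rmin d b) by nra.
  assert (Q := Hd r). assert (Br : ball 0 d r).
  { unfold ball. simpl. unfold AbsRing_ball, abs, minus, plus, opp. simpl. rewrite Ropp_0, Rplus_0_r, Rabs_pos_eq; lra. }
  specialize (Q Br r0). rewrite Rminus_0_r in Q.
  eapply Rle_trans; [apply (circle_oscillation b u _ _ r x y x' y' Gu); lra|].
  eapply Rle_trans; [|left; exact Q]. eapply Rle_trans; [|apply Rle_abs]. right.
  unfold circle_integral. apply (RInt_ext (V := R_CompleteNormedModule)). intros t _.
  assert (En : enorm (r * cos t, r * sin t) = r).
  { apply enorm_circle; [exact r0|]. replace ((r * cos t) ^ 2 + (r * sin t) ^ 2) with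
      (r ^ 2 * (Rsqr (sin t) + Rsqr (cos t))) by (unfold Rsqr; ring). rewrite sin2_cos2. ring. }
  unfold dot, e_r. rewrite En. cbn [fst snd]. unfold comp1, comp2.
  set (w1 := fst _). set (w2 := snd _).
  rewrite <- (Rabs_pos_eq r) at 7 by lra. rewrite <- Rabs_mult.
  replace (r * cos t * - w1 - r * sin t * w2) with (- ((w1 * (r * cos t / r) + w2 * (r * sin t / r)) * r)) by (field; lra).
  apply Rabs_Ropp.
Qed.

(** Transfers to C_b the circular form of v, known inside: the factor k depends on the direction
    only, so it is constant along a radius. *)
Lemma bd_lim_ray b f g x y k l m : 0 < b -> x ^ 2 + y ^ 2 = b ^ 2 ->
  bd_lim b f x y l -> bd_lim b g b 0 m ->
  (forall s, 0 < s < 1 -> f ((1 - s) * x) ((1 - s) * y) = g ((1 - s) * b) ((1 - s) * 0) * k) -> l = m * k.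
Proof.
  intros hb E Lf Lg H. apply NNPP. intros N.
  assert (P : 0 < Rabs (l - m * k)) by (apply Rabs_pos_lt; lra).
  assert (Pk := Rabs_pos k).
  destruct (bd_lim_approach b f x y l (Rabs (l - m * k) / 2) hb E Lf ltac:(lra)) as [s1 [Hs1 K1]].
  destruct (bd_lim_approach b g b 0 m (Rabs (l - m * k) / 2 / (Rabs k + 1)) hb ltac:(ring) Lg) as [s2 [Hs2 K2]].
  { apply Rdiv_lt_0_compat; lra. }
  assert (M0 : 0 < Rmin s1 s2) by (apply Rmin_pos; lra).
  assert (M1 := Rmin_l s1 s2). assert (M2 := Rmin_r s1 s2).
  set (s := Rmin s1 s2 / 2).
  specialize (K1 s ltac:(unfold s; lra)). specialize (K2 s ltac:(unfold s; lra)).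
  rewrite (H s) in K1 by (unfold s; lra). set (z := g _ _) in *.
  assert (K3 : Rabs ((z - m) * k) <= Rabs (l - m * k) / 2).
  { rewrite Rabs_mult. apply Rle_trans with (Rabs (l - m * k) / 2 / (Rabs k + 1) * (Rabs k + 1)); [|right; field; lra].
    apply Rmult_le_compat; try apply Rabs_pos; lra. }
  rewrite Rabs_minus_sym in K1. generalize (Rabs_triang (l - z * k) ((z - m) * k)).
  replace (l - z * k + (z - m) * k) with (l - m * k) by ring. lra.
Qed.

Lemma continuous_on_axis b (g : R * R -> R) : 0 < b -> continuous_on (closed_punctured_disc b) g ->
  continuous_on (fun r => 0 < r <= b) (fun r => g (r, 0)).
Proof.
  intros hb Cg r Hr P HP.
  assert (Pc : forall r, 0 < r <= b -> closed_punctured_disc b (r, 0)).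
  { intros s Hs. apply closed_punctured_disc_iff; nra. }
  destruct (Cg (r, 0) (Pc r Hr) P HP) as [d Hd]. exists d. intros s Hs Hs'.
  apply Hd; [split; [exact Hs|apply ball_center]|now apply Pc].
Qed.

Lemma extends_axis b (f : R * R -> R) : 0 < b ->
  extends_continuously (punctured_disc b) (closed_punctured_disc b) f ->
  extends_continuously (fun r => 0 < r < b) (fun r => 0 < r <= b) (fun r => f (r, 0)).
Proof.
  intros hb [g [Eg Cg]]. exists (fun r => g (r, 0)). split; [|now apply continuous_on_axis].
  intros r Hr. apply Eg. apply punctured_disc_iff; [exact hb|split; nra].
Qed.

(** V is arbitrary beyond b and only continuous from the left there, so the intermediate value
    theorem is confined to (0, b) and the endpoint is treated by a limit. *)
Lemma constant_sign b (V : R -> R) : 0 < b -> continuous_on (fun r => 0 < r <= b) V ->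
  (forall r, 0 < r <= b -> V r <> 0) ->
  (forall r, 0 < r <= b -> 0 < V r) \/ (forall r, 0 < r <= b -> V r < 0).
Proof.
  intros hb CV NZ.
  assert (Ce : forall r e, 0 < r <= b -> 0 < e -> exists d, 0 < d /\ forall s, 0 < s <= b -> Rabs (s - r) < d ->
    Rabs (V s - V r) < e).
  { intros r e Hr He. destruct (CV r Hr (fun z => Rabs (z - V r) < e)) as [d Hd]; [now exists (mkposreal e He)|].
    exists d. split; [apply cond_pos|]. intros s Hs Hsr. now apply Hd. }
  assert (Same : forall r s, 0 < r -> r < s -> s < b -> 0 < V r * V s).
  { intros r s r0 rs sb. apply Rnot_le_lt. intros L.
    assert (Nr := NZ r ltac:(lra)). assert (Ns := NZ s ltac:(lra)).
    assert (C : forall t, r <= t <= s -> continuity_pt V t).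
    { intros t Ht e He. destruct (Ce t e ltac:(lra) He) as [d [Hd K]].
      exists (Rmin d (Rmin t (b - t))). split; [repeat apply Rmin_pos; lra|].
      intros z [_ Hz]. simpl in Hz. unfold Rdist in Hz.
      assert (M1 := Rmin_l d (Rmin t (b - t))). assert (M2 := Rmin_r d (Rmin t (b - t))).
      assert (M3 := Rmin_l t (b - t)). assert (M4 := Rmin_r t (b - t)).
      assert (Hz' := Hz). apply Rabs_def2 in Hz'. apply K; lra. }
    destruct (Rlt_le_dec (V r) 0) as [A|A].
    - destruct (Ranalysis5.IVT_interv V r s C rs A) as [z [Hz Ez]]; [nra|]. now apply (NZ z); [lra|].
    - destruct (Ranalysis5.IVT_interv (fun z => - V z) r s) as [z [Hz Ez]].
      + intros t Ht. now apply continuity_pt_opp, C.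
      + exact rs.
      + lra.
      + nra.
      + apply (NZ z); lra. }
  assert (SameL : forall r s, 0 < r < b -> 0 < s < b -> 0 < V r * V s).
  { intros r s Hr Hs. destruct (Rtotal_order r s) as [L|[->|G]].
    - apply Same; lra.
    - assert (N := NZ s ltac:(lra)). nra.
    - rewrite Rmult_comm. apply Same; lra. }
  assert (End : forall r, 0 < r < b -> 0 < V r * V b).
  { intros r Hr. apply Rnot_le_lt. intros L. assert (Nb := NZ b ltac:(lra)). assert (Nr := NZ r ltac:(lra)).
    destruct (Ce b (Rabs (V b)) ltac:(lra) (Rabs_pos_lt _ Nb)) as [d [Hd K]].
    assert (M0 : 0 < Rmin d b) by (apply Rmin_pos; lra).
    assert (M1 := Rmin_l d b). assert (M2 := Rmin_r d b).
    assert (T := K (b - Rmin d b / 2) ltac:(lra) ltac:(rewrite Rabs_left; lra)).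
    assert (S := SameL r (b - Rmin d b / 2) Hr ltac:(lra)).
    set (w := V (b - Rmin d b / 2)) in *. apply Rabs_def2 in T.
    unfold Rabs in T. destruct (Rcase_abs (V b)); nra. }
  assert (Nb := NZ b ltac:(lra)).
  assert (Sg : forall r, 0 < r <= b -> 0 < V r * V b).
  { intros r [r0 [L| ->]]; [now apply End|nra]. }
  destruct (Rlt_le_dec 0 (V b)) as [L|L]; [left|right]; intros r Hr; assert (S := Sg r Hr); nra.
Qed.

Theorem theorem1p5 (b : R) (hb : 0 < b) (v : R * R -> R * R)
  (hreg1 : C2_up_to (punctured_disc b) (closed_punctured_disc b) (comp1 v))
  (hreg2 : C2_up_to (punctured_disc b) (closed_punctured_disc b) (comp2 v))
  (heuler : exists p : R * R -> R, steady_Euler (punctured_disc b) v p)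
  (hbd : forall x, circle b x -> dot (v x) (e_r x) = 0)
  (hstag : strict_subset
     (fun x => closed_punctured_disc b x /\ enorm (v x) = 0) (circle b))
  (hflux : filterlim (circle_integral (fun x => Rabs (dot (v x) (e_r x))))
     (at_right 0) (locally 0)) :
  (forall x, closed_punctured_disc b x -> 0 < enorm (v x)) /\
  circular (closed_punctured_disc b) v /\
  exists V : R -> R,
    C2_left_open b V /\
    ((forall r, 0 < r <= b -> 0 < V r) \/ (forall r, 0 < r <= b -> V r < 0)) /\
    forall x, closed_punctured_disc b x ->
      v x = (V (enorm x) * fst (e_theta x), V (enorm x) * snd (e_theta x)).
Proof.
  assert (F := euler_flow b v hb hreg1 hreg2 heuler hbd hstag).
  destruct (flow_stream _ _ _ _ _ _ _ _ _ F) as [u [Gu Hu]].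
  assert (Hosc := flux_oscillation b v u hb Gu hflux).
  assert (Hrad := flow_radial _ _ _ _ _ _ _ _ _ _ F Gu Hu Hosc).
  destruct hreg1 as [_ [K1 _]]. destruct hreg2 as [[C2 [C21 _]] [K2 [E21 [_ [E211 _]]]]].
  (* On the positive horizontal axis e_theta = (0, 1), so V is the second component of v there and
     inherits its regularity. *)
  set (V := fun r => comp2 v (r, 0)).
  assert (In : forall x y, pdisc b x y -> let r := sqrt (x ^ 2 + y ^ 2) in
    comp2 v (x, y) = V r * (x / r) /\ comp1 v (x, y) = V r * (- y / r)).
  { intros x y P r. destruct (radial_gradient b u _ _ x y hb Gu Hrad P) as [A1 A2]. fold r in A1, A2.
    fold (V r) in A1, A2. split; [exact A1|].
    assert (V r * (- y / r) = - (V r * (y / r))) by (unfold Rdiv; ring). lra. }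
  assert (Bd : forall x y, x ^ 2 + y ^ 2 = b ^ 2 ->
    comp2 v (x, y) = V b * (x / b) /\ comp1 v (x, y) = V b * (- y / b)).
  { intros x y E.
    assert (L1 := bd_lim_continuous_on b (comp1 v) (comp1 v) x y hb (fun _ _ => eq_refl) K1 E).
    assert (L2 := bd_lim_continuous_on b (comp2 v) (comp2 v) x y hb (fun _ _ => eq_refl) K2 E).
    assert (Lb := bd_lim_continuous_on b (comp2 v) (comp2 v) b 0 hb (fun _ _ => eq_refl) K2 ltac:(ring)).
    assert (Ray : forall s, 0 < s < 1 -> comp2 v ((1 - s) * x, (1 - s) * y) = comp2 v ((1 - s) * b, (1 - s) * 0) * (x / b)
      /\ comp1 v ((1 - s) * x, (1 - s) * y) = comp2 v ((1 - s) * b, (1 - s) * 0) * (- y / b)).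
    { intros s Hs. destruct (pdisc_shrink b x y s hb E Hs) as [P Q]. destruct (In _ _ P) as [A1 A2].
      assert (R : sqrt (((1 - s) * x) ^ 2 + ((1 - s) * y) ^ 2) = (1 - s) * b).
      { rewrite Q. apply sqrt_pow2. nra. }
      rewrite R in A1, A2. rewrite Rmult_0_r. fold (V ((1 - s) * b)). rewrite A1, A2. split; field; lra. }
    split.
    - apply (bd_lim_ray b _ _ x y (x / b) _ _ hb E L2 Lb). intros s Hs. now apply Ray.
    - apply (bd_lim_ray b _ _ x y (- y / b) _ _ hb E L1 Lb). intros s Hs. now apply Ray. }
  assert (All : forall x y, closed_punctured_disc b (x, y) ->
    comp2 v (x, y) = V (enorm (x, y)) * (x / enorm (x, y)) /\ comp1 v (x, y) = V (enorm (x, y)) * (- y / enorm (x, y))).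
  { intros x y P. apply closed_punctured_disc_iff in P; [|exact hb].
    destruct P as [P0 [L|E]]; [now apply In|]. rewrite (enorm_circle b x y hb E). now apply Bd. }
  (* Inside, V r = 0 would be a critical point of u; V b = 0 would make all of C_b stagnant, against
     the non-stagnation point. *)
  assert (VNZ : forall r, 0 < r <= b -> V r <> 0).
  { intros r [r0 [L| ->]] Z.
    - assert (P : pdisc b r 0) by (split; nra).
      destruct (In r 0 P) as [A1 A2].
      assert (R : sqrt (r ^ 2 + 0 ^ 2) = r).
      { replace (r ^ 2 + 0 ^ 2) with (r ^ 2) by ring. apply sqrt_pow2. lra. }
      rewrite R, Z in A1, A2.
      destruct (fl_nocrit F r 0 P); lra.
    - destruct (fl_nonstag F) as [x [y [lp [lq [E [Lp [Lq N]]]]]]].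
      assert (L1 := bd_lim_continuous_on b (comp1 v) (comp1 v) x y hb (fun _ _ => eq_refl) K1 E).
      assert (L2 := bd_lim_continuous_on b (comp2 v) (comp2 v) x y hb (fun _ _ => eq_refl) K2 E).
      destruct (Bd x y E) as [A1 A2]. rewrite Z in A1, A2.
      rewrite (bd_lim_unique b _ x y _ _ hb E Lp L2) in N.
      rewrite (bd_lim_unique b _ x y _ _ hb E Lq (bd_lim_opp b _ x y _ L1)) in N. lra. }
  assert (CV := continuous_on_axis b _ hb K2).
  split; [|split].
  - intros [x y] P. destruct (All x y P) as [A1 A2].
    assert (P' := P). unfold closed_punctured_disc in P'. assert (NZ := VNZ _ P').
    set (r := enorm (x, y)) in *.
    destruct (sqrt_pos (fst (v (x, y)) ^ 2 + snd (v (x, y)) ^ 2)) as [L|Z]; [exact L|exfalso].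
    assert (Z' : enorm (v (x, y)) = 0) by (symmetry; exact Z).
    unfold comp1, comp2 in A1, A2. destruct (v (x, y)) as [w1 w2]. cbn [fst snd] in A1, A2.
    apply enorm_zero in Z'. destruct Z' as [-> ->].
    assert (X0 : x = 0).
    { symmetry in A1. apply Rmult_integral in A1. destruct A1 as [A1|A1]; [easy|].
      replace x with (x / r * r) by (field; lra). rewrite A1. ring. }
    assert (Y0 : y = 0).
    { symmetry in A2. apply Rmult_integral in A2. destruct A2 as [A2|A2]; [easy|].
      replace y with (- (- y / r) * r) by (field; lra). rewrite A2. ring. }
    apply closed_punctured_disc_iff in P; [|exact hb]. rewrite X0, Y0 in P. lra.
  - intros [x y] P. destruct (All x y P) as [A1 A2]. destruct P as [P _].
    unfold dot, e_r. cbn [fst snd]. fold (comp1 v (x, y)) (comp2 v (x, y)). rewrite A1, A2. field. lra.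
  - exists V. split; [|split].
    + split; [|split; [exact CV|split; [exact (extends_axis b _ hb E21)|exact (extends_axis b _ hb E211)]]].
      intros r Hr. assert (P : punctured_disc b (r, 0)) by (apply punctured_disc_iff; [exact hb|split; nra]).
      split; [apply (C2 (r, 0) P)|apply (C21 (r, 0) P)].
    + now apply constant_sign.
    + intros [x y] P. destruct (All x y P) as [A1 A2]. unfold e_theta. cbn [fst snd]. unfold comp1, comp2 in A1, A2.
      rewrite (surjective_pairing (v (x, y))) at 1. now rewrite <- A1, <- A2.
Qed.
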